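(* Let $M^n$ be a compact manifold and let $(g(t),\varphi(t))$ be a solution on $M^n$ of the rescaled List's extended Ricci flow $$\frac{\partial}{\partial t}g_{ij}=-2\left(S_{ij}-\frac{r}{n}g_{ij}\right),\qquad \varphi_t=\Delta\varphi,$$ where $r=r(t)$ is a function depending only on $t$. Let $\lambda^{-\Delta}(t)$ be the eigenvalue of the operator $-\Delta$ corresponding to the normalized eigenfunction $u$, that is, $$-\Delta u=\lambda^{-\Delta}u,\qquad \int_M u^2\,dv=1.$$ Then $$\frac{d}{dt}\lambda^{-\Delta}=-\frac{2r}{n}\lambda^{-\Delta}+\int_M\left(\lambda^{-\Delta}Su^2-S|\nabla u|^2+2S^{ij}u_iu_j\right)dv.$$
   Context: $M^n$ is a compact $n$-dimensional manifold (without boundary); $g(t)$ is a smooth family of Riemannian metrics and $\varphi=\varphi(t)$ a smooth family of real functions on $M$; $\alpha>0$ is a fixed real constant. $\Delta$, $\nabla$, $dv$ are the Laplacian, gradient and volume element of $g(t)$; $R_{ij}$ is the Ricci tensor, $R$ the scalar curvature. Subscripts on functions denote covariant derivatives ($u_i=\nabla_iu$, $\varphi_i=\nabla_i\varphi$); indices are raised with $g(t)$. Define $S_{ij}=R_{ij}-\alpha\varphi_i\varphi_j$ and $S=g^{ij}S_{ij}=R-\alpha|\nabla\varphi|^2$. The eigenvalue and its normalized eigenfunction $u$ are taken at each time $t$ with respect to $g(t)$ and are understood to depend differentiably on $t$. *)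

(* Defs.v *)
From HB Require Import structures.
From mathcomp Require Export all_boot all_order all_algebra.
From mathcomp Require Export all_classical all_reals all_analysis.

Set Implicit Arguments.
Unset Strict Implicit.
Unset Printing Implicit Defensive.

Export Order.TTheory GRing.Theory Num.Theory.
Export numFieldNormedType.Exports.

Local Open Scope classical_set_scope.
Local Open Scope ring_scope.

Section Smooth.
Context {R : realType} {V W : normedModType R}.

Definition iter_derive (s : seq V) (f : V -> W) : V -> W :=
  foldr (fun v h x => 'D_v h x) f s.

(* For D open in a finite-dimensional V this is C^oo on D: all iterated
   directional derivatives exist and are continuous at the points of D. *)
Definition smooth_on (D : set V) (f : V -> W) : Prop :=
  forall (s : seq V) (x : V), D x ->
    {for x, continuous (iter_derive s f)} /\
    forall v : V, derivable (iter_derive s f) x v.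

End Smooth.

(* A smooth atlas of dimension n without boundary on M.  [chart a] is only
   meaningful on [chart_dom a], and [param a] is its inverse, only meaningful on
   the image of [chart_dom a].  [chart_at p] is a preferred chart around p, used
   to evaluate at p scalars that are given by formulas in coordinates. *)
Record smooth_atlas (R : realType) (n : nat) (M : ptopologicalType) := SmoothAtlas {
  chart_index : Type ;
  chart_dom : chart_index -> set M ;
  chart : chart_index -> M -> 'rV[R]_n ;
  param : chart_index -> 'rV[R]_n -> M ;
  chart_at : M -> chart_index ;
  chart_at_dom : forall p, chart_dom (chart_at p) p ;
  chart_dom_open : forall a, open (chart_dom a) ;
  chart_cod_open : forall a, open (chart a @` chart_dom a) ;
  chartK : forall a p, chart_dom a p -> param a (chart a p) = p ;
  chart_continuous : forall a p, chart_dom a p -> {for p, continuous (chart a)} ;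
  param_continuous : forall a x, (chart a @` chart_dom a) x ->
    {for x, continuous (param a)} ;
  transition_smooth : forall a b,
    smooth_on (chart a @` (chart_dom a `&` chart_dom b)) (chart b \o param a)
}.

Definition chart_cod (R : realType) (n : nat) (M : ptopologicalType)
    (A : smooth_atlas R n M) (a : chart_index A) : set 'rV[R]_n :=
  chart a @` chart_dom a.

(* Riemannian geometry in one coordinate system: G x is the matrix (g_ij) of the
   metric at the point of coordinates x, f is a function of the coordinates. *)
Section Coordinates.
Context {R : realType} {n : nat}.
Implicit Types (G : 'rV[R]_n -> 'M[R]_n) (f : 'rV[R]_n -> R) (x : 'rV[R]_n).

Definition partial (i : 'I_n) f x : R := 'D_(delta_mx 0 i) f x.

Definition metric_inv G x : 'M[R]_n := invmx (G x).

(* Gamma^k_ij *)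
Definition christoffel G (k i j : 'I_n) x : R :=
  2^-1 * \sum_l metric_inv G x k l *
    (partial i (fun y => G y j l) x + partial j (fun y => G y i l) x
     - partial l (fun y => G y i j) x).

(* R^l_kij, with R(d_i, d_j) d_k = R^l_kij d_l *)
Definition riemann G (l k i j : 'I_n) x : R :=
  partial i (christoffel G l j k) x - partial j (christoffel G l i k) x
  + \sum_m (christoffel G l i m x * christoffel G m j k x
            - christoffel G l j m x * christoffel G m i k x).

Definition ricci G (j k : 'I_n) x : R := \sum_i riemann G i k i j x.

(* nabla_i nabla_j f *)
Definition hessian G f (i j : 'I_n) x : R :=
  partial i (partial j f) x - \sum_k christoffel G k i j x * partial k f x.

Definition laplacian G f x : R :=
  \sum_i \sum_j metric_inv G x i j * hessian G f i j x.

(* |nabla f|^2 *)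
Definition grad_sq G f x : R :=
  \sum_i \sum_j metric_inv G x i j * partial i f x * partial j f x.

(* S_ij = R_ij - alpha phi_i phi_j *)
Definition S_tensor (alpha : R) G f (i j : 'I_n) x : R :=
  ricci G i j x - alpha * partial i f x * partial j f x.

(* S = g^ij S_ij *)
Definition S_scalar (alpha : R) G f x : R :=
  \sum_i \sum_j metric_inv G x i j * S_tensor alpha G f i j x.

(* S^ij = g^ik g^jl S_kl *)
Definition S_raised (alpha : R) G f (i j : 'I_n) x : R :=
  \sum_k \sum_l
    metric_inv G x i k * metric_inv G x j l * S_tensor alpha G f k l x.

(* S^ij u_i u_j, where S is built from f *)
Definition S_grad_grad (alpha : R) G f (u : 'rV[R]_n -> R) x : R :=
  \sum_i \sum_j S_raised alpha G f i j x * partial i u x * partial j u x.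

End Coordinates.

(* The Lebesgue integral over R^n of a nonnegative Borel function, as an
   iterated integral (Tonelli). *)
Fixpoint lebesgue_integral_rV (R : realType) (n : nat) :
    ('rV[R]_n -> \bar R) -> \bar R :=
  match n with
  | 0 => fun h => h 0
  | m.+1 => fun h => (\int[@lebesgue_measure R]_s
      lebesgue_integral_rV (fun y : 'rV[R]_m =>
        h (row_mx (const_mx s : 'rV[R]_1) y : 'rV[R]_(1 + m))))%E
  end.

(* M with its Borel sigma-algebra *)
Definition borelType (M : ptopologicalType) := g_sigma_algebraType (@open M).

Section Manifold.
Context {R : realType} {n : nat} {M : ptopologicalType}.
Variable A : smooth_atlas R n M.

(* Covariant 2-tensor fields, given by their components in each chart. *)
Definition tensor2 := chart_index A -> 'rV[R]_n -> 'M[R]_n.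

(* Recall that [jacobian] acts on row vectors: 'd f x v = v *m jacobian f x. *)
Definition riemannian_metric (g : tensor2) : Prop :=
  [/\ forall a x, chart_cod a x -> (g a x)^T = g a x,
      forall a x (v : 'rV[R]_n), chart_cod a x -> v != 0 ->
        0 < (v *m g a x *m v^T) 0 0 &
      forall a b p, chart_dom a p -> chart_dom b p ->
        let J := jacobian (chart b \o param a) (chart a p) in
        g a (chart a p) = J *m g b (chart b p) *m J^T ].

Definition smooth_metric_family (I : set R) (g : R -> tensor2) : Prop :=
  (forall t, I t -> riemannian_metric (g t)) /\
  forall a i j, smooth_on (I `*` chart_cod a)
    (fun z : R * 'rV[R]_n => g z.1 a z.2 i j).

Definition smooth_function_family (I : set R) (f : R -> M -> R) : Prop :=
  forall a : chart_index A, smooth_on (I `*` chart_cod a)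
    (fun z : R * 'rV[R]_n => f z.1 (param a z.2)).

(* f(t) is C^2 on M and depends differentiably on t: the spatial derivatives of
   f(t) of order at most 2 are differentiable in t, and continuous in (t, x). *)
Definition differentiable_C2_family (I : set R) (f : R -> M -> R) : Prop :=
  forall (a : chart_index A) (s : seq 'rV[R]_n), (size s <= 2)%N ->
  forall t x, I t -> chart_cod a x ->
  [/\ (size s < 2)%N -> forall v : 'rV[R]_n,
        derivable (iter_derive s (f t \o param a)) x v,
      {for (t, x), continuous (fun z : R * 'rV[R]_n =>
        iter_derive s (f z.1 \o param a) z.2)} &
      derivable (fun t' => iter_derive s (f t' \o param a) x) t 1 ].

(* dv = sqrt(det g_ij) dx^1 ... dx^n in every chart; as the chart domains cover
   M, at most one Borel measure (on compact M, exactly one) has this property. *)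
Definition riemannian_volume (g : tensor2)
    (dv : {measure set (borelType M) -> \bar R}) : Prop :=
  forall a (B : set (borelType M)), measurable B -> B `<=` chart_dom a ->
    dv B = lebesgue_integral_rV (fun x =>
      (\1_(chart a @` B) x * Num.sqrt (\det (g a x)))%:E).

Definition rescaled_List_flow (alpha : R) (I : set R) (r : R -> R)
    (g : R -> tensor2) (phi : R -> M -> R) : Prop :=
  forall t a x, I t -> chart_cod a x ->
  (forall i j, is_derive t 1 (fun t' => g t' a x i j)
     (- 2 * (S_tensor alpha (g t a) (phi t \o param a) i j x
             - r t / n%:R * g t a x i j))) /\
  is_derive t 1 (fun t' => phi t' (param a x))
    (laplacian (g t a) (phi t \o param a) x).

(* u satisfies - Delta u = lambda u and has unit L^2 norm. *)
Definition normalized_eigenfunction (g : tensor2)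
    (dv : {measure set (borelType M) -> \bar R}) (lambda : R) (u : M -> R) :
    Prop :=
  (forall a x, chart_cod a x ->
     - laplacian (g a) (u \o param a) x = lambda * u (param a x)) /\
  \int[dv]_p (u p ^+ 2) = 1.

(* The scalar field on M with local expression F a x in the chart a (at the
   coordinates x), F being independent of a. *)
Definition scalar_at (F : chart_index A -> 'rV[R]_n -> R) (p : M) : R :=
  F (chart_at A p) (chart (chart_at A p) p).

Definition S_field (alpha : R) (g : tensor2) (phi : M -> R) : M -> R :=
  scalar_at (fun a => S_scalar alpha (g a) (phi \o param a)).

Definition grad_sq_field (g : tensor2) (u : M -> R) : M -> R :=
  scalar_at (fun a => grad_sq (g a) (u \o param a)).

Definition S_grad_grad_field (alpha : R) (g : tensor2) (phi u : M -> R) :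
    M -> R :=
  scalar_at (fun a => S_grad_grad alpha (g a) (phi \o param a) (u \o param a)).

End Manifold.

(* Main.v *)
From HB Require Import structures.
From mathcomp Require Import perm ring lra measurable_realfun.
Require Import Defs.

Set Implicit Arguments.
Unset Strict Implicit.
Unset Printing Implicit Defensive.

Local Open Scope classical_set_scope.
Local Open Scope ring_scope.

(** Fix a time t0 and write u0 = u(t0), l0 = lambda(t0), h = dg/dt at t0.  All
    the time dependence that has to be differentiated can be moved into the
    metric.  Test the eigenvalue equation of u(t), at time t, against u0, and
    that of u0, at time t0, against u(t); Green's formula ([green]) gives
<<
  lambda(t) int u0 u(t) dv_t  = int <grad u0, grad u(t)>_t  dv_t,
  l0        int u(t) u0 dv_t0 = int <grad u(t), grad u0>_t0 dv_t0.
>>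
    Subtracting and regrouping,
<<
  (lambda(t) - l0) B(t) = (t - t0) N(t),    B(t) = int u0 u(t) dv_t,
>>
    where N(t) integrates the difference quotients in time of the coefficients
    sqrt(det g) g^ij and sqrt(det g) against products of u0, u(t) and of their
    first derivatives.  The metric is smooth, and u(t) and its derivatives are
    continuous in (t, x); so these integrands converge uniformly on compact
    sets ([quotient_continuous], [integral_limit]), B(t) tends to 1 and N(t) to
    N(t0).  Hence lambda is differentiable at t0 ([is_derive_of_quotient]) with
<<
  lambda'(t0) = N(t0)
    = int (tr h / 2 (|grad u0|^2 - l0 u0^2) - h(grad u0, grad u0)) dv.
>>
    Along the flow h = - 2 S_ij + (2 r / n) g_ij and tr h = - 2 S + 2 r.  The
    terms in S are those of the claim, and since int u0^2 = 1 and
    int |grad u0|^2 = l0, the terms in r add up to - (2 r / n) l0.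

    The integrals over M are cut by a partition of unity
    ([partition_of_unity], [integral_partition]) into Lebesgue integrals over
    coordinate domains.  The volume measure is given by its values on Borel
    sets; [integral_transfer] passes from sets to functions.  In a chart,
    Green's formula follows from the divergence form of the Laplacian
    ([laplacian_divergence]) and from the vanishing of the integral of a
    partial derivative of a compactly supported function
    ([integral_partial_eq0]). *)

(** * Borel sets and Lebesgue measure on row vectors *)

Lemma borel_open (T : ptopologicalType) (O : set T) :
  open O -> measurable (O : set (borelType T)).
Proof. by move=> oO; apply: sub_sigma_algebra. Qed.

Lemma continuous_borel (R : realType) (T : ptopologicalType) (f : T -> R) :
  continuous f -> measurable_fun [set: borelType T] f.
Proof.
move=> cf; apply: (@measurability _ _ _ _ _ _ _ (measurable_realfun.RGenOpens.measurableE R)).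
move=> _ [_ [a [b ->]] <-]; rewrite setTI.
by apply: borel_open; move/continuousP : cf; apply; exact: interval_open.
Qed.

Section BorelRow.
Context {R : realType}.

(** Balls for the sup norm are cubes, so a function into R^n whose coordinates are
    measurable pulls them back to measurable sets; countably many of them are
    enough to exhaust an open set. *)
Lemma open_rV_bigcup_rat n (O : set 'rV[R]_n) : open O ->
  O = \bigcup_(qk in [set qk : 'rV[rat]_n * nat |
        ball (map_mx ratr qk.1 : 'rV[R]_n) qk.2.+1%:R^-1 `<=` O])
      ball (map_mx ratr qk.1 : 'rV[R]_n) qk.2.+1%:R^-1.
Proof.
move=> oO; apply/seteqP; split=> [x Ox|x [[q k] /= + qx]]; last exact.
have /nbhs_ballP[e /= e0 xeO] : nbhs x O by exact: open_nbhs_nbhs.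
have e20 : 0 < e / 2 by rewrite divr_gt0.
have [k _ ke] := near_infty_natSinv_lt (PosNum e20).
pose d := k.+1%:R^-1 : R.
have kd : d + d <= e by have := ke k (leqnn k); rewrite /= -/d; lra.
have d0 : 0 < d by rewrite invr_gt0.
have qP i : {q : rat | `|x 0 i - ratr q| < d}.
  apply: cid.
  have : x 0 i - d < x 0 i + d by lra.
  move=> /rat_in_itvoo[q]; rewrite in_itv/= => /andP[q1 q2].
  by exists q; rewrite ltr_norml; apply/andP; split; lra.
have xq : ball (map_mx ratr (\row_i sval (qP i)) : 'rV[R]_n) d x.
  split=> // i j; rewrite ord1 !mxE /ball/= distrC.
  by case: (qP j).
exists (\row_i sval (qP i), k) => //= y qy; apply: xeO.
by apply: le_ball kd _ _; apply: ball_triangle qy; apply: ball_sym.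
Qed.

Lemma measurable_fun_rV d (T : measurableType d) n (f : T -> 'rV[R]_n) :
  (forall i, measurable_fun [set: T] (fun t => f t 0 i)) ->
  measurable_fun [set: T] (f : T -> borelType 'rV[R]_n).
Proof.
move=> mf; apply: (@measurability _ _ _ (borelType 'rV[R]_n) _ _ (@open 'rV[R]_n) erefl).
move=> _ [U oU <-]; rewrite setTI (open_rV_bigcup_rat oU) preimage_bigcup.
rewrite bigcup_mkcond; apply: countable_bigcupT_measurable => [|qk]; first exact: countableP.
case: ifPn => // _.
have -> : f @^-1` ball (map_mx ratr qk.1 : 'rV[R]_n) qk.2.+1%:R^-1 =
    \bigcap_(i in [set: 'I_n])
      (fun t => f t 0 i) @^-1` ball (ratr (qk.1 0 i) : R) qk.2.+1%:R^-1.
  apply/seteqP; split=> [t [_ H] i _|t H] /=.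
    by have := H 0 i; rewrite mxE.
  by split=> [|i j]; [rewrite invr_gt0|rewrite ord1 mxE; exact: H].
apply: fin_bigcap_measurable => // i _; rewrite -[X in measurable X]setTI.
by apply: mf => //; apply: measurable_realfun.measurable_ball.
Qed.

(** The splitting R^(1+m) = R x R^m by which [lebesgue_integral_rV] iterates
    one-dimensional integrals. *)
Definition rV_cons m (z : R * 'rV[R]_m) : 'rV[R]_m.+1 :=
  row_mx (const_mx z.1 : 'rV[R]_1) z.2.

Definition rV_uncons m (x : 'rV[R]_m.+1) : R * 'rV[R]_m :=
  (x 0 0, @rsubmx R 1 1 m x).

Lemma rV_cons0 m (z : R * 'rV[R]_m) : rV_cons z 0 0 = z.1.
Proof.
have := @row_mxEl R 1 1 m (const_mx z.1) z.2 0 0; rewrite [RHS]mxE => <-.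
by congr (row_mx _ _ _ _); exact: (@ord_inj m.+1).
Qed.

Lemma rV_consS m (z : R * 'rV[R]_m) i : rV_cons z 0 (lift ord0 i) = z.2 0 i.
Proof.
rewrite -(@row_mxEr R 1 1 m (const_mx z.1) z.2 0 i).
by congr (row_mx _ _ _ _); exact: (@ord_inj m.+1).
Qed.

Lemma rV_consK m : cancel (@rV_cons m) (@rV_uncons m).
Proof.
move=> [s y]; rewrite /rV_uncons rV_cons0/=; congr pair.
by rewrite /rV_cons row_mxKr.
Qed.

Lemma measurable_coord n (i : 'I_n) :
  measurable_fun [set: borelType 'rV[R]_n] (fun x : borelType 'rV[R]_n => x 0 i).
Proof. by apply: (@continuous_borel R 'rV[R]_n); exact: coord_continuous. Qed.

Lemma measurable_rV_cons m :
  measurable_fun [set: R * borelType 'rV[R]_m]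
    (@rV_cons m : _ -> borelType 'rV[R]_m.+1).
Proof.
apply: measurable_fun_rV => i; case: (unliftP ord0 i) => [j ->|->].
  rewrite (_ : (fun _ => _) = (fun y : 'rV[R]_m => y 0 j) \o snd); last first.
    by apply/funext => z; rewrite rV_consS.
  apply: measurableT_comp measurable_snd.
  exact: measurable_coord.
rewrite (_ : (fun _ => _) = fst); first exact: measurable_fst.
by apply/funext => z; rewrite rV_cons0.
Qed.

Lemma measurable_rV_uncons m :
  measurable_fun [set: borelType 'rV[R]_m.+1]
    (@rV_uncons m : _ -> R * borelType 'rV[R]_m).
Proof.
apply/measurable_fun_pairP; split; first exact: measurable_coord.
apply: measurable_fun_rV => i; under eq_fun do rewrite mxE.
exact: measurable_coord.
Qed.

End BorelRow.

Section LebesgueSucc.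
Context {R : realType} (m : nat).
Variable mu : {sigma_finite_measure set (borelType 'rV[R]_m) -> \bar R}.

Definition lebesgue_succ : set (borelType 'rV[R]_m.+1) -> \bar R :=
  pushforward (@lebesgue_measure R \x mu)%E
    (@rV_cons R m : measurableTypeR R * borelType 'rV[R]_m -> borelType _).

Let lebesgue_succ0 : lebesgue_succ set0 = 0%E.
Proof. by rewrite /lebesgue_succ /pushforward preimage_set0 measure0. Qed.

Let lebesgue_succ_ge0 B : (0 <= lebesgue_succ B)%E.
Proof. by rewrite /lebesgue_succ /pushforward measure_ge0. Qed.

Let lebesgue_succ_sigma_additive : semi_sigma_additive lebesgue_succ.
Proof.
by apply: measure_semi_sigma_additive; exact: measurable_rV_cons.
Qed.

HB.instance Definition _ := isMeasure.Build _ _ _ lebesgue_succ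
  lebesgue_succ0 lebesgue_succ_ge0 lebesgue_succ_sigma_additive.

Let lebesgue_succ_sigma_finite : sigma_finite setT lebesgue_succ.
Proof.
have /sigma_finiteP[F [FT ndF Foo]] := sigma_finiteT (@lebesgue_measure R).
have /sigma_finiteP[G [GT ndG Goo]] := sigma_finiteT mu.
exists (fun k => @rV_uncons R m @^-1` (F k `*` G k)).
  apply/esym; rewrite -subTset => x _.
  have [i _ Fi] : (\bigcup_i F i) (rV_uncons x).1 by rewrite -FT.
  have [j _ Gj] : (\bigcup_i G i) (rV_uncons x).2 by rewrite -GT.
  exists (maxn i j) => //; split.
    by apply: (subsetPset _ _ (ndF _ _ (leq_maxl i j))).
  by apply: (subsetPset _ _ (ndG _ _ (leq_maxr i j))).
move=> k; have [mF Fk] := Foo k; have [mG Gk] := Goo k.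
have mFG : measurable (F k `*` G k) by exact: measurableX.
split.
  rewrite -[X in measurable X]setTI.
  exact: (@measurable_rV_uncons R m measurableT _ mFG).
rewrite /lebesgue_succ /pushforward -comp_preimage.
rewrite (_ : _ \o _ = id); last by apply/funext => z /=; rewrite rV_consK.
by rewrite preimage_id product_measure1E// lte_mul_pinfty// ge0_fin_numE.
Qed.

HB.instance Definition _ := Measure_isSigmaFinite.Build _ _ _ lebesgue_succ
  lebesgue_succ_sigma_finite.

End LebesgueSucc.

Section LebesgueZero.
Context {R : realType}.

Definition lebesgue_zero : set (borelType 'rV[R]_0) -> \bar R := @dirac _ (borelType 'rV[R]_0) (0 : 'rV[R]_0) R.
HB.instance Definition _ := Measure.on lebesgue_zero.
Let lebesgue_zero_sigma_finite : sigma_finite setT lebesgue_zero.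
Proof.
exists (fun=> setT); first by rewrite bigcup_const.
by move=> _; rewrite /lebesgue_zero diracT ltry.
Qed.
HB.instance Definition _ := Measure_isSigmaFinite.Build _ _ _ lebesgue_zero
  lebesgue_zero_sigma_finite.
End LebesgueZero.

(** The measure behind the iterated integral [lebesgue_integral_rV]
    ([lebesgue_integral_rVE]); with a sigma-finite measure at hand, signed
    functions, monotone convergence and Fubini's theorem become available. *)
Fixpoint lebesgue_rV (R : realType) (n : nat) :
    {sigma_finite_measure set (borelType 'rV[R]_n) -> \bar R} :=
  match n with
  | 0 => @lebesgue_zero R
  | m.+1 => lebesgue_succ (lebesgue_rV R m)
  end.

Section LebesgueRV.
Context {R : realType}.
Local Open Scope ereal_scope.

Lemma ge0_integral_rV_cons m (h : borelType 'rV[R]_m.+1 -> \bar R) :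
  (forall x, 0 <= h x) -> measurable_fun [set: borelType 'rV[R]_m.+1] h ->
  \int[lebesgue_rV R m.+1]_x h x =
  \int[(@lebesgue_measure R \x lebesgue_rV R m)]_z h (rV_cons z).
Proof.
move=> h0 mh; rewrite [LHS](@ge0_integral_pushforward _ _ (measurableTypeR R * borelType 'rV[R]_m)%type
  (borelType 'rV[R]_m.+1) _ (@rV_cons R m))//=.
exact: measurable_rV_cons.
Qed.

Lemma integral_rV_cons m (h : borelType 'rV[R]_m.+1 -> \bar R) :
  (lebesgue_rV R m.+1).-integrable setT h ->
  (@lebesgue_measure R \x lebesgue_rV R m).-integrable setT (h \o @rV_cons R m) /\
  \int[lebesgue_rV R m.+1]_x h x =
  \int[(@lebesgue_measure R \x lebesgue_rV R m)]_z h (rV_cons z).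
Proof.
move=> ih; have mh := measurable_int _ ih.
have i2 : (@lebesgue_measure R \x lebesgue_rV R m).-integrable setT (h \o @rV_cons R m).
  apply/integrableP; split.
    by apply: measurableT_comp => //; exact: measurable_rV_cons.
  case/integrableP : ih => _; rewrite ge0_integral_rV_cons//.
  exact: measurableT_comp.
split=> //; rewrite [LHS](@integral_pushforward _ _ (measurableTypeR R * borelType 'rV[R]_m)%type
  (borelType 'rV[R]_m.+1) _ (@rV_cons R m))//=.
exact: measurable_rV_cons.
Qed.

Lemma lebesgue_integral_rVE n (h : borelType 'rV[R]_n -> \bar R) :
  (forall x, 0 <= h x) -> measurable_fun [set: borelType 'rV[R]_n] h ->
  lebesgue_integral_rV h = \int[lebesgue_rV R n]_x h x.
Proof.
elim: n h => [|m IHm] h h0 mh /=.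
  by rewrite integral_dirac// diracT mul1e.
have mh' : measurable_fun [set: R * borelType 'rV[R]_m] (h \o @rV_cons R m).
  by apply: measurableT_comp => //; exact: measurable_rV_cons.
rewrite ge0_integral_rV_cons// fubini_tonelli1//=; apply: eq_integral => s _.
apply: IHm => // /=.
exact: (measurable_fun_pair2 s mh').
Qed.

Lemma lebesgue_rV_bounded n (B : set 'rV[R]_n) (k : R) :
  (forall x, B x -> forall i, (`|x 0 i| <= k)%R) -> measurable (B : set (borelType 'rV[R]_n)) ->
  lebesgue_rV R n B < +oo.
Proof.
pose Q j : set 'rV[R]_j := [set x | forall i, (`|x 0 i| <= k)%R].
have mQ j : measurable (Q j : set (borelType _)).
  have -> : Q j = \bigcap_(i in [set: 'I_j]) (fun x : 'rV[R]_j => x 0%R i) @^-1` `[(- k)%R, k]%classic.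
    apply/seteqP; split=> [x Qx i _|x Qx i] /=; first by rewrite in_itv/= -ler_norml.
    by have := Qx i I; rewrite /= in_itv/= -ler_norml.
  apply: fin_bigcap_measurable => // i _; rewrite -[X in measurable X]setTI.
  exact: (measurable_coord i measurableT (measurable_itv _)).
move=> BQ mB; apply: (@le_lt_trans _ _ (lebesgue_rV R n (Q n))).
  by apply: le_measure; [rewrite inE|rewrite inE; exact: mQ|exact: BQ].
elim: n {B BQ mB} => [|m IHm] /=; first by rewrite /lebesgue_zero diracE ltry.
rewrite /lebesgue_succ /pushforward.
have -> : @rV_cons R m @^-1` Q m.+1 = `[(- k)%R, k]%classic `*` Q m.
  apply/seteqP; split=> [[s y] Qsy|[s y] [/= ks Qy] i].
    split=> /=; first by have := Qsy 0%R; rewrite rV_cons0 in_itv/= ler_norml.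
    by move=> i; have := Qsy (lift ord0 i); rewrite rV_consS.
  case: (unliftP ord0 i) => [j ->|->]; first by rewrite rV_consS; exact: Qy.
  by rewrite rV_cons0 ler_norml; move: ks; rewrite in_itv.
rewrite product_measure1E//; last exact: mQ.
rewrite [X in X * _](_ : _ = (@lebesgue_measure R) `[(- k)%R, k]%classic)//.
apply: lte_mul_pinfty => //; rewrite lebesgue_measure_itv/=.
  by case: ifP.
Qed.
End LebesgueRV.

(** * Calculus of several variables *)

Section BigCvg.
Context {R : realType} {T : Type} {F : set_system T} {FF : Filter F}.

Lemma cvg_bigsum I (r : seq I) (P : pred I) (f : I -> T -> R) (l : I -> R) :
  (forall i, P i -> f i x @[x --> F] --> l i) ->
  \sum_(i <- r | P i) f i x @[x --> F] --> \sum_(i <- r | P i) l i.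
Proof.
move=> fl; elim: r => [|i r IHr].
  by rewrite big_nil; under eq_fun do rewrite big_nil; exact: cvg_cst.
rewrite big_cons; under eq_fun do rewrite big_cons.
by case: ifPn => // Pi; apply: cvgD => //; exact: fl.
Qed.

Lemma cvg_bigprod I (r : seq I) (P : pred I) (f : I -> T -> R) (l : I -> R) :
  (forall i, P i -> f i x @[x --> F] --> l i) ->
  \prod_(i <- r | P i) f i x @[x --> F] --> \prod_(i <- r | P i) l i.
Proof.
move=> fl; elim: r => [|i r IHr].
  by rewrite big_nil; under eq_fun do rewrite big_nil; exact: cvg_cst.
rewrite big_cons; under eq_fun do rewrite big_cons.
by case: ifPn => // Pi; apply: cvgM => //; exact: fl.
Qed.

End BigCvg.

Section LineMVT.
Context {R : realType} {V : normedModType R}.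
Implicit Types (f : V -> R) (x v : V).

Lemma is_derive_line f x v (s : R) : derivable f (x + s *: v) v ->
  is_derive s 1 (fun s => f (x + s *: v)) ('D_v f (x + s *: v)).
Proof.
move=> df.
have E : (fun h : R => h^-1 *: ((fun s => f (x + s *: v)) (h *: 1 + s) - f (x + s *: v)))
       = (fun h : R => h^-1 *: ((f \o shift (x + s *: v)) (h *: v) - f (x + s *: v))).
  apply/funext => h /=; congr (_ *: (f _ - _)).
  by rewrite [h *: 1]mulr1 scalerDl addrCA.
split; first by rewrite /derivable /= E.
by rewrite /derive /= E.
Qed.

Lemma MVT_line f x v (h : R) :
  (forall s : R, `|s| <= `|h| -> derivable f (x + s *: v) v) ->
  exists2 s, `|s| <= `|h| & f (x + h *: v) - f x = h * 'D_v f (x + s *: v).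
Proof.
move=> df; pose g s := f (x + s *: v).
have dg (s : R) : `|s| <= `|h| -> is_derive s 1 g ('D_v f (x + s *: v)).
  by move=> /df; exact: is_derive_line.
have g0 : g 0 = f x by rewrite /g scale0r addr0.
have [h0|/ltW h0] := leP 0 h.
  have sh s : s \in `[0, h] -> `|s| <= `|h|.
    by rewrite in_itv/= => /andP[s0 sh]; rewrite !ger0_norm.
  have [||c /sh ch] := @MVT_segment R g (fun s => 'D_v f (x + s *: v)) 0 h h0.
    by move=> s /subset_itv_oo_cc/sh/dg.
    apply: derivable_within_continuous => s /sh sh'; exact: (@ex_derive _ _ _ _ _ _ _ (dg _ sh')).
  by rewrite subr0 g0 mulrC => fE; exists c.
have sh s : s \in `[h, 0] -> `|s| <= `|h|.
  by rewrite in_itv/= => /andP[hs s0]; rewrite !ler0_norm// lerN2.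
have [||c /sh ch] := @MVT_segment R g (fun s => 'D_v f (x + s *: v)) h 0 h0.
  by move=> s /subset_itv_oo_cc/sh/dg.
  by apply: derivable_within_continuous => s /sh sh'; exact: (@ex_derive _ _ _ _ _ _ _ (dg _ sh')).
rewrite sub0r g0 => fE; exists c => //.
by apply/eqP; rewrite -eqr_opp opprB [f x - _]fE mulrC mulNr.
Qed.

End LineMVT.

Section C1.
Context {R : realType}.

Lemma rV_coord_le n (h : 'rV[R]_n) i : `|h 0 i| <= `|h|.
Proof.
by rewrite [leRHS]/Num.norm /= mx_normrE; apply/bigmax_geP; right => /=; exists (0, i).
Qed.

Lemma rV_norm_le n (h : 'rV[R]_n) (e : R) : 0 <= e ->
  (forall i, `|h 0 i| <= e) -> `|h| <= e.
Proof.
move=> e0 he; rewrite [leLHS]/Num.norm /= mx_normrE; apply/bigmax_leP; split=> //.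
by move=> [i j] _ /=; rewrite ord1.
Qed.

Lemma rV_sum_delta n (h : 'rV[R]_n) : h = \sum_i h 0 i *: delta_mx 0 i.
Proof. by rewrite {1}[h]matrix_sum_delta big_ord1. Qed.

(** Go from x to x + h parallel to the axes, one coordinate at a time: on each
    leg the mean value theorem gives a partial derivative at a point close to x. *)
Lemma partials_differentiable n (f : 'rV[R]_n -> R) x :
  (forall i, \forall y \near x, derivable f y (delta_mx 0 i)) ->
  (forall i, {for x, continuous (partial i f)}) ->
  differentiable f x.
Proof.
move=> df cf; pose D (h : 'rV[R]_n) : R := \sum_i h 0 i * partial i f x.
have D_lin : linear D.
  move=> a u v; rewrite /D scaler_sumr -big_split/=; apply: eq_bigr => i _.
  by rewrite !mxE mulrDl -mulrA.
pose DlM := GRing.isLinear.Build _ _ _ _ _ D_lin.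
pose DL : {linear 'rV[R]_n -> R} := HB.pack D DlM.
have cD : continuous D.
  move=> y; apply: (@cvg_bigsum _ _ (nbhs y)) => i _; apply: cvgM; last exact: cvg_cst.
  exact: coord_continuous.
suff fD : f \o shift x = cst (f x) + D +o_ 0 id.
  have dE := @diff_unique _ _ _ f DL x cD fD.
  by apply/diff_locallyP; rewrite dE; split.
apply/eqaddoP => _/posnumP[e].
have e'0 : 0 < e%:num / n.+1%:R by rewrite divr_gt0.
have : \forall y \near x, forall i, derivable f y (delta_mx 0 i) /\
    `|partial i f x - partial i f y| <= e%:num / n.+1%:R.
  apply: (@filter_forall _ _ (fun (i : 'I_n) y => derivable f y (delta_mx 0 i) /\
    `|partial i f x - partial i f y| <= e%:num / n.+1%:R) (nbhs x)) => i.
  near=> y; split; first by near: y; exact: df.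
  by near: y; move/cvgrPdist_le : (cf i); apply.
move=> /nbhs_ballP[d /= d0 dP].
near=> h.
have hd : `|h| < d.
  near: h; apply/nbhs_ballP; exists d => //= h.
  by rewrite -ball_normE/= sub0r normrN.
(* p k keeps the first k coordinates of h: the path runs through the x + p k. *)
pose p k : 'rV[R]_n := \row_(i < n) if (i < k)%N then h 0 i else 0.
have pn : p n = h by apply/rowP => i; rewrite mxE ltn_ord.
have p0 : p 0%N = 0 by apply/rowP => i; rewrite !mxE.
have pS (k : 'I_n) : p k.+1 = p k + h 0 k *: delta_mx 0 k.
  apply/rowP => i; rewrite !mxE/= ltnS leq_eqVlt (inj_eq val_inj).
  have [->|] := eqVneq i k; first by rewrite ltnn/= add0r mulr1.
  by rewrite /= mulr0 addr0.
have near_p (k : 'I_n) s : `|s| <= `|h 0 k| ->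
    ball x d (x + p k + s *: delta_mx 0 k).
  move=> sk; rewrite -ball_normE/= -addrA opprD addNKr normrN.
  apply: le_lt_trans hd; apply: rV_norm_le => // i; rewrite !mxE/=.
  have [->|ik] := eqVneq i k.
    by rewrite ltnn add0r mulr1 (le_trans sk)// rV_coord_le.
  by rewrite mulr0 addr0; case: ifP; rewrite ?rV_coord_le// normr0.
have step (k : 'I_n) :
    `|f (x + p k.+1) - f (x + p k) - h 0 k * partial k f x| <= `|h| * (e%:num / n.+1%:R).
  have [|s sk] := @MVT_line _ _ f (x + p k) (delta_mx 0 k) (h 0 k).
    by move=> s /near_p/dP/(_ k)[].
  rewrite -addrA -pS => ->; rewrite -mulrBr normrM.
  apply: ler_pM => //; first exact: rV_coord_le.
  by rewrite distrC; have [] := dP _ (near_p _ _ sk) k.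
rewrite /= -![(_ + _ : _ -> _) _]/(_ + _) -![(- _ : _ -> _) _]/(- _) /=.
rewrite opprD addrA.
have -> : f (h + x) - cst (f x) h = \sum_(k < n) (f (x + p k.+1) - f (x + p k)).
  rewrite -(big_mkord xpredT (fun k => f (x + p k.+1) - f (x + p k))).
  by rewrite telescope_sumr//= p0 addr0 pn [x + h]addrC.
rewrite /D -sumrB; apply: (le_trans (ler_norm_sum _ _ _)).
apply: (@le_trans _ _ (\sum_(k < n) `|h| * (e%:num / n.+1%:R))).
  by apply: ler_sum => k _; exact: step.
rewrite sumr_const card_ord -[leLHS]mulr_natr.
have -> : `|h| * (e%:num / n.+1%:R) * n%:R = e%:num * `|h| * (n%:R / n.+1%:R).
  by ring.
by rewrite ler_piMr ?mulr_ge0// ler_pdivrMr// mul1r ler_nat.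
Unshelve. all: by end_near. Qed.

End C1.

Section DeriveRules.
Context {R : realType} {V : normedModType R}.
Implicit Types (x v : V).

Lemma derive_line0 (W : normedModType R) (f : V -> W) x v :
  'D_v f x = 'D_1 (fun s : R => f (s *: v + x)) 0.
Proof.
rewrite /derive; set g1 := fun h => h^-1 *: _; set g2 := fun h => h^-1 *: _.
suff -> : g1 = g2 by [].
by apply/funext => h; rewrite /g1 /g2 /= addr0 scale0r add0r [h *: 1]mulr1.
Qed.

Lemma is_derive_mul (f g : V -> R) x v df dg :
  is_derive x v f df -> is_derive x v g dg ->
  is_derive x v (fun y => f y * g y) (df * g x + f x * dg).
Proof.
move=> Df Dg; have := is_deriveM Df Dg.
by rewrite addrC [g x *: df]mulrC.
Qed.

Lemma is_derive_inv (f : V -> R) x v df : f x != 0 ->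
  is_derive x v f df -> is_derive x v (fun y => (f y)^-1) (- (f x ^- 2 * df)).
Proof.
move=> f0 [Df <-]; split; first exact: derivableV.
by rewrite deriveV// scaleNr.
Qed.

Lemma is_derive_bigsum I (r : seq I) (P : pred I) (f : I -> V -> R) (df : I -> R) x v :
  (forall i, P i -> is_derive x v (f i) (df i)) ->
  is_derive x v (fun y => \sum_(i <- r | P i) f i y) (\sum_(i <- r | P i) df i).
Proof.
move=> Df; elim: r => [|i r IHr].
  by rewrite big_nil; under eq_fun do rewrite big_nil; exact: is_derive_cst.
rewrite big_cons; under eq_fun do rewrite big_cons.
by case: ifPn => // Pi; apply: is_deriveD; exact: Df.
Qed.

Lemma is_derive_bigprod (I : eqType) (r : seq I) (f : I -> V -> R) (df : I -> R) x v :
  uniq r -> (forall i, is_derive x v (f i) (df i)) ->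
  is_derive x v (fun y => \prod_(i <- r) f i y)
    (\sum_(i <- r) df i * \prod_(j <- r | j != i) f j x).
Proof.
move=> + Df; elim: r => [_|i r IHr /= /andP[ir ur]].
  by rewrite big_nil; under eq_fun do rewrite big_nil; exact: is_derive_cst.
under eq_fun do rewrite big_cons.
apply: is_derive_eq; first exact: is_derive_mul (Df i) (IHr ur).
rewrite [in RHS]big_cons big_cons eqxx/=; congr (df i * _ + _).
  rewrite big_seq_cond [RHS]big_seq_cond; apply: eq_bigl => j.
  by case: (boolP (j \in r)) => //= jr; apply/esym; apply: contraNneq ir => <-.
rewrite mulr_sumr [LHS]big_seq_cond [RHS]big_seq_cond; apply: eq_bigr => j /andP[jr _].
rewrite big_cons ifT 1?mulrCA//.
by apply: contraNneq ir => ->.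
Qed.

Lemma is_derive_comp1 (h : R -> R) (f : V -> R) x v df dh :
  is_derive x v f df -> is_derive (f x) 1 h dh ->
  is_derive x v (fun y => h (f y)) (dh * df).
Proof.
move=> [Df <-] [Dh <-].
pose c (s : R) := f (s *: v + x).
have c0 : c 0 = f x by rewrite /c scale0r add0r.
have dc : derivable c 0 1 by exact: ((derivable1P f x v).1 Df).
have dcE : 'D_1 c 0 = 'D_v f x by rewrite derive_line0.
have dhc : derivable h (c 0) 1 by rewrite c0.
split.
  apply/derivable1P/derivable1_diffP.
  by apply: (@differentiable_comp _ _ _ _ c h); exact/derivable1_diffP.
have -> : 'D_v (fun y => h (f y)) x = 'D_1 (h \o c) 0.
  by rewrite derive_line0.
by rewrite -derive1E derive1_comp// !derive1E dcE c0.
Qed.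

(** Only one directional derivative of the inner function is given, so the chain
    rule is applied along the curve s |-> f (x + s v). *)
Lemma is_derive_comp_rV m (h : 'rV[R]_m -> R) (f : V -> 'rV[R]_m) x v (df : 'I_m -> R) :
  (forall k, is_derive x v (fun y => f y 0 k) (df k)) ->
  differentiable h (f x) ->
  is_derive x v (fun y => h (f y)) (\sum_k df k * partial k h (f x)).
Proof.
move=> Df Dh.
pose c (s : R) := f (s *: v + x).
have c0 : c 0 = f x by rewrite /c scale0r add0r.
have dck k : is_derive (0:R) 1 (fun s => c s 0 k) (df k).
  have [Dfk <-] := Df k; split; first exact: ((derivable1P (fun y => f y 0 k) x v).1 Dfk).
  by rewrite derive_line0.
have dc : derivable c 0 1.
  by apply/derivable_mxP => i j; rewrite ord1; exact: ex_derive.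
have dh : differentiable h (c 0) by rewrite c0.
have hcE : 'D_v (fun y => h (f y)) x = 'D_1 (h \o c) 0.
  by rewrite derive_line0.
have dhc : differentiable (h \o c) 0.
  by apply: differentiable_comp => //; exact/derivable1_diffP.
split; first exact/derivable1P/derivable1_diffP.
have dc' : differentiable c 0 by exact/derivable1_diffP.
rewrite hcE deriveE// diff_comp//= -(deriveE _ dc') derive_mx// c0.
set w := \matrix_(i, j) _; rewrite [w]rV_sum_delta linear_sum/=.
apply: eq_bigr => k _; rewrite linearZ/= /partial deriveE -?c0//.
by rewrite mxE (@derive_val _ _ _ _ _ _ _ (dck k)).
Qed.

End DeriveRules.

(** * Derivatives of determinants and inverse matrices *)

Section Jacobi.
Context {R : realType} {V : normedModType R} (n : nat).
Variables (x v : V) (G : V -> 'M[R]_n) (dG : 'M[R]_n).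
Hypothesis DG : forall i j, is_derive x v (fun y => G y i j) (dG i j).

(** Jacobi's formula: the product rule in the Leibniz expansion gives one
    determinant for each row i, with row i differentiated; expand it along that row. *)
Lemma is_derive_det :
  is_derive x v (fun y => \det (G y)) (\tr (dG *m \adj (G x))).
Proof.
have D : is_derive x v (fun y => \det (G y))
  (\sum_(s : 'S_n) (0 * \prod_i G x i (s i) + (-1) ^+ s *
    \sum_i dG i (s i) * \prod_(j | j != i) G x j (s j))).
  apply: is_derive_bigsum => s _; apply: is_derive_mul.
  apply: (@is_derive_bigprod _ _ _ _ (fun i y => G y i (s i))) => //.
  by rewrite /index_enum -enumT enum_uniq.
apply: is_derive_eq D _; under eq_bigr do rewrite mul0r add0r mulr_sumr.
rewrite exchange_big/= /mxtrace; apply: eq_bigr => i _.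
pose M := \matrix_(k, j) if k == i then dG i j else G x k j.
transitivity (\det M).
  apply: eq_bigr => s _; congr (_ * _); rewrite [RHS](bigD1 i)//= mxE eqxx.
  by congr (_ * _); apply: eq_bigr => j /negbTE ji; rewrite mxE ji.
rewrite (expand_det_row _ i) mxE; apply: eq_bigr => j _.
rewrite !mxE eqxx; congr (_ * _).
rewrite /cofactor; congr (_ * \det _); apply/matrixP => a b; rewrite !mxE.
by rewrite eq_sym (negbTE (neq_lift _ _)).
Qed.

Hypothesis unitG : \forall y \near x, G y \in unitmx.

(** Cramer's rule shows that the inverse is differentiable; the value of its
    derivative then comes from differentiating G G^-1 = 1. *)
Lemma is_derive_invmx i j :
  is_derive x v (fun y => invmx (G y) i j)
    (- (invmx (G x) *m dG *m invmx (G x)) i j).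
Proof.
have uG : G x \in unitmx by exact: nbhs_singleton unitG.
have ex a b : derivable (fun y => invmx (G y) a b) x v.
  have adj : derivable (fun y => \adj (G y) a b) x v.
    have -> : (fun y => \adj (G y) a b) =
        fun y => (-1) ^+ (b + a) * \sum_(s : 'S_n.-1) (-1) ^+ s *
          \prod_(k <- index_enum 'I_n.-1) G y (lift b k) (lift a (s k)).
      apply/funext => y; rewrite mxE /cofactor; congr (_ * _).
      by apply: eq_bigr => s _; congr (_ * _); apply: eq_bigr => k _; rewrite !mxE.
    apply: ex_derive; apply: is_derive_mul.
    apply: is_derive_bigsum => s _; apply: is_derive_mul.
    apply: (@is_derive_bigprod _ _ _ _ (fun k y => G y (lift b k) (lift a (s k)))) => //.
    by rewrite /index_enum -enumT enum_uniq.
  have : derivable (fun y => (\det (G y))^-1 * \adj (G y) a b) x v.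
    apply: ex_derive; apply: is_derive_mul; last exact: derivableP adj.
    by apply: is_derive_inv is_derive_det; move: uG; rewrite unitmxE unitfE.
  apply: near_eq_derivable; near=> y.
  have uGy : G y \in unitmx by near: y.
  by rewrite [in RHS]/invmx uGy [RHS]mxE.
pose dI : 'M[R]_n := \matrix_(a, b) 'D_v (fun y => invmx (G y) a b) x.
have DI a b : is_derive x v (fun y => invmx (G y) a b) (dI a b).
  by rewrite mxE; exact: derivableP.
suff dIE : dI = - (invmx (G x) *m dG *m invmx (G x)).
  by apply: is_derive_eq (DI i j) _; rewrite dIE mxE.
have : dG *m invmx (G x) + G x *m dI = 0.
  apply/matrixP => a b; rewrite !mxE.
  have D1 : is_derive x v (fun y => \sum_k G y a k * invmx (G y) k b)
      (\sum_k (dG a k * invmx (G x) k b + G x a k * dI k b)).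
    by apply: is_derive_bigsum => k _; exact: is_derive_mul.
  have D2 : is_derive x v (fun y => \sum_k G y a k * invmx (G y) k b) 0.
    apply: (@near_eq_is_derive _ _ _ (cst ((1%:M : 'M[R]_n) a b))).
      near=> y; have uGy : G y \in unitmx by near: y.
      by rewrite -(mulmxV uGy) mxE.
  by rewrite -big_split/= -(@derive_val _ _ _ _ _ _ _ D1) (@derive_val _ _ _ _ _ _ _ D2).
move=> /(congr1 (mulmx (invmx (G x)))); rewrite mulmx0 mulmxDr mulKmx// mulmxA.
by move=> /eqP; rewrite addrC addr_eq0 => /eqP.
Unshelve. all: by end_near. Qed.

Lemma is_derive_sqrt_det : 0 < \det (G x) ->
  is_derive x v (fun y => Num.sqrt (\det (G y)))
    (2^-1 * Num.sqrt (\det (G x)) * \tr (dG *m invmx (G x))).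
Proof.
move=> d0; have uG : G x \in unitmx by exact: nbhs_singleton unitG.
apply: is_derive_eq.
  exact: is_derive_comp1 is_derive_det (is_derive1_sqrt d0).
have -> : dG *m invmx (G x) = (\det (G x))^-1 *: (dG *m \adj (G x)).
  by rewrite /invmx uG scalemxAr.
rewrite mxtraceZ invfM -!mulrA; congr (_ * _).
rewrite mulrA; congr (_ * _).
have s0 : Num.sqrt (\det (G x)) != 0 by rewrite gt_eqF// sqrtr_gt0.
by rewrite -{3}(sqr_sqrtr (ltW d0)) expr2 invfM mulrA mulfV// mul1r.
Qed.

End Jacobi.

(** * Functions of class C^1 on an open set *)

Lemma near_open (T : topologicalType) (U : set T) (x : T) (P : set T) :
  open U -> U x -> (forall y, U y -> P y) -> \forall y \near x, P y.
Proof.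
by move=> oU Ux UP; apply: filterS UP _; apply: open_nbhs_nbhs.
Qed.

Lemma near_eq_continuous (T S : topologicalType) (f g : T -> S) (x : T) :
  (\forall y \near x, f y = g y) -> {for x, continuous f} -> {for x, continuous g}.
Proof.
move=> fg; rewrite /prop_for /continuous_at (nbhs_singleton fg : f x = g x) => cf.
by apply: cvg_trans cf; exact: near_eq_cvg.
Qed.

(** Rules for limits along the neighbourhoods of a point, in the pointwise form to
    which statements of continuity reduce. *)
Section CvgAt.
Context {R : realType} {T : topologicalType} (x : T).
Implicit Types (f g : T -> R) (a b : R).

Lemma cvgD_at f g a b : f y @[y --> x] --> a -> g y @[y --> x] --> b ->
  f y + g y @[y --> x] --> a + b.
Proof. exact: cvgD. Qed.

Lemma cvgB_at f g a b : f y @[y --> x] --> a -> g y @[y --> x] --> b ->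
  f y - g y @[y --> x] --> a - b.
Proof. exact: cvgB. Qed.

Lemma cvgM_at f g a b : f y @[y --> x] --> a -> g y @[y --> x] --> b ->
  f y * g y @[y --> x] --> a * b.
Proof. exact: cvgM. Qed.

Lemma cvgN_at f a : f y @[y --> x] --> a -> - f y @[y --> x] --> - a.
Proof. exact: cvgN. Qed.

Lemma cvgV_at f a : a != 0 -> f y @[y --> x] --> a -> (f y)^-1 @[y --> x] --> a^-1.
Proof. exact: cvgV. Qed.

Lemma cvg_cst_at (a : R) : a @[_ --> x] --> a.
Proof. exact: cvg_cst. Qed.

Lemma cvg_sum_at I (r : seq I) (P : pred I) (f : I -> T -> R) (l : I -> R) :
  (forall i, P i -> f i y @[y --> x] --> l i) ->
  \sum_(i <- r | P i) f i y @[y --> x] --> \sum_(i <- r | P i) l i.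
Proof. exact: cvg_bigsum. Qed.

Lemma cvg_prod_at I (r : seq I) (P : pred I) (f : I -> T -> R) (l : I -> R) :
  (forall i, P i -> f i y @[y --> x] --> l i) ->
  \prod_(i <- r | P i) f i y @[y --> x] --> \prod_(i <- r | P i) l i.
Proof. exact: cvg_bigprod. Qed.

Lemma cvg_comp_at (h : R -> R) f a : f y @[y --> x] --> a ->
  h s @[s --> a] --> h a -> h (f y) @[y --> x] --> h a.
Proof. by move=> fa ha; exact: (cvg_comp f h fa ha). Qed.

End CvgAt.

(** Class C^1 expressed by partial derivatives, which is how the coordinate
    formulas of geometry use it; [C1_differentiable] gives differentiability. *)
Definition C1_on (R : realType) n (U : set 'rV[R]_n) (f : 'rV[R]_n -> R) :=
  forall x, U x -> forall i : 'I_n,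
    derivable f x (delta_mx 0 i) /\ {for x, continuous (partial i f)}.

Section C1Theory.
Context {R : realType} {n : nat} (U : set 'rV[R]_n).
Hypothesis oU : open U.
Implicit Types f g : 'rV[R]_n -> R.

Lemma C1_is_derive f x i : C1_on U f -> U x ->
  is_derive x (delta_mx 0 i) f (partial i f x).
Proof. by move=> Cf Ux; apply: derivableP; have [] := Cf x Ux i. Qed.

Lemma C1_partial_continuous f x i : C1_on U f -> U x ->
  partial i f y @[y --> x] --> partial i f x.
Proof. by move=> Cf Ux; have [] := Cf x Ux i. Qed.

Lemma C1_differentiable f x : C1_on U f -> U x -> differentiable f x.
Proof.
move=> Cf Ux; apply: partials_differentiable => i; last first.
  exact: C1_partial_continuous.
by apply: near_open oU Ux _ => y Uy; have [] := Cf y Uy i.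
Qed.

Lemma C1_continuous f x : C1_on U f -> U x ->
  f y @[y --> x] --> f x.
Proof. by move=> Cf Ux; exact/differentiable_continuous/C1_differentiable. Qed.

Lemma C1_onI f (D : 'I_n -> 'rV[R]_n -> R) :
  (forall x i, U x -> is_derive x (delta_mx 0 i) f (D i x)) ->
  (forall x i, U x -> D i y @[y --> x] --> D i x) -> C1_on U f.
Proof.
move=> Df cD x Ux i; split; first by have [] := Df x i Ux.
apply: near_eq_continuous (cD x i Ux); apply: near_open oU Ux _ => y Uy.
by rewrite /partial; have [_ ->] := Df y i Uy.
Qed.

Lemma C1_ext f g : (forall x, U x -> f x = g x) -> C1_on U f -> C1_on U g.
Proof.
move=> fg Cf.
have nfg x : U x -> \forall y \near x, f y = g y.
  by move=> Ux; exact: near_open oU Ux _.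
apply: (C1_onI (D := fun i x => partial i f x)).
  by move=> x i Ux; apply: near_eq_is_derive (nfg _ Ux) _; exact: C1_is_derive.
by move=> x i Ux; exact: C1_partial_continuous.
Qed.

Lemma C1_cst (c : R) : C1_on U (fun=> c).
Proof.
apply: (C1_onI (D := fun _ _ => 0)) => x i Ux.
exact: cvg_cst_at.
Qed.

Lemma C1_add f g : C1_on U f -> C1_on U g -> C1_on U (fun x => f x + g x).
Proof.
move=> Cf Cg; apply: (C1_onI (D := fun i x => partial i f x + partial i g x)).
  by move=> x i Ux; apply: is_deriveD; exact: C1_is_derive.
by move=> x i Ux; apply: cvgD_at; exact: C1_partial_continuous.
Qed.

Lemma C1_mul f g : C1_on U f -> C1_on U g -> C1_on U (fun x => f x * g x).
Proof.
move=> Cf Cg; apply: (C1_onI (D := fun i x =>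
    partial i f x * g x + f x * partial i g x)).
  by move=> x i Ux; apply: is_derive_mul; exact: C1_is_derive.
by move=> x i Ux; apply: cvgD_at; apply: cvgM_at;
  first [exact: C1_partial_continuous|exact: C1_continuous].
Qed.

Lemma C1_sum I (r : seq I) (P : pred I) (f : I -> 'rV[R]_n -> R) :
  (forall i, C1_on U (f i)) -> C1_on U (fun x => \sum_(i <- r | P i) f i x).
Proof.
move=> Cf; elim: r => [|i r IHr].
  by under eq_fun do rewrite big_nil; exact: C1_cst.
under eq_fun do rewrite big_cons.
by case: (P i) => //; exact: C1_add.
Qed.

Lemma C1_prod I (r : seq I) (P : pred I) (f : I -> 'rV[R]_n -> R) :
  (forall i, C1_on U (f i)) -> C1_on U (fun x => \prod_(i <- r | P i) f i x).
Proof.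
move=> Cf; elim: r => [|i r IHr].
  by under eq_fun do rewrite big_nil; exact: C1_cst.
under eq_fun do rewrite big_cons.
by case: (P i) => //; exact: C1_mul.
Qed.

Lemma C1_comp1 f (h dh : R -> R) : C1_on U f ->
  (forall x, U x -> is_derive (f x) 1 h (dh (f x))) ->
  (forall x, U x -> {for f x, continuous dh}) -> C1_on U (fun x => h (f x)).
Proof.
move=> Cf Dh cdh; apply: (C1_onI (D := fun i x => dh (f x) * partial i f x)).
  by move=> x i Ux; apply: is_derive_comp1; [exact: C1_is_derive|exact: Dh].
move=> x i Ux; apply: cvgM_at; last exact: C1_partial_continuous.
by apply: continuous_comp; [exact: C1_continuous|exact: cdh].
Qed.

Lemma C1_inv f : C1_on U f -> (forall x, U x -> f x != 0) ->
  C1_on U (fun x => (f x)^-1).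
Proof.
move=> Cf f0; apply: (C1_onI (D := fun i x => - ((f x)^-1 ^+ 2 * partial i f x))).
  move=> x i Ux; rewrite exprVn.
  by apply: is_derive_inv; [exact: f0|exact: C1_is_derive].
move=> x i Ux; apply: cvgN_at; apply: cvgM_at; last exact: C1_partial_continuous.
have cfV : (fun x => (f x)^-1) y @[y --> x] --> (f x)^-1.
  by apply: cvgV_at; [exact: f0|exact: C1_continuous].
exact: cvgM_at.
Qed.

Lemma C1_sqrt f : C1_on U f -> (forall x, U x -> 0 < f x) ->
  C1_on U (fun x => Num.sqrt (f x)).
Proof.
move=> Cf f0; apply: (C1_comp1 (dh := fun s => (2 * Num.sqrt s)^-1) Cf).
  by move=> x Ux; apply: is_derive1_sqrt; exact: f0.
move=> x Ux; apply: cvgV_at.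
  by rewrite mulf_neq0// gt_eqF// sqrtr_gt0 f0.
by apply: cvgM_at; [exact: cvg_cst_at|exact: sqrt_continuous].
Qed.

Lemma C1_comp_rV m (W : set 'rV[R]_m) (h : 'rV[R]_m -> R) (f : 'rV[R]_n -> 'rV[R]_m) :
  open W -> C1_on W h -> (forall k, C1_on U (fun x => f x 0 k)) ->
  (forall x, U x -> W (f x)) -> C1_on U (fun x => h (f x)).
Proof.
move=> oW Ch Cf UW; apply: (C1_onI (D := fun i x =>
  \sum_k partial i (fun x => f x 0 k) x * partial k h (f x))).
  move=> x i Ux; apply: is_derive_comp_rV => [k|].
    exact: C1_is_derive.
  apply: partials_differentiable => k.
    by apply: near_open oW (UW _ Ux) _ => y /Ch/(_ k)[].
  by have [] := Ch _ (UW _ Ux) k.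
move=> x i Ux; apply: cvg_sum_at => k _.
apply: cvgM_at; first exact: C1_partial_continuous.
apply: continuous_comp; last by have [] := Ch _ (UW _ Ux) k.
move=> A /nbhs_ballP[e /= e0 eA].
have : \forall y \near x, forall k, ball (f x 0 k) e (f y 0 k).
  apply: (@filter_forall _ _ (fun (k : 'I_m) y => ball (f x 0 k) e (f y 0 k)) (nbhs x)) => j.
  by apply: (C1_continuous (Cf j) Ux); exact: nbhsx_ballx.
by apply: filterS => y Hy; apply: eA; split=> // a b; rewrite ord1.
Qed.

Section Matrix.
Variable G : 'rV[R]_n -> 'M[R]_n.
Hypothesis CG : forall i j, C1_on U (fun x => G x i j).

Lemma C1_det : C1_on U (fun x => \det (G x)).
Proof.
apply: C1_sum => s; apply: C1_mul; first exact: C1_cst.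
by apply: C1_prod => i; exact: CG.
Qed.

Lemma C1_invmx : (forall x, U x -> G x \in unitmx) ->
  forall i j, C1_on U (fun x => invmx (G x) i j).
Proof.
move=> uG i j; apply: (@C1_ext (fun x => (\det (G x))^-1 * \adj (G x) i j)).
  by move=> x Ux; rewrite /invmx uG// [RHS]mxE.
apply: C1_mul.
  apply: C1_inv C1_det _ => x /uG; rewrite unitmxE unitfE//.
apply: (@C1_ext (fun y => (-1) ^+ (j + i) * \sum_(s : 'S_n.-1) (-1) ^+ s *
          \prod_(k <- index_enum 'I_n.-1) G y (lift j k) (lift i (s k)))).
  move=> x _; rewrite mxE /cofactor; congr (_ * _).
  by apply: eq_bigr => s _; congr (_ * _); apply: eq_bigr => k _; rewrite !mxE.
apply: C1_mul; first exact: C1_cst.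
apply: C1_sum => s; apply: C1_mul; first exact: C1_cst.
by apply: C1_prod => k; exact: CG.
Qed.

End Matrix.
End C1Theory.

(** * The divergence form of the Laplacian *)

Definition posdef (R : realType) n (B : 'M[R]_n) :=
  forall v : 'rV[R]_n, v != 0 -> 0 < (v *m B *m v^T) 0 0.

Lemma posdef_det_neq0 (R : realType) n (B : 'M[R]_n) : posdef B -> \det B != 0.
Proof.
move=> pB; apply/negP => /det0P[v v0 vB].
by have := pB _ v0; rewrite vB mul0mx mxE ltxx.
Qed.

(** The segment from the identity matrix to B consists of positive definite
    matrices, and their determinants do not vanish: the determinant keeps the
    sign that it has at the identity. *)
Lemma posdef_det_gt0 (R : realType) n (B : 'M[R]_n) : posdef B -> 0 < \det B.
Proof.
move=> pB; pose H (s : R) : 'M[R]_n := (1 - s) *: 1%:M + s *: B.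
have pH s : 0 <= s <= 1 -> posdef (H s).
  move=> /andP[s0 s1] v v0.
  have vv : 0 < (v *m v^T) 0 0.
    rewrite mxE lt_def sumr_ge0 ?andbT; last first.
      by move=> i _; rewrite mxE -expr2 sqr_ge0.
    apply: contraNneq v0 => /eqP; rewrite psumr_eq0; last first.
      by move=> i _; rewrite mxE -expr2 sqr_ge0.
    move=> /allP v0; apply/eqP/rowP => i; have := v0 i (mem_index_enum _).
    by rewrite !mxE /= -expr2 sqrf_eq0 => /eqP.
  rewrite mulmxDr mulmxDl -!scalemxAr -!scalemxAl mulmx1.
  rewrite mxE [X in X + _]mxE [X in _ + X]mxE.
  have := pB v v0; set p := (_ *m _ *m _) _ _ => p0.
  have [->|s_neq0] := eqVneq s 0; first by rewrite subr0 mul1r mul0r addr0.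
  apply: ltr_wpDl; first by rewrite mulr_ge0 ?subr_ge0// ltW.
  by rewrite mulr_gt0// lt_def s_neq0.
have cH : continuous (fun s => \det (H s)).
  move=> s; apply: cvg_sum_at => p _; apply: cvgM_at; first exact: cvg_cst_at.
  apply: cvg_prod_at => i _ /=.
  under eq_fun do rewrite !mxE.
  rewrite !mxE; apply: cvgD_at; apply: cvgM_at; try exact: cvg_cst_at.
    by apply: cvgB_at; [exact: cvg_cst_at|exact: cvg_id].
  exact: cvg_id.
have H0 : \det (H 0) = 1 by rewrite /H subr0 scale1r scale0r addr0 det1.
have H1 : \det (H 1) = \det B by rewrite /H subrr scale0r add0r scale1r.
rewrite ltNge; apply/negP => B0.
have [|s] := @IVT R (fun s => \det (H s)) 0 1 0 ler01 (continuous_subspaceT cH).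
  by rewrite H0 H1 ge_min le_max B0 ler01 orbT.
rewrite in_itv/= => s01 /eqP; apply/negP; apply: posdef_det_neq0.
exact: pH.
Qed.

Section Divergence.
Context {R : realType} {n : nat}.
Variables (U : set 'rV[R]_n) (G : 'rV[R]_n -> 'M[R]_n).
Hypothesis oU : open U.
Hypothesis CG : forall i j, C1_on U (fun x => G x i j).
Hypothesis symG : forall x, U x -> (G x)^T = G x.
Hypothesis posG : forall x, U x -> posdef (G x).

Definition vol_density x := Num.sqrt (\det (G x)).

Lemma metric_unit x : U x -> G x \in unitmx.
Proof. by move=> /posG/posdef_det_neq0; rewrite unitmxE unitfE. Qed.

Lemma C1_vol_density : C1_on U vol_density.
Proof.
by apply: C1_sqrt => //; [exact: C1_det|move=> x /posG/posdef_det_gt0].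
Qed.

Lemma C1_metric_inv i j : C1_on U (fun x => metric_inv G x i j).
Proof. by apply: C1_invmx => // x /metric_unit. Qed.

Lemma metric_inv_sym x i j : U x -> metric_inv G x i j = metric_inv G x j i.
Proof. by move=> Ux; rewrite /metric_inv -{1}(symG Ux) -trmx_inv mxE. Qed.

Let T x a : 'M[R]_n := \matrix_(b, c) partial a (fun y => G y b c) x.

Let DT x a : U x ->
  forall i j, is_derive x (delta_mx 0 a) (fun y => G y i j) (T x a i j).
Proof. by move=> Ux i j; rewrite mxE; exact: C1_is_derive. Qed.

Let near_unit x : U x -> \forall y \near x, G y \in unitmx.
Proof. by move=> Ux; exact: near_open oU Ux metric_unit. Qed.

(** The contracted Christoffel symbols form a divergence:
    sqrt(det g) g^ij Gamma^k_ij = - d_i (sqrt(det g) g^ik). *)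
Lemma christoffel_trace x k : U x ->
  \sum_i (partial i vol_density x * metric_inv G x i k +
          vol_density x * partial i (fun y => metric_inv G y i k) x)
  = - (vol_density x * \sum_i \sum_j metric_inv G x i j * christoffel G k i j x).
Proof.
move=> Ux; set p := vol_density x; pose I := metric_inv G x.
have IC i j : I i j = I j i by exact: metric_inv_sym.
(* Both sides are combinations of g^ij d_i g_jl and g^ij d_l g_ij. *)
pose A l := \sum_i \sum_j I i j * T x i j l.
pose B l := \sum_i \sum_j I i j * T x l i j.
have dp i : partial i vol_density x = 2^-1 * p * B i.
  rewrite /partial (@derive_val _ _ _ _ _ _ _ (is_derive_sqrt_det (DT i Ux) (near_unit Ux) (posdef_det_gt0 (posG Ux)))).
  congr (_ * _); rewrite /mxtrace; apply: eq_bigr => a _; rewrite mxE.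
  by apply: eq_bigr => b _; rewrite -/(metric_inv G x) -/I IC mulrC.
have dI i : partial i (fun y => metric_inv G y i k) x =
    - \sum_b \sum_c I i b * T x i b c * I c k.
  rewrite /partial (@derive_val _ _ _ _ _ _ _ (is_derive_invmx (DT i Ux) (near_unit Ux) i k)).
  rewrite !mxE; congr (- _); rewrite exchange_big/=; apply: eq_bigr => c _.
  by rewrite mxE mulr_suml.
have E1 : \sum_i partial i vol_density x * I i k = 2^-1 * p * \sum_l I k l * B l.
  by rewrite mulr_sumr; apply: eq_bigr => i _; rewrite dp IC; ring.
have E2 : \sum_i \sum_b \sum_c I i b * T x i b c * I c k = \sum_l I k l * A l.
  under eq_bigr do rewrite exchange_big.
  rewrite exchange_big/=; apply: eq_bigr => l _.
  rewrite mulr_sumr; apply: eq_bigr => i _; rewrite mulr_sumr; apply: eq_bigr => b _.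
  by rewrite (IC k l); ring.
have E3 : \sum_i \sum_j I i j * christoffel G k i j x =
    2^-1 * \sum_l I k l * (2 * A l - B l).
  transitivity (\sum_i \sum_j \sum_l 2^-1 * (I k l *
      (I i j * T x i j l + I i j * T x j i l - I i j * T x l i j))).
    apply: eq_bigr => i _; apply: eq_bigr => j _.
    rewrite /christoffel mulrCA mulr_sumr mulr_sumr; apply: eq_bigr => l _.
    by rewrite /T !mxE -/I; ring.
  rewrite mulr_sumr; under eq_bigr do rewrite exchange_big.
  rewrite exchange_big/=; apply: eq_bigr => l _.
  have -> : 2 * A l - B l = \sum_i \sum_j (I i j * T x i j l + I i j * T x j i l - I i j * T x l i j).
    have -> : 2 * A l = A l + \sum_i \sum_j I i j * T x j i l.
      rewrite [X in _ + X]exchange_big/= mulr_natl mulr2n; congr (_ + _).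
      by apply: eq_bigr => i _; apply: eq_bigr => j _; rewrite IC.
    rewrite -big_split -sumrB/=; apply: eq_bigr => i _.
    by rewrite -big_split -sumrB.
  by do 2 (rewrite !mulr_sumr; apply: eq_bigr => ? _).
rewrite E3 big_split/= E1.
have -> : \sum_i p * partial i (fun y => metric_inv G y i k) x = - (p * \sum_l I k l * A l).
  rewrite -E2 mulr_sumr -sumrN; apply: eq_bigr => i _.
  by rewrite dI mulrN.
have -> : \sum_l I k l * (2 * A l - B l) = 2 * (\sum_l I k l * A l) - \sum_l I k l * B l.
  by rewrite mulr_sumr -sumrB; apply: eq_bigr => l _; ring.
by field.
Qed.

(** By the product rule; [christoffel_trace] accounts for the first-order terms of
    the Hessian. *)
Lemma laplacian_divergence f x : (forall j, C1_on U (partial j f)) -> U x ->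
  vol_density x * laplacian G f x =
  \sum_i partial i (fun y => \sum_j vol_density y * metric_inv G y i j * partial j f y) x.
Proof.
move=> Cf Ux; set p := vol_density; pose I := metric_inv G.
have dE i : partial i (fun y => \sum_j p y * I y i j * partial j f y) x =
    \sum_j ((partial i p x * I x i j + p x * partial i (fun y => I y i j) x) * partial j f x
      + p x * I x i j * partial i (partial j f) x).
  rewrite /partial; apply: derive_val; apply: is_derive_bigsum => j _.
  apply: is_derive_mul; last exact: (C1_is_derive i (Cf j) Ux).
  by apply: is_derive_mul; [exact: (C1_is_derive i C1_vol_density Ux)|
    exact: (C1_is_derive i (C1_metric_inv i j) Ux)].
under [RHS]eq_bigr do rewrite dE big_split/=.
rewrite big_split/= [X in X + _]exchange_big/=.
under [X in X + _]eq_bigr do rewrite -mulr_suml christoffel_trace//.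
have -> : vol_density x * laplacian G f x =
  \sum_i \sum_j p x * I x i j * partial i (partial j f) x
  - \sum_i \sum_j \sum_k p x * I x i j * (christoffel G k i j x * partial k f x).
  rewrite /laplacian -sumrB mulr_sumr; apply: eq_bigr => i _.
  rewrite -sumrB mulr_sumr; apply: eq_bigr => j _.
  by rewrite /hessian -mulr_sumr -mulrBr mulrA.
rewrite addrC; congr (_ + _).
have -> : \sum_i \sum_j \sum_k p x * I x i j * (christoffel G k i j x * partial k f x) =
    \sum_k \sum_i \sum_j p x * I x i j * (christoffel G k i j x * partial k f x).
  by rewrite [RHS]exchange_big; apply: eq_bigr => i _; rewrite [RHS]exchange_big.
rewrite -sumrN; apply: eq_bigr => k _.
rewrite mulNr; congr (- _); rewrite mulr_sumr mulr_suml; apply: eq_bigr => i _.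
rewrite mulr_sumr mulr_suml; apply: eq_bigr => j _.
by rewrite /p /I; ring.
Qed.

(** Green's formula before integration: for w of compact support the left-hand
    side integrates to 0. *)
Lemma green_divergence w f x : C1_on U w -> (forall j, C1_on U (partial j f)) -> U x ->
  \sum_i partial i (fun y => w y * \sum_j vol_density y * metric_inv G y i j * partial j f y) x
  = vol_density x * (w x * laplacian G f x +
      \sum_i \sum_j metric_inv G x i j * partial i w x * partial j f x).
Proof.
move=> Cw Cf Ux.
have CX i : C1_on U (fun y => \sum_j vol_density y * metric_inv G y i j * partial j f y).
  apply: C1_sum => // j; apply: C1_mul => //; apply: C1_mul => //.
    exact: C1_vol_density.
  exact: C1_metric_inv.
have dE i : partial i (fun y => w y * \sum_j vol_density y * metric_inv G y i j * partial j f y) x =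
   partial i w x * (\sum_j vol_density x * metric_inv G x i j * partial j f x) +
   w x * partial i (fun y => \sum_j vol_density y * metric_inv G y i j * partial j f y) x.
  rewrite {1}/partial; apply: derive_val; apply: is_derive_mul.
    exact: (C1_is_derive i Cw Ux).
  exact: (C1_is_derive i (CX i) Ux).
under eq_bigr do rewrite dE; rewrite big_split/= addrC -mulr_sumr.
rewrite -laplacian_divergence// mulrDr; congr (_ + _); first by ring.
rewrite mulr_sumr; apply: eq_bigr => i _; rewrite !mulr_sumr.
by apply: eq_bigr => j _; ring.
Qed.

End Divergence.

(** * Integrals of compactly supported functions *)

Section CompactSupport.
Context {R : realType}.

Lemma closed_ball_rV_compact n (k : R) : compact [set x : 'rV[R]_n | `|x| <= k].
Proof.
apply: bounded_closed_compact.
  by exists k; split; rewrite ?num_real// => M kM x /= xk; rewrite (le_trans xk)// ltW.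
have -> : [set x : 'rV[R]_n | `|x| <= k] = (fun x => `|x|) @^-1` [set s | s <= k] by [].
by apply: preimage_closed; [move=> x _; exact: norm_continuous|exact: closed_le].
Qed.

Lemma continuous_norm_bounded n (h : 'rV[R]_n -> R) (k : R) : continuous h ->
  exists M, forall x, `|x| <= k -> `|h x| <= M.
Proof.
move=> ch; have /compact_bounded[M [_ HM]] :
    compact (h @` [set x : 'rV[R]_n | `|x| <= k]).
  apply: continuous_compact; last exact: closed_ball_rV_compact.
  exact: continuous_subspaceT.
by exists (M + 1) => x xk; apply: (HM (M + 1)); [rewrite ltrDl|exists x].
Qed.

Lemma bounded_support_integrable n (h : 'rV[R]_n -> R) (k M : R) :
  measurable_fun [set: borelType 'rV[R]_n] h ->
  (forall x, `|x| <= k -> `|h x| <= M) -> (forall x, k < `|x| -> h x = 0) ->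
  (lebesgue_rV R n).-integrable setT (EFin \o h).
Proof.
move=> mh hM h0; pose B := [set x : 'rV[R]_n | `|x| <= k].
have mB : measurable (B : set (borelType 'rV[R]_n)).
  have oB : open (~` B).
    apply: closed_openC; apply: compact_closed; first exact: norm_hausdorff.
    exact: closed_ball_rV_compact.
  by have := measurableC (borel_open oB); rewrite setCK.
have -> : EFin \o h = (EFin \o h) \_ B.
  apply/funext => x; rewrite patchE; case: ifPn => // /negP; rewrite inE /B /=.
  by move=> /negP; rewrite -ltNge /= => /h0 ->.
apply: (iffLR (integrable_mkcond _ mB)); apply: measurable_bounded_integrable => //.
- apply: (@lebesgue_rV_bounded _ _ _ k) => // x Bx i.
  exact: le_trans (rV_coord_le _ _) Bx.
- exact: measurable_funTS.
- by exists M; split; rewrite ?num_real// => M' MM' x Bx; exact: le_trans (hM _ Bx) (ltW MM').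
Qed.

Lemma continuous_support_integrable n (h : 'rV[R]_n -> R) (k : R) :
  continuous h -> (forall x, k < `|x| -> h x = 0) ->
  (lebesgue_rV R n).-integrable setT (EFin \o h).
Proof.
move=> ch h0; have [M HM] := continuous_norm_bounded k ch.
by apply: bounded_support_integrable HM h0; exact: (@continuous_borel R 'rV[R]_n).
Qed.

Lemma partial_out n (h : 'rV[R]_n -> R) (k : R) i x :
  (forall x, k < `|x| -> h x = 0) -> k < `|x| -> partial i h x = 0.
Proof.
move=> h0 kx; rewrite /partial (@near_eq_derive _ _ _ _ (cst 0)) ?derive_cst//.
have o : open [set y : 'rV[R]_n | k < `|y|].
  have -> : [set y : 'rV[R]_n | k < `|y|] = (fun y => `|y|) @^-1` [set s | k < s] by [].
  by apply: open_comp; [move=> y _; exact: norm_continuous|exact: open_gt].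
by apply: near_open o kx _ => y /h0.
Qed.

(** The fundamental theorem of calculus on an interval larger than the support. *)
Lemma integral_derive1_support (phi dphi : R -> R) (k : R) :
  (forall s : R, is_derive s 1 phi (dphi s)) -> continuous dphi ->
  (forall s, k < `|s| -> phi s = 0) ->
  (\int[@lebesgue_measure R]_s (dphi s)%:E = 0)%E.
Proof.
move=> Dphi cdphi phi0; pose c := `|k| + 1.
have kc : k < c by rewrite /c; have := ler_norm k; lra.
have c0 : 0 < c by rewrite /c; have := normr_ge0 k; lra.
have dphi0 s : k < `|s| -> dphi s = 0.
  move=> ks; have [_ <-] := Dphi s.
  rewrite (@near_eq_derive _ _ _ _ (cst 0)) ?derive_cst//.
  have o : open [set y : R | k < `|y|].
    have -> : [set y : R | k < `|y|] = (fun y => `|y|) @^-1` [set s | k < s] by [].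
    by apply: open_comp; [move=> y _; exact: norm_continuous|exact: open_gt].
  by apply: near_open o ks _ => y /phi0.
have -> : (fun s => (dphi s)%:E) = (fun s => (dphi s)%:E) \_ `[- c, c].
  apply/funext => s; rewrite patchE; case: ifPn => // /negP; rewrite inE /= in_itv/=.
  move=> H; rewrite dphi0//; apply: (lt_le_trans kc).
  by rewrite leNgt; apply/negP => sc; apply: H; rewrite -ler_norml ltW.
rewrite -integral_mkcond (@continuous_FTC2 _ dphi phi)//.
- rewrite !phi0 ?subee//.
    by rewrite ltr0_norm ?oppr_lt0// opprK.
  by rewrite gtr0_norm.
- lra.
- exact: continuous_subspaceT.
- have cphi : continuous phi.
    by move=> s; apply/differentiable_continuous/derivable1_diffP; have [] := Dphi s.
  split=> [s _|//|//].
  + by have [] := Dphi s.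
  + by apply: cvg_at_right_filter; exact: cphi.
  + by apply: cvg_at_left_filter; exact: cphi.
- by move=> s _; rewrite derive1E; have [_ ->] := Dphi s.
Qed.

Lemma rV_cons_norm m s (y : 'rV[R]_m) : `|y| <= `|rV_cons (s, y)|.
Proof.
by apply: rV_norm_le => // i; rewrite -(rV_consS (s, y)); exact: rV_coord_le.
Qed.

Lemma rV_cons_norm0 m s (y : 'rV[R]_m) : `|s| <= `|rV_cons (s, y)|.
Proof. by rewrite -[X in `|X| <= _](rV_cons0 (s, y)); exact: rV_coord_le. Qed.

Lemma rV_cons_sub m (z w : R * 'rV[R]_m) (e : R) :
  `|z.1 - w.1| < e -> `|z.2 - w.2| < e -> `|rV_cons z - rV_cons w| < e.
Proof.
move=> e1 e2; have e0 : 0 < e by exact: le_lt_trans e1.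
have [e' /andP[e'm e'e]] : exists e', Num.max `|z.1 - w.1| `|z.2 - w.2| <= e' < e.
  by exists (Num.max `|z.1 - w.1| `|z.2 - w.2|); rewrite lexx gt_max e1 e2.
apply: le_lt_trans e'e; move: e'm; rewrite ge_max => /andP[z1 z2].
apply: rV_norm_le => [|i]; first exact: le_trans z1.
rewrite mxE [X in _ + X]mxE.
case: (unliftP ord0 i) => [j ->|->]; last by rewrite !rV_cons0.
rewrite !rV_consS; apply: le_trans z2; apply: le_trans (rV_coord_le _ j).
by rewrite !mxE.
Qed.

Lemma rV_cons_lineS m (s t : R) (y : 'rV[R]_m) l :
  rV_cons (s, t *: delta_mx 0 l + y) =
  t *: delta_mx 0 (lift ord0 l) + rV_cons (s, y).
Proof.
apply/rowP => a; rewrite [RHS]mxE [X in _ = X + _]mxE [X in _ * X]mxE.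
case: (unliftP ord0 a) => [b ->|->]; rewrite ?rV_consS ?rV_cons0/=.
  by rewrite !mxE/= (inj_eq lift_inj).
by rewrite mulr0 add0r.
Qed.

Lemma rV_cons_line0 m (s t : R) (y : 'rV[R]_m) :
  rV_cons (t + s, y) = t *: delta_mx 0 ord0 + rV_cons (s, y).
Proof.
apply/rowP => a; rewrite [RHS]mxE [X in _ = X + _]mxE [X in _ * X]mxE.
case: (unliftP ord0 a) => [b ->|->]; rewrite ?rV_consS ?rV_cons0/=.
  by rewrite mulr0 add0r.
by rewrite mulr1.
Qed.

(** For the first coordinate, integrate in that variable first.  Any other
    coordinate is a coordinate of R^m once the first one is split off, and the
    induction hypothesis applies to each slice. *)
Lemma integral_partial_eq0 n (h : 'rV[R]_n -> R) (i : 'I_n) (k : R) :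
  C1_on setT h -> (forall x, k < `|x| -> h x = 0) ->
  (\int[lebesgue_rV R n]_x (partial i h x)%:E = 0)%E.
Proof.
elim: n h i => [h []//|m IHm] h i Ch h0.
have ih : (lebesgue_rV R m.+1).-integrable setT (EFin \o partial i h).
  apply: (@continuous_support_integrable _ _ k) => [x|x kx].
    exact: (C1_partial_continuous (U := setT)).
  exact: partial_out h0 kx.
have [i2 ->] := integral_rV_cons ih.
have c1 (y : 'rV[R]_m) : continuous (fun s : R => rV_cons (s, y)).
  move=> s; apply/cvgrPdist_lt => e e0; apply/nbhs_ballP; exists e => //= t st.
  by apply: rV_cons_sub; [exact: st|rewrite /= subrr normr0].
have c2 (s : R) : continuous (fun y : 'rV[R]_m => rV_cons (s, y)).
  move=> y; apply/(@cvgrPdist_lt _ _ _ (nbhs y)) => e e0.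
  apply/nbhs_ballP; exists e => //= z.
  rewrite -ball_normE /= => yz.
  by apply: rV_cons_sub; rewrite /= ?subrr ?normr0.
case: (unliftP ord0 i) => [j ij|i0].
  rewrite -(integral12_prod_meas1 i2) /fubini_F.
  rewrite integral0_eq// => s _.
  have Dh y l : is_derive y (delta_mx 0 l) (fun y => h (rV_cons (s, y)))
      (partial (lift ord0 l) h (rV_cons (s, y))).
    have [D1 D2] := Ch (rV_cons (s, y)) I (lift ord0 l).
    have E : (fun t : R => t^-1 *: ((fun y => h (rV_cons (s, y))) (t *: delta_mx 0 l + y)
          - h (rV_cons (s, y)))) =
        (fun t : R => t^-1 *: ((h \o shift (rV_cons (s, y))) (t *: delta_mx 0 (lift ord0 l))
          - h (rV_cons (s, y)))).
      by apply/funext => t /=; rewrite rV_cons_lineS.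
    by split; rewrite /derivable /partial /derive /= E.
  have C : C1_on setT (fun y => h (rV_cons (s, y))).
    apply: C1_onI => //; first exact: openT.
    move=> y l _; apply: (@continuous_comp _ _ _ (fun y => rV_cons (s, y))).
      exact: c2.
    exact: (C1_partial_continuous (U := setT)).
  rewrite -[RHS](IHm _ j C).
    apply: eq_integral => y _ /=; congr (_%:E).
    by rewrite ij; have [_ <-] := Dh y j.
  by move=> y ky; apply: h0; exact: lt_le_trans ky (rV_cons_norm _ _).
rewrite -(integral21_prod_meas1 i2) /fubini_G.
rewrite integral0_eq// => y _ /=; rewrite i0.
apply: (@integral_derive1_support (fun s => h (rV_cons (s, y))) _ k).
- move=> s; have [D1 D2] := Ch (rV_cons (s, y)) I ord0.
  have E : (fun t : R => t^-1 *: ((fun s => h (rV_cons (s, y))) (t *: 1 + s)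
          - h (rV_cons (s, y)))) =
        (fun t : R => t^-1 *: ((h \o shift (rV_cons (s, y))) (t *: delta_mx 0 ord0)
          - h (rV_cons (s, y)))).
    by apply/funext => t /=; rewrite [t *: 1]mulr1 rV_cons_line0.
  by split; rewrite /derivable /partial /derive /= E.
- move=> s; apply: (@continuous_comp _ _ _ (fun s => rV_cons (s, y))).
    exact: c1.
  exact: (C1_partial_continuous (U := setT)).
- by move=> s ks; apply: h0; exact: lt_le_trans ks (rV_cons_norm0 _ _).
Qed.

End CompactSupport.

(** * Integrals against a measure with a density *)

(** A measure m1 that has, through phi, the density rho with respect to m2 is
    known by its values on sets; the identity of integrals follows for simple
    functions, for nonnegative ones by monotone convergence, and then for all. *)
Section Transfer.
Context {R : realType} d1 d2 (T1 : measurableType d1) (T2 : measurableType d2).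
Variables (m1 : {measure set T1 -> \bar R}) (m2 : {measure set T2 -> \bar R}).
Variables (D : set T1) (phi : T1 -> T2) (rho : T2 -> R).
Hypotheses (mD : measurable D) (mphi : measurable_fun setT phi).
Hypotheses (mrho : measurable_fun setT rho) (rho0 : forall x, 0 <= rho x).
Hypothesis densityE : forall B, measurable B ->
  m1 (D `&` phi @^-1` B) = (\int[m2]_x (\1_B x * rho x)%:E)%E.

Import HBNNSimple.
Local Open Scope ereal_scope.

Let mphiI B : measurable B -> measurable (phi @^-1` B).
Proof. by move=> mB; rewrite -[X in measurable X]setTI; exact: mphi. Qed.

Let transfer_nnsfun (s : {nnsfun T2 >-> R}) :
  \int[m1]_(x in D) (s (phi x))%:E = \int[m2]_x (s x * rho x)%:E.
Proof.
transitivity (\sum_(y \in range s) (y%:E * m1 (D `&` phi @^-1` (s @^-1` [set y])))).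
  transitivity (\int[m1]_(x in D)
     (\sum_(y \in range s) (y * \1_(s @^-1` [set y]) (phi x))%:E)).
    by apply: eq_integral => t tE; rewrite /= fimfunE -fsumEFin.
  rewrite ge0_integral_fsum//; last 2 first.
  - move=> y; apply: (measurable_comp measurableT) => //.
    apply: measurable_funTS; apply: measurable_funM => //.
    by apply: (measurableT_comp _ mphi); exact: measurable_indic.
  - by move=> y x Dx; exact: nnfun_muleindic_ge0.
  apply: eq_fsbigr => y _.
  have -> : (fun x => (y * \1_(s @^-1` [set y]) (phi x))%:E) =
     (fun x => (y * \1_(phi @^-1` (s @^-1` [set y])) x)%:E) by [].
  rewrite (@integralZl_indic _ _ _ m1 _ mD (fun y => phi @^-1` (s @^-1` [set y])))//.
  - congr (_ * _); have mB : measurable (phi @^-1` (s @^-1` [set y])).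
      by apply: mphiI.
    by rewrite (integral_indic m1 mD mB) setIC.
  - by move=> y0; rewrite preimage_nnfun0.
  - exact: mphiI.
transitivity (\sum_(y \in range s) (y%:E * \int[m2]_x (\1_(s @^-1` [set y]) x * rho x)%:E)).
  by apply: eq_fsbigr => y _; rewrite densityE.
transitivity (\int[m2]_x
     (\sum_(y \in range s) (y * (\1_(s @^-1` [set y]) x * rho x))%:E)); last first.
  apply: eq_integral => t tE; rewrite [X in (X * _)%R]fimfunE fsumEFin//.
  congr (_%:E); rewrite !fsbig_finite//= mulr_suml.
  by apply: eq_bigr => i _; rewrite mulrA.
have y0 y x : (0 <= y * (\1_(s @^-1` [set y]) x * rho x))%R.
  rewrite mulrA mulr_ge0//.
  by have := nnfun_muleindic_ge0 s y x; rewrite lee_fin.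
have mi y : measurable_fun setT (fun x => (\1_(s @^-1` [set y]) x * rho x)%R).
  by apply: measurable_funM => //; exact: measurable_indic.
rewrite ge0_integral_fsum//; last 2 first.
- move=> y; apply: (measurable_comp measurableT) => //.
  by apply: measurable_funM.
- by move=> y x Dx; rewrite lee_fin.
apply: eq_fsbigr => y; rewrite inE => -[x _ <-].
rewrite -ge0_integralZl_EFin//.
- by move=> z _; rewrite lee_fin mulr_ge0.
- by apply/measurable_EFinP.
Qed.

Lemma ge0_integral_transfer (h : T2 -> R) : measurable_fun setT h ->
  (forall x, (0 <= h x)%R) ->
  \int[m1]_(x in D) (h (phi x))%:E = \int[m2]_x (h x * rho x)%:E.
Proof.
move=> mh h0.
have mh' : measurable_fun setT (EFin \o h) by exact/measurable_EFinP.
pose s := nnsfun_approx measurableT mh'.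
have cs x : (s n x)%:E @[n --> \oo] --> (h x)%:E.
  by apply: (cvg_nnsfun_approx measurableT mh') => // t _; rewrite /= lee_fin.
have nds x : {homo (fun n => s n x) : a b / (a <= b)%N >-> (a <= b)%R}.
  by move=> a b ab; exact/lefP/nd_nnsfun_approx.
transitivity (limn (fun n => \int[m1]_(x in D) (s n (phi x))%:E)).
  rewrite -monotone_convergence//.
  - by apply: eq_integral => x _; apply/esym/cvg_lim.
  - move=> n; apply/measurable_EFinP; apply: measurable_funTS.
    exact: measurableT_comp.
  - by move=> n x _; rewrite lee_fin.
  - by move=> x _ a b ab; rewrite lee_fin; exact: nds.
under eq_fun do rewrite transfer_nnsfun.
rewrite -monotone_convergence//.
- apply: eq_integral => x _; apply/cvg_lim => //.
  by under eq_fun do rewrite EFinM; rewrite EFinM; apply: cvgeZr.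
- move=> n; apply/measurable_EFinP; exact: measurable_funM.
- by move=> n x _; rewrite lee_fin mulr_ge0.
- by move=> x _ a b ab; rewrite lee_fin ler_wpM2r//; exact: nds.
Qed.

Lemma integrable_transfer (h : T2 -> R) : measurable_fun setT h ->
  m2.-integrable setT (fun x => (h x * rho x)%:E) ->
  m1.-integrable D (fun x => (h (phi x))%:E).
Proof.
move=> mh /integrableP[mhr hr]; apply/integrableP; split.
  by apply/measurable_EFinP; apply: measurable_funTS; exact: measurableT_comp.
under eq_integral do rewrite abse_EFin.
rewrite (@ge0_integral_transfer (fun x => `|h x|%R))//; last exact: measurableT_comp.
rewrite (_ : (fun x => _) = (fun x => `|(h x * rho x)%:E|))//.
by apply/funext => x; rewrite abse_EFin normrM (ger0_norm (rho0 x)).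
Qed.

Lemma integral_transfer (h : T2 -> R) : measurable_fun setT h ->
  \int[m1]_(x in D) (h (phi x))%:E = \int[m2]_x (h x * rho x)%:E.
Proof.
move=> mh; rewrite integralE [RHS]integralE.
pose hp x := Num.max (h x) 0%R; pose hn x := Num.max (- h x)%R 0%R.
have mhp : measurable_fun setT hp by exact: measurable_maxr.
have mhn : measurable_fun setT hn.
  by apply: measurable_maxr => //; exact: measurable_funN.
congr (_ - _).
  transitivity (\int[m1]_(x in D) (hp (phi x))%:E).
    by apply: eq_integral => x _; rewrite funeposE -EFin_max.
  rewrite ge0_integral_transfer//; last by move=> x; rewrite le_max lexx orbT.
  apply: eq_integral => x _; rewrite funeposE -EFin_max; congr (_%:E).
  by rewrite /hp maxr_pMl// mul0r.
transitivity (\int[m1]_(x in D) (hn (phi x))%:E).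
  by apply: eq_integral => x _; rewrite funenegE -EFin_max.
rewrite ge0_integral_transfer//; last by move=> x; rewrite le_max lexx orbT.
apply: eq_integral => x _; rewrite funenegE -EFin_max; congr (_%:E).
by rewrite /hn maxr_pMl// mul0r mulNr.
Qed.

End Transfer.

(** * Integration in a chart *)

(** Coordinate expressions are continuous on an open domain and set to 0 outside;
    across the boundary of the domain they may jump. *)
Lemma open_support_borel (R : realType) (T : ptopologicalType) (f : T -> R) (D : set T) :
  open D -> (forall p, D p -> {for p, continuous f}) -> (forall p, ~ D p -> f p = 0) ->
  measurable_fun [set: borelType T] f.
Proof.
move=> oD cf f0.
apply: (@measurability _ _ _ _ _ _ _ (measurable_realfun.RGenOpens.measurableE R)).
move=> _ [_ [a [b ->]] <-]; rewrite setTI.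
have -> : f @^-1` `]a, b[%classic =
    (D `&` f @^-1` `]a, b[%classic) `|` (~` D `&` [set p | `]a, b[%classic (0 : R)]).
  apply/seteqP; split=> [p fp|p [[]//|[nDp /= ab0]]].
    have [Dp|nDp] := pselect (D p); [by left|right; split=> //=].
    by rewrite -(f0 _ nDp).
  by rewrite /= f0.
apply: measurableU; last first.
  have mDC : measurable (~` D : set (borelType T)).
    by apply: measurableC; exact: borel_open.
  have [H|H] := pselect (`]a, b[%classic (0 : R)).
    rewrite (_ : _ `&` _ = ~` D)//.
    by apply/seteqP; split=> [p []//|p nDp]; split.
  rewrite (_ : _ `&` _ = set0)//.
  by apply/seteqP; split=> [p [_ /H]|].
apply: borel_open; rewrite openE => p [Dp fp].
apply: filterI; first exact: open_nbhs_nbhs.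
apply: (cf p Dp); apply: open_nbhs_nbhs; split=> //.
Qed.

(** A point outside U lies in the open complement of K, where f is 0. *)
Lemma compact_support_continuous (R : realType) (T : topologicalType) (f : T -> R)
    (U K : set T) :
  hausdorff_space T -> compact K -> K `<=` U ->
  (forall p, U p -> {for p, continuous f}) -> (forall p, ~ K p -> f p = 0) ->
  continuous f.
Proof.
move=> hT cK KU cf f0 p; have [Up|nUp] := pselect (U p); first exact: cf.
have nKp : ~ K p by move=> /KU.
have oK : open (~` K) by apply: closed_openC; exact: compact_closed.
apply: (@near_eq_continuous _ _ (cst 0)); last exact: cst_continuous.
by apply: near_open oK nKp _ => q /f0.
Qed.

Section Charts.
Context {R : realType} {n : nat} {M : ptopologicalType} (A : smooth_atlas R n M).
Implicit Types (a b : chart_index A) (p : M).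

Lemma chart_cod_chart a p : chart_dom a p -> chart_cod a (chart a p).
Proof. by move=> ap; exists p. Qed.

Lemma param_dom a x : chart_cod a x -> chart_dom a (param a x).
Proof. by move=> [p ap <-]; rewrite chartK. Qed.

Lemma paramK a x : chart_cod a x -> chart a (param a x) = x.
Proof. by move=> [p ap <-]; rewrite chartK. Qed.

Lemma open_chart_cod a : open (chart_cod a).
Proof. exact: chart_cod_open. Qed.

Lemma continuous_param_comp a (f : M -> R) x : chart_cod a x ->
  {for param a x, continuous f} -> {for x, continuous (f \o param a)}.
Proof.
by move=> ax cf; apply: continuous_comp => //; exact: param_continuous.
Qed.

Lemma continuous_chart_comp a (F : 'rV[R]_n -> R) p : chart_dom a p ->
  {for chart a p, continuous F} -> {for p, continuous (F \o chart a)}.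
Proof.
by move=> ap cF; apply: continuous_comp => //; exact: chart_continuous.
Qed.

(** The expression of f in the chart a, cut off because [param a] is meaningful
    on [chart_cod a] only. *)
Definition pull a (f : M -> R) (x : 'rV[R]_n) : R :=
  \1_(chart_cod a) x * f (param a x).

Lemma pullE a f x : chart_cod a x -> pull a f x = f (param a x).
Proof. by move=> ax; rewrite /pull indicE mem_set// mul1r. Qed.

Lemma pull_out a f x : ~ chart_cod a x -> pull a f x = 0.
Proof. by move=> ax; rewrite /pull indicE memNset// mul0r. Qed.

Lemma continuous_pull a (f : M -> R) x : chart_cod a x ->
  {for param a x, continuous f} -> {for x, continuous (pull a f)}.
Proof.
move=> ax cf; apply: (@near_eq_continuous _ _ (f \o param a)).
  by apply: near_open (@open_chart_cod a) ax _ => y ay; rewrite pullE.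
exact: continuous_param_comp.
Qed.

Lemma chart_compact a (K : set M) : compact K -> K `<=` chart_dom a ->
  compact (chart a @` K).
Proof.
move=> cK Ka; apply: continuous_compact => //.
apply: continuous_in_subspaceT => p /set_mem Kp.
by apply: chart_continuous; exact: Ka.
Qed.

Lemma pull_support a (K : set M) f x : (forall p, ~ K p -> f p = 0) ->
  ~ (chart a @` K) x -> pull a f x = 0.
Proof.
move=> f0 nKx; have [ax|ax] := pselect (chart_cod a x); last exact: pull_out.
rewrite pullE// f0// => Kx; apply: nKx; exists (param a x) => //.
exact: paramK.
Qed.

Lemma chart_image_cod a (K : set M) : K `<=` chart_dom a -> chart a @` K `<=` chart_cod a.
Proof. by move=> Ka; exact: image_subset. Qed.

Lemma compact_rV_bounded (K : set 'rV[R]_n) : compact K ->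
  exists k : R, forall x, K x -> `|x| <= k.
Proof.
move=> /compact_bounded[k [_ Hk]]; exists (k + 1) => x Kx.
by apply: Hk Kx; rewrite ltrDl.
Qed.

Section Volume.
Variables (g : tensor2 A) (dv : {measure set (borelType M) -> \bar R}).
Hypothesis metric_g : riemannian_metric g.
Hypothesis C1_g : forall a i j, C1_on (chart_cod a) (fun x => g a x i j).
Hypothesis volume_dv : riemannian_volume g dv.

Lemma metric_posdef a x : chart_cod a x -> posdef (g a x).
Proof. by move=> ax v v0; have [_ + _] := metric_g; apply. Qed.

Lemma C1_vol a : C1_on (chart_cod a) (vol_density (g a)).
Proof.
apply: C1_vol_density; [exact: open_chart_cod|exact: C1_g|exact: metric_posdef].
Qed.

Lemma continuous_pull_vol a (f : M -> R) (K : set M) :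
  compact K -> K `<=` chart_dom a -> continuous f -> (forall p, ~ K p -> f p = 0) ->
  continuous (fun x => pull a f x * vol_density (g a) x).
Proof.
move=> cK Ka cf f0.
apply: (@compact_support_continuous _ _ _ (chart_cod a) (chart a @` K)).
- exact: norm_hausdorff.
- exact: chart_compact.
- exact: chart_image_cod.
- move=> x ax; apply: cvgM_at; first exact: (continuous_pull ax (cf _)).
  exact: (C1_continuous (@open_chart_cod a) (@C1_vol a) ax).
- by move=> x nKx; rewrite (pull_support f0 nKx) mul0r.
Qed.

Lemma integrable_pull_vol a (f : M -> R) (K : set M) :
  compact K -> K `<=` chart_dom a -> continuous f -> (forall p, ~ K p -> f p = 0) ->
  (lebesgue_rV R n).-integrable setT
    (fun x => (pull a f x * vol_density (g a) x)%:E).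
Proof.
move=> cK Ka cf f0; have [k Hk] := compact_rV_bounded (chart_compact cK Ka).
apply: (@continuous_support_integrable _ _ _ k).
  exact: continuous_pull_vol cK Ka cf f0.
move=> x kx; rewrite (pull_support f0) ?mul0r// => /Hk.
by apply/negP; rewrite -ltNge.
Qed.

(** The chart, multiplied by the indicator of its domain, is a measurable map
    phi on all of M; through phi the volume has the density sqrt(det g), so
    [integral_transfer] applies. *)
Lemma integral_chart a (f : M -> R) (K : set M) :
  compact K -> K `<=` chart_dom a -> continuous f -> (forall p, ~ K p -> f p = 0) ->
  dv.-integrable setT (EFin \o f) /\
  (\int[dv]_p (f p)%:E =
   \int[lebesgue_rV R n]_x (pull a f x * vol_density (g a) x)%:E)%E.
Proof.
move=> cK Ka cf f0.
pose D : set (borelType M) := chart_dom a.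
have mD : measurable D by apply: borel_open; exact: chart_dom_open.
pose phi (p : M) : 'rV[R]_n := \row_i (\1_D p * chart a p 0 i).
have phiE p : D p -> phi p = chart a p.
  by move=> Dp; apply/rowP => i; rewrite mxE indicE mem_set// mul1r.
have mphi : measurable_fun [set: borelType M] (phi : _ -> borelType 'rV[R]_n).
  apply: measurable_fun_rV => i; apply: (@open_support_borel _ _ _ D).
  - exact: chart_dom_open.
  - move=> p Dp; apply: (@near_eq_continuous _ _ (fun q => chart a q 0 i)).
      by apply: near_open (chart_dom_open a) Dp _ => q Dq; rewrite phiE.
    apply: (@continuous_chart_comp a (fun x => x 0 i)) => //.
    exact: coord_continuous.
  - by move=> p nDp; rewrite mxE indicE memNset// mul0r.
pose rho x := \1_(chart_cod a) x * vol_density (g a) x.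
have rho0 x : 0 <= rho x by rewrite mulr_ge0// sqrtr_ge0.
have mrho : measurable_fun [set: borelType 'rV[R]_n] rho.
  apply: (@open_support_borel _ _ _ (chart_cod a)).
  - exact: open_chart_cod.
  - move=> x ax; apply: (@near_eq_continuous _ _ (vol_density (g a))).
      by apply: near_open (@open_chart_cod a) ax _ => y ay; rewrite /rho indicE mem_set// mul1r.
    exact: (C1_continuous (@open_chart_cod a) (@C1_vol a) ax).
  - by move=> x nax; rewrite /rho indicE memNset// mul0r.
have mpull : measurable_fun [set: borelType 'rV[R]_n] (pull a f).
  apply: (@open_support_borel _ _ _ (chart_cod a)).
  - exact: open_chart_cod.
  - by move=> x ax; exact: (continuous_pull ax (cf _)).
  - by move=> x nax; exact: pull_out.
have densityE (B : set (borelType 'rV[R]_n)) : measurable B ->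
    dv (D `&` phi @^-1` B) = (\int[lebesgue_rV R n]_x (\1_B x * rho x)%:E)%E.
  move=> mB; have mphiB : measurable (phi @^-1` B : set (borelType M)).
    by rewrite -[X in measurable X]setTI; exact: mphi.
  rewrite (volume_dv (a := a)); last 2 first.
  - exact: measurableI.
  - by move=> p [].
  have -> : chart a @` (D `&` phi @^-1` B) = chart_cod a `&` B.
    apply/seteqP; split=> [_ [p [Dp /= Bp] <-]|_ [[p Dp <-] Bp]].
      by rewrite -phiE//; split=> //; rewrite phiE//; exact: chart_cod_chart.
    by exists p => //; split=> //=; rewrite phiE.
  rewrite (_ : (fun x => _) = fun x => (\1_B x * rho x)%:E); last first.
    apply/funext => x; rewrite /rho indicI /= mulrA; congr (_ * _)%:E.
    exact: mulrC.
  apply: lebesgue_integral_rVE; first by move=> x; rewrite lee_fin mulr_ge0.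
  by apply/measurable_EFinP; apply: measurable_funM => //; exact: measurable_indic.
have pullrho x : pull a f x * rho x = pull a f x * vol_density (g a) x.
  have [ax|ax] := pselect (chart_cod a x); last by rewrite pull_out// !mul0r.
  by rewrite /rho indicE mem_set// mul1r.
have fE p : D p -> pull a f (phi p) = f p.
  move=> Dp; rewrite phiE// pullE ?chartK//; exact: chart_cod_chart.
have fpatch : EFin \o f = (fun p => (pull a f (phi p))%:E) \_ D.
  apply/funext => p; rewrite patchE /=; case: ifPn => [/set_mem Dp|/negP nDp].
    by rewrite fE.
  by rewrite f0// => /Ka Dp; apply: nDp; exact: mem_set.
split.
  rewrite fpatch; apply: (iffLR (integrable_mkcond _ mD)).
  apply: (integrable_transfer mD mphi mrho rho0 densityE) => //.
  under eq_fun do rewrite pullrho.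
  exact: integrable_pull_vol cK Ka cf f0.
transitivity (\int[dv]_(p in D) (pull a f (phi p))%:E)%E.
  by rewrite [RHS]integral_mkcond; apply: eq_integral => p _; rewrite -fpatch.
rewrite (integral_transfer mD mphi mrho rho0 densityE)//.
by apply: eq_integral => x _; rewrite pullrho.
Qed.

End Volume.
End Charts.

(** * Coordinate expressions of scalar fields *)

Section MatrixForms.
Context {R : realType} {n : nat}.

Definition grad (f : 'rV[R]_n -> R) x : 'cV[R]_n := \col_i partial i f x.

(** The inner product that the metric B induces on covectors. *)
Definition dual_form (B : 'M[R]_n) (v w : 'cV[R]_n) : R :=
  (v^T *m invmx B *m w) 0 0.

(** The value of h on the vectors obtained from v and w by raising indices
    with B; for v = w = du this is h(grad u, grad u). *)
Definition raised_form (B h : 'M[R]_n) (v w : 'cV[R]_n) : R :=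
  (v^T *m invmx B *m h *m invmx B *m w) 0 0.

Definition metric_trace (B h : 'M[R]_n) : R := \tr (invmx B *m h).

Lemma dual_formE G f w x :
  \sum_i \sum_j metric_inv G x i j * partial i f x * partial j w x =
  dual_form (G x) (grad f x) (grad w x).
Proof.
rewrite /dual_form mxE exchange_big; apply: eq_bigr => j _.
rewrite !mxE mulr_suml; apply: eq_bigr => i _; rewrite !mxE.
by rewrite /metric_inv [_ * partial i f x]mulrC.
Qed.

Lemma congruence_inv (J Ba Bb : 'M[R]_n) : Ba \in unitmx -> Ba = J *m Bb *m J^T ->
  J^T *m invmx Ba *m J = invmx Bb.
Proof.
move=> uBa E.
have [[uJ uBb] uJT] : (J \in unitmx /\ Bb \in unitmx) /\ J^T \in unitmx.
  by move: uBa; rewrite E !unitmx_mul => /andP[/andP[-> ->] ->].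
rewrite -[LHS](mulmxK uBb) -[RHS]mul1mx; congr (_ *m _).
rewrite -[LHS](mulmxK uJT) -(mulmxA _ Bb) -(mulmxA _ J) [J *m _]mulmxA -E.
by rewrite mulmxKV// mulmxV.
Qed.

Section Congruence.
Variables (J Ba Bb : 'M[R]_n).
Hypotheses (uBa : Ba \in unitmx) (E : Ba = J *m Bb *m J^T).

Lemma dual_form_congruence v w :
  dual_form Ba (J *m v) (J *m w) = dual_form Bb v w.
Proof.
by rewrite /dual_form trmx_mul -(congruence_inv uBa E) !mulmxA.
Qed.

Lemma raised_form_congruence h v w :
  raised_form Ba (J *m h *m J^T) (J *m v) (J *m w) = raised_form Bb h v w.
Proof.
by rewrite /raised_form trmx_mul -(congruence_inv uBa E) !mulmxA.
Qed.

Lemma metric_trace_congruence h :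
  metric_trace Ba (J *m h *m J^T) = metric_trace Bb h.
Proof.
rewrite /metric_trace -(congruence_inv uBa E) mulmxA mxtrace_mulC.
by rewrite !mulmxA.
Qed.

End Congruence.
End MatrixForms.

Section SmoothC1.
Context {R : realType} {n m : nat}.

Lemma differentiable_rV (V : normedModType R) (f : V -> 'rV[R]_m) x :
  (forall k, differentiable (fun y => f y 0 k) x) -> differentiable f x.
Proof.
move=> Df.
have -> : f = \sum_(k < m) (fun y => f y 0 k *: delta_mx 0 k).
  apply/funext => y; rewrite fct_sumE; exact: rV_sum_delta.
by apply: differentiable_sum => k; apply: differentiableZl.
Qed.

Lemma smooth_C1_coord (D : set 'rV[R]_n) (f : 'rV[R]_n -> 'rV[R]_m) :
  open D -> smooth_on D f -> forall k, C1_on D (fun x => f x 0 k).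
Proof.
move=> oD sf k.
apply: (C1_onI oD (D := fun i x => 'D_(delta_mx 0 i) f x 0 k)) => x i Dx.
  have [_ /(_ (delta_mx 0 i)) df] := sf [::] x Dx.
  split; first exact: ((derivable_mxP f x (delta_mx 0 i)).1 df 0 k).
  by rewrite derive_mx// mxE.
have [c _] := sf [:: delta_mx 0 i] x Dx.
exact: (@continuous_comp _ _ _ _ (fun y : 'rV[R]_m => y 0 k) _ c (@coord_continuous _ _ _ _ _ _)).
Qed.

End SmoothC1.

Section Manifold.
Context {R : realType} {n : nat} {M : ptopologicalType} (A : smooth_atlas R n M).
Implicit Types (a b : chart_index A) (p : M) (f w : M -> R).

Definition C1_M f := forall a, C1_on (chart_cod a) (f \o param a).

Lemma C1_M_continuous f : C1_M f -> continuous f.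
Proof.
move=> Cf p; pose a := chart_at A p; have ap := chart_at_dom A p.
apply: (@near_eq_continuous _ _ ((f \o param a) \o chart a)).
  by apply: near_open (@chart_dom_open _ _ _ A a) ap _ => q aq /=; rewrite chartK.
apply: continuous_chart_comp => //.
exact: (C1_continuous (@open_chart_cod _ _ _ A a) (Cf a) (chart_cod_chart ap)).
Qed.

Lemma open_overlap a b : open (chart a @` (chart_dom a `&` chart_dom b)).
Proof.
rewrite openE => _ [p [ap bp] <-].
have ax := chart_cod_chart ap.
have bx : chart_dom b (param a (chart a p)) by rewrite chartK.
have : \forall x \near chart a p, chart_cod a x /\ chart_dom b (param a x).
  near=> x; split; near: x.
    by apply: open_nbhs_nbhs; split=> //; exact: open_chart_cod.
  have nb : nbhs (param a (chart a p)) (chart_dom b).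
    by apply: open_nbhs_nbhs; split=> //; exact: chart_dom_open.
  exact: (param_continuous ax nb).
apply: filterS => x [ax' bx']; exists (param a x); last exact: paramK.
by split=> //; exact: param_dom.
Unshelve. all: by end_near. Qed.

Lemma overlap_cod a b x : (chart a @` (chart_dom a `&` chart_dom b)) x ->
  chart_cod a x /\ chart_cod b (chart b (param a x)).
Proof.
by move=> [p [ap bp] <-]; rewrite chartK//; split; exact: chart_cod_chart.
Qed.

Lemma C1_transition a b k :
  C1_on (chart a @` (chart_dom a `&` chart_dom b))
    (fun x => (chart b \o param a) x 0 k).
Proof.
apply: smooth_C1_coord; first exact: open_overlap.
exact: transition_smooth.
Qed.

Lemma C1_change_chart a b f : C1_on (chart_cod b) (f \o param b) ->
  C1_on (chart a @` (chart_dom a `&` chart_dom b)) (f \o param a).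
Proof.
move=> Cf.
apply: (C1_ext (@open_overlap a b) (f := fun x => (f \o param b) ((chart b \o param a) x))).
  by move=> _ [p [ap bp] <-] /=; rewrite !chartK.
apply: (C1_comp_rV (@open_overlap a b) (@open_chart_cod _ _ _ A b) Cf).
  by move=> k; exact: C1_transition.
by move=> x /overlap_cod[].
Qed.

(** Around a point of another chart, either the transition map carries the
    expression of f in a over, or the point is off K and f vanishes nearby. *)
Lemma C1_M_of_chart a (K : set M) f : hausdorff_space M -> compact K ->
  K `<=` chart_dom a -> (forall p, ~ K p -> f p = 0) ->
  C1_on (chart_cod a) (f \o param a) -> C1_M f.
Proof.
move=> hM cK Ka f0 Cf b x bx.
have [ap|nap] := pselect (chart_dom a (param b x)).
  apply: (@C1_change_chart b a f Cf x).
  by exists (param b x); [split=> //; exact: param_dom|exact: paramK].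
have nKp : ~ K (param b x) by move=> /Ka.
have oK : open (~` K) by apply: closed_openC; exact: compact_closed.
pose V := chart_cod b `&` (param b @^-1` (~` K)).
have oV : open V.
  rewrite openE => y [cy Ky]; apply: filterI.
    by apply: open_nbhs_nbhs; split=> //; exact: open_chart_cod.
  have nb : nbhs (param b y) (~` K) by exact: open_nbhs_nbhs.
  exact: (param_continuous cy nb).
have : C1_on V (f \o param b).
  by apply: (C1_ext oV (f := fun=> 0)); [move=> y [_ /f0]|exact: C1_cst].
by apply.
Qed.

Definition jac a b p := jacobian (chart b \o param a) (chart a p).

(** The chain rule for f o param a = (f o param b) o (chart b o param a), an
    identity valid near the point only. *)
Lemma partial_change_chart a b f p i : chart_dom a p -> chart_dom b p -> C1_M f ->
  partial i (f \o param a) (chart a p) =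
  \sum_k jac a b p i k * partial k (f \o param b) (chart b p).
Proof.
move=> ap bp Cf; pose x := chart a p.
have ox : (chart a @` (chart_dom a `&` chart_dom b)) x by exists p.
have psix : (chart b \o param a) x = chart b p by rewrite /x /= chartK.
have Dpsi : differentiable (chart b \o param a) x.
  apply: differentiable_rV => k.
  exact: (C1_differentiable (@open_overlap a b) (@C1_transition a b k) ox).
rewrite /partial; apply: derive_val.
have fE : \forall y \near x, (f \o param b) ((chart b \o param a) y) = (f \o param a) y.
  by apply: near_open (@open_overlap a b) ox _ => _ [q [aq bq] <-] /=; rewrite !chartK.
apply: (near_eq_is_derive fE).
have D := @is_derive_comp_rV R _ n (f \o param b) (chart b \o param a) x
  (delta_mx 0 i) (fun k => jac a b p i k).
rewrite psix in D; apply: D; last first.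
  exact: (C1_differentiable (@open_chart_cod _ _ _ A b) (Cf b) (chart_cod_chart bp)).
move=> k.
have [dk ck] := @C1_transition a b k x ox i; split=> //.
have dpsi : derivable (chart b \o param a) x (delta_mx 0 i) by exact: diff_derivable.
have := derive_mx dpsi; rewrite (deriveEjacobian _ Dpsi) => /matrixP/(_ 0 k).
by rewrite [RHS]mxE -rowE mxE => <-.
Qed.

Lemma grad_change_chart a b f p : chart_dom a p -> chart_dom b p -> C1_M f ->
  grad (f \o param a) (chart a p) =
  jac a b p *m grad (f \o param b) (chart b p).
Proof.
move=> ap bp Cf; apply/colP => i; rewrite mxE (partial_change_chart _ ap bp Cf) [RHS]mxE.
by apply: eq_bigr => k _; rewrite [grad _ _ _ _]mxE.
Qed.

Section Compatible.
Variable F : chart_index A -> 'rV[R]_n -> R.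
Hypothesis compat : forall a b p, chart_dom a p -> chart_dom b p ->
  F a (chart a p) = F b (chart b p).

Lemma scalar_atE a p : chart_dom a p -> scalar_at F p = F a (chart a p).
Proof. by move=> ap; apply: compat => //; exact: chart_at_dom. Qed.

Lemma scalar_at_param a x : chart_cod a x -> scalar_at F (param a x) = F a x.
Proof. by move=> ax; rewrite (scalar_atE (param_dom ax)) paramK. Qed.

Lemma scalar_at_continuous :
  (forall a x, chart_cod a x -> {for x, continuous (F a)}) -> continuous (scalar_at F).
Proof.
move=> cF p; have ap := chart_at_dom A p.
apply: (@near_eq_continuous _ _ (F (chart_at A p) \o chart (chart_at A p))).
  by apply: near_open (@chart_dom_open _ _ _ A _) ap _ => q aq; rewrite (scalar_atE aq).
by apply: continuous_chart_comp => //; apply: cF; exact: chart_cod_chart.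
Qed.

End Compatible.
End Manifold.

(** * Partitions of unity *)

Section Bump.
Context {R : realType}.

(** Squaring the positive part is enough to make it C^1, the regularity of the
    test functions in Green's formula. *)
Definition pos_sq (s : R) : R := Num.max s 0 ^+ 2.

Lemma continuous_max0 : continuous (fun s : R => Num.max s 0).
Proof. by move=> s; apply: continuous_max => //; exact: cst_continuous. Qed.

Lemma is_derive_pos_sq (s : R) : is_derive s 1 pos_sq (2 * Num.max s 0).
Proof.
have [s0|s0|->] := ltgtP s 0.
- rewrite mulr0; apply: (@near_eq_is_derive _ _ _ (cst 0)).
  apply: near_open (@open_lt _ 0) s0 _ => t /= t0.
  by rewrite /pos_sq max_r ?ltW// expr0n.
- apply: (@near_eq_is_derive R R R (fun t : R => t * t)).
    apply: near_open (@open_gt _ 0) s0 _ => t /= t0.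
    by rewrite /pos_sq max_l ?ltW// expr2.
  have D : is_derive s 1 (fun t : R => t) (1 : R) by exact: is_derive_id.
  apply: is_derive_eq (is_derive_mul D D) _.
  by rewrite mul1r mulr1 mulr_natl mulr2n.
- rewrite mulr0.
  have H : (fun h : R => h^-1 *: (pos_sq (h *: 1 + 0) - pos_sq 0)) @ 0^' --> (0 : R).
    apply/cvgrPdist_le => e e0; near=> h.
    have h0 : h != 0 by near: h; exact: nbhs_dnbhs_neq.
    have he : `|h| <= e.
      by apply: ltW; near: h; exact: dnbhs0_lt.
    rewrite sub0r normrN addr0 [h *: 1]mulr1 /pos_sq maxxx expr0n subr0.
    rewrite [_ *: _]mulrC normrM normfV ler_pdivrMr ?normr_gt0// normrX expr2.
    have mh : `|Num.max h 0| <= `|h|.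
      by rewrite ger0_norm ?le_max ?lexx ?orbT// ge_max normr_ge0 ler_norm.
    by apply: ler_pM => //; exact: le_trans mh he.
  by split; [apply/cvg_ex; exists 0|apply: cvg_lim].
Unshelve. all: by end_near. Qed.

Definition bump1 (s : R) : R := pos_sq (1 - s ^+ 2).

Definition dbump1 (s : R) : R := 2 * Num.max (1 - s ^+ 2) 0 * (- (2 * s)).

Lemma is_derive_bump1 (s : R) : is_derive s 1 bump1 (dbump1 s).
Proof.
have D1 : is_derive s 1 (fun t : R => t) (1 : R) by exact: is_derive_id.
have D2 : is_derive s 1 (fun t : R => 1 - t * t) (0 - (1 * s + s * 1)).
  have D0 : is_derive s 1 (cst (1 : R)) (0 : R) by exact: is_derive_cst.
  exact: (is_deriveB D0 (is_derive_mul D1 D1)).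
have D3 : is_derive s 1 (fun t : R => 1 - t ^+ 2) (- (2 * s)).
  under eq_fun do rewrite expr2.
  by apply: is_derive_eq D2 _; rewrite mul1r mulr1 sub0r mulr_natl mulr2n.
exact: is_derive_comp1 D3 (is_derive_pos_sq _).
Qed.

Lemma continuous_dbump1 : continuous dbump1.
Proof.
have csq : continuous (fun s : R => 1 - s ^+ 2).
  move=> s; apply: cvgB_at; first exact: cvg_cst_at.
  by under eq_fun do rewrite expr2; rewrite expr2; apply: cvgM_at; exact: cvg_id.
move=> s; apply: cvgM_at; last first.
  by apply: cvgN_at; apply: cvgM_at; [exact: cvg_cst_at|exact: cvg_id].
apply: cvgM_at; first exact: cvg_cst_at.
apply: (@continuous_comp _ _ _ (fun s : R => 1 - s ^+ 2) (fun s => Num.max s 0)).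
  exact: csq.
exact: continuous_max0.
Qed.

Lemma bump1_ge0 s : 0 <= bump1 s.
Proof. exact: sqr_ge0. Qed.

Lemma bump1_gt0 s : `|s| < 1 -> 0 < bump1 s.
Proof.
move=> s1; rewrite /bump1 /pos_sq exprn_gt0// lt_max subr_gt0.
by rewrite ltxx orbF -real_normK ?num_real// expr_lt1.
Qed.

Lemma bump1_out s : 1 <= `|s| -> bump1 s = 0.
Proof.
move=> s1; rewrite /bump1 /pos_sq max_r ?expr0n//.
by rewrite subr_le0 -real_normK ?num_real// expr_ge1.
Qed.

Lemma is_derive_coord n (x v : 'rV[R]_n) k :
  is_derive x v (fun y : 'rV[R]_n => y 0 k) (v 0 k).
Proof.
have did : derivable (@id 'rV[R]_n) x v by exact: derivable_id.
split; first exact: ((derivable_mxP id x v).1 did 0 k).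
have := derive_mx did; rewrite derive_id => /matrixP/(_ 0 k) ->.
by rewrite mxE.
Qed.

Lemma C1_coord n (U : set 'rV[R]_n) k : open U -> C1_on U (fun y => y 0 k).
Proof.
move=> oU; apply: (C1_onI oU (D := fun i _ => (delta_mx 0 i : 'rV[R]_n) 0 k)).
  by move=> x i _; exact: is_derive_coord.
by move=> x i _; exact: cvg_cst_at.
Qed.

Definition bump n (x0 : 'rV[R]_n) (e : R) (y : 'rV[R]_n) : R :=
  \prod_i bump1 (e^-1 * (y 0 i - x0 0 i)).

Lemma C1_bump n (U : set 'rV[R]_n) x0 e : open U -> C1_on U (bump x0 e).
Proof.
move=> oU; apply: (C1_prod oU) => i.
apply: (C1_comp1 oU (h := bump1) (dh := dbump1)) => [|x _|x _].
- apply: (C1_mul oU); first exact: C1_cst.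
  by apply: (C1_add oU); [exact: C1_coord|exact: C1_cst].
- exact: is_derive_bump1.
- exact: continuous_dbump1.
Qed.

Lemma bump_ge0 n (x0 : 'rV[R]_n) e y : 0 <= bump x0 e y.
Proof. by apply: prodr_ge0 => i _; exact: bump1_ge0. Qed.

Lemma bump_gt0 n (x0 : 'rV[R]_n) e y : 0 < e -> `|y - x0| < e -> 0 < bump x0 e y.
Proof.
move=> e0 ye; apply: prodr_gt0 => i _; apply: bump1_gt0.
rewrite normrM normfV (gtr0_norm e0) ltr_pdivrMl// mulr1.
by apply: le_lt_trans ye; have := rV_coord_le (y - x0) i; rewrite !mxE.
Qed.

Lemma bump_out n (x0 : 'rV[R]_n) e y : 0 < e -> ~ (`|y - x0| <= e) -> bump x0 e y = 0.
Proof.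
move=> e0 ye; apply/eqP; apply: contra_notT ye => /prodf_neq0 by0.
apply: rV_norm_le => [|i]; first exact: ltW.
have := by0 i isT; rewrite !mxE => byi; rewrite leNgt; apply: contra byi => ey.
apply/eqP/bump1_out; rewrite normrM normfV (gtr0_norm e0) ler_pdivlMl// mulr1.
exact: ltW.
Qed.

End Bump.

Section Partition.
Context {R : realType} {n : nat} {M : ptopologicalType} (A : smooth_atlas R n M).
Hypotheses (hausdorff_M : hausdorff_space M) (compact_M : compact [set: M]).

Lemma C1_M_mul (f g : M -> R) : C1_M A f -> C1_M A g -> C1_M A (fun p => f p * g p).
Proof.
by move=> Cf Cg a; apply: (C1_mul (@open_chart_cod _ _ _ A a)); [exact: Cf|exact: Cg].
Qed.

Lemma C1_M_sum I (s : seq I) (f : I -> M -> R) : (forall i, C1_M A (f i)) ->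
  C1_M A (fun p => \sum_(i <- s) f i p).
Proof.
by move=> Cf a; apply: (C1_sum (@open_chart_cod _ _ _ A a)) => i; exact: Cf.
Qed.

Lemma C1_M_inv (f : M -> R) : C1_M A f -> (forall p, f p != 0) ->
  C1_M A (fun p => (f p)^-1).
Proof.
move=> Cf f0 a; apply: (C1_inv (@open_chart_cod _ _ _ A a)); first exact: Cf.
by move=> x _; exact: f0.
Qed.

(** K is the image of a closed cube around the coordinates of p, and V that of the
    open cube.  The compactness of K makes the extension by 0 of class C^1 on M. *)
Lemma local_bump p : exists (b : M -> R) (K V : set M),
  [/\ C1_M A b, compact K, K `<=` chart_dom (chart_at A p), open V & V p] /\
  [/\ forall q, ~ K q -> b q = 0, forall q, 0 <= b q & forall q, V q -> 0 < b q].
Proof.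
pose a := chart_at A p; have ap : chart_dom a p := chart_at_dom A p.
pose x0 := chart a p; have ax0 : chart_cod a x0 by exact: chart_cod_chart.
have /nbhs_ballP[d /= d0 dU] : nbhs x0 (chart_cod a).
  by apply: open_nbhs_nbhs; split=> //; exact: open_chart_cod.
pose e := d / 2; have e0 : 0 < e by rewrite divr_gt0.
pose Q := [set x : 'rV[R]_n | `|x - x0| <= e].
have QU : Q `<=` chart_cod a.
  move=> x Qx; apply: dU; rewrite -ball_normE/= distrC.
  by apply: (le_lt_trans Qx); rewrite /e ltr_pdivrMr// ltr_pMr// ltr1n.
have cQ : compact Q.
  have -> : Q = (fun y => y + x0) @` [set y : 'rV[R]_n | `|y| <= e].
    apply/seteqP; split=> [x Qx|_ [y ye <-]]; last by rewrite /Q /= addrK.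
    by exists (x - x0) => //; rewrite subrK.
  apply: continuous_compact; last exact: closed_ball_rV_compact.
  apply: continuous_subspaceT => y; exact: (@cvgD _ _ _ (nbhs y) _ (fun y => y) (fun=> x0) y x0 cvg_id (cvg_cst x0)).
pose K := param a @` Q.
have Ka : K `<=` chart_dom a by move=> _ [x /QU ax <-]; exact: param_dom.
have cK : compact K.
  apply: continuous_compact => //; apply: continuous_in_subspaceT => x /set_mem /QU ax.
  exact: param_continuous.
pose b q := \1_(chart_dom a) q * bump x0 e (chart a q).
have bE q : chart_dom a q -> b q = bump x0 e (chart a q).
  by move=> aq; rewrite /b indicE mem_set// mul1r.
have b0 q : ~ K q -> b q = 0.
  move=> nKq; have [aq|naq] := pselect (chart_dom a q); last first.
    by rewrite /b indicE memNset// mul0r.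
  rewrite bE// bump_out// => Qq; apply: nKq; exists (chart a q) => //.
  exact: chartK.
pose V := chart_dom a `&` chart a @^-1` (ball x0 e).
exists b, K, V; split; split=> //.
- apply: (C1_M_of_chart hausdorff_M cK Ka b0).
  apply: (C1_ext (@open_chart_cod _ _ _ A a) (f := bump x0 e)).
    by move=> x ax /=; rewrite bE ?paramK//; exact: param_dom.
  by apply: C1_bump; exact: open_chart_cod.
- rewrite openE => q [aq bq]; apply: filterI.
    by apply: open_nbhs_nbhs; split=> //; exact: chart_dom_open.
  have nb : nbhs (chart a q) (ball x0 e).
    by apply: open_nbhs_nbhs; split=> //; exact: ball_open.
  exact: (chart_continuous aq nb).
- by split=> //; exact: ballxx.
- by move=> q; rewrite mulr_ge0// bump_ge0.
- move=> q [aq bq]; rewrite bE//; apply: bump_gt0 => //.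
  by move: bq; rewrite -ball_normE /ball_/= distrC.
Qed.

(** Finitely many of the sets V of [local_bump] cover M, so the sum of the
    corresponding bumps is positive: divide by it. *)
Lemma partition_of_unity : exists (s : seq M) (chi : M -> M -> R) (K : M -> set M),
  (forall k, [/\ C1_M A (chi k), compact (K k), K k `<=` chart_dom (chart_at A k) &
    forall q, ~ K k q -> chi k q = 0]) /\
  (forall q, \sum_(k <- s) chi k q = 1).
Proof.
have /choice[b] := local_bump; move=> /choice[K] /choice[V] HV.
have [D _ DT] : finite_subset_cover setT V setT.
  move: (compact_M); rewrite compact_cover; apply.
    by move=> p _; have [[]] := HV p.
  by move=> p _; exists p => //; have [[]] := HV p.
pose s : seq M := finmap.enum_fset D; pose sigma q := \sum_(k <- s) b k q.
have sigma0 q : 0 < sigma q.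
  have [k kD Vkq] := DT q I.
  have ks : k \in s by [].
  rewrite /sigma (big_rem k)//=; apply: ltr_wpDr.
    by apply: sumr_ge0 => j _; have [_ [_ + _]] := HV j; apply.
  by have [_ [_ _ +]] := HV k; apply.
exists s, (fun k q => b k q * (sigma q)^-1), K; split=> [k|q]; last first.
  by rewrite -mulr_suml -/(sigma q) mulfV// gt_eqF.
have [[Cb cK Ka _ _] [b0 _ _]] := HV k; split=> //.
  apply: C1_M_mul => //; apply: C1_M_inv.
    by apply: C1_M_sum => j; have [[]] := HV j.
  by move=> q; rewrite gt_eqF.
by move=> q /b0 ->; rewrite mul0r.
Qed.

End Partition.

(** * Green's formula for eigenfunctions *)

Lemma partial_near_eq (R : realType) n (f g : 'rV[R]_n -> R) i x :
  (\forall y \near x, f y = g y) -> partial i f x = partial i g x.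
Proof. exact: near_eq_derive. Qed.

Lemma partial_near0 (R : realType) n (f : 'rV[R]_n -> R) i x :
  (\forall y \near x, f y = 0) -> partial i f x = 0.
Proof.
by move=> /(@partial_near_eq _ _ _ (cst 0)) ->; rewrite /partial derive_cst.
Qed.

Lemma C1_extend (R : realType) n (U K : set 'rV[R]_n) (X : 'rV[R]_n -> R) :
  open U -> compact K -> K `<=` U -> C1_on U X -> (forall x, ~ K x -> X x = 0) ->
  C1_on setT X.
Proof.
move=> oU cK KU CX X0 x _; have [Ux|nUx] := pselect (U x); first exact: CX.
have oK : open (~` K).
  by apply: closed_openC; apply: compact_closed cK; exact: norm_hausdorff.
have : C1_on (~` K) X.
  by apply: (C1_ext oK (f := fun=> 0)); [move=> y /X0|exact: C1_cst].
by apply => /KU.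
Qed.

Lemma eq_continuous_at (T S : topologicalType) (f g : T -> S) (x : T) :
  f =1 g -> {for x, continuous f} -> {for x, continuous g}.
Proof. by move=> /funext ->. Qed.

Section Green.
Context {R : realType} {n : nat} {M : ptopologicalType} (A : smooth_atlas R n M).
Variables (g : tensor2 A) (dv : {measure set (borelType M) -> \bar R}).
Hypotheses (hausdorff_M : hausdorff_space M) (compact_M : compact [set: M]).
Hypothesis metric_g : riemannian_metric g.
Hypothesis C1_g : forall a i j, C1_on (chart_cod a) (fun x => g a x i j).
Hypothesis volume_dv : riemannian_volume g dv.
Implicit Types (f w : M -> R).

Definition grad_ip f w : M -> R := scalar_at (fun a x =>
  dual_form (g a x) (grad (f \o param a) x) (grad (w \o param a) x)).

Lemma metric_symm a x : chart_cod a x -> (g a x)^T = g a x.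
Proof. by have [+ _ _] := metric_g; apply. Qed.

Lemma metric_unitmx a x : chart_cod a x -> g a x \in unitmx.
Proof.
by move=> ax; rewrite unitmxE unitfE; apply: posdef_det_neq0; exact: metric_posdef metric_g _ _ ax.
Qed.

Lemma metric_change_chart a b p : chart_dom a p -> chart_dom b p ->
  g a (chart a p) = jac a b p *m g b (chart b p) *m (jac a b p)^T.
Proof. by have [_ _ +] := metric_g; apply. Qed.

Lemma grad_ip_compat f w a b p : C1_M A f -> C1_M A w ->
  chart_dom a p -> chart_dom b p ->
  dual_form (g a (chart a p)) (grad (f \o param a) (chart a p))
    (grad (w \o param a) (chart a p)) =
  dual_form (g b (chart b p)) (grad (f \o param b) (chart b p))
    (grad (w \o param b) (chart b p)).
Proof.
move=> Cf Cw ap bp; rewrite (grad_change_chart ap bp Cf) (grad_change_chart ap bp Cw).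
apply: dual_form_congruence; last exact: metric_change_chart.
exact/metric_unitmx/chart_cod_chart.
Qed.

Lemma grad_ip_param f w a x : C1_M A f -> C1_M A w -> chart_cod a x ->
  grad_ip f w (param a x) =
  dual_form (g a x) (grad (f \o param a) x) (grad (w \o param a) x).
Proof.
move=> Cf Cw ax.
exact: (@scalar_at_param _ _ _ _ (fun a x => dual_form (g a x)
  (grad (f \o param a) x) (grad (w \o param a) x))
  (fun a b p => @grad_ip_compat f w a b p Cf Cw)).
Qed.

Lemma dual_form_continuous a f w x : chart_cod a x ->
  C1_on (chart_cod a) (f \o param a) -> C1_on (chart_cod a) (w \o param a) ->
  {for x, continuous (fun x =>
    dual_form (g a x) (grad (f \o param a) x) (grad (w \o param a) x))}.
Proof.
move=> ax Cf Cw; have oa := @open_chart_cod _ _ _ A a.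
apply: (@eq_continuous_at _ _ (fun x => \sum_i \sum_j metric_inv (g a) x i j *
  partial i (f \o param a) x * partial j (w \o param a) x)).
  by move=> y; rewrite dual_formE.
apply: cvg_sum_at => i _; apply: cvg_sum_at => j _; apply: cvgM_at.
  apply: cvgM_at; last exact: C1_partial_continuous Cf ax.
  exact: (C1_continuous oa (C1_metric_inv oa (@C1_g a) (@metric_posdef _ _ _ _ _ metric_g a) i j) ax).
exact: C1_partial_continuous Cw ax.
Qed.

Lemma grad_ip_continuous f w : C1_M A f -> C1_M A w -> continuous (grad_ip f w).
Proof.
move=> Cf Cw; apply: scalar_at_continuous.
  by move=> a b p; exact: grad_ip_compat.
by move=> a x ax; exact: dual_form_continuous (Cf a) (Cw a).
Qed.

Lemma grad_ip_support (K : set M) f w p : compact K ->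
  (forall q, ~ K q -> w q = 0) -> ~ K p -> grad_ip w f p = 0.
Proof.
move=> cK w0 nKp; rewrite /grad_ip /scalar_at.
set a := chart_at A p; have ap : chart_dom a p := chart_at_dom A p.
suff -> : grad (w \o param a) (chart a p) = 0.
  by rewrite /dual_form trmx0 !mul0mx mxE.
apply/colP => i; rewrite !mxE; apply: partial_near0.
have ax := chart_cod_chart ap.
have oK : open (~` K) by apply: closed_openC; exact: compact_closed.
have nb : nbhs (param a (chart a p)) (~` K).
  by rewrite chartK//; exact: open_nbhs_nbhs.
have nb2 : nbhs (chart a p) (param a @^-1` (~` K)) := param_continuous ax nb.
by apply: filterS nb2 => y /= nKy; exact: w0.
Qed.

Lemma integrable_continuous f : continuous f ->
  dv.-integrable setT (EFin \o f).
Proof.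
move=> cf; have [s [chi [K [Hk chi1]]]] := partition_of_unity A hausdorff_M compact_M.
have -> : EFin \o f = (fun p => \sum_(k <- s) (chi k p * f p)%:E)%E.
  apply/funext => p; rewrite sumEFin -mulr_suml chi1 mul1r//.
apply: (@integrable_sum _ _ _ dv setT measurableT M s xpredT
  (fun k p => (chi k p * f p)%:E)) => k _.
have [Cchi cK Ka chi0] := Hk k.
have cchif : continuous (fun p => chi k p * f p).
  by move=> p; apply: cvgM_at; [exact: C1_M_continuous Cchi _|exact: cf].
have chif0 p : ~ K k p -> chi k p * f p = 0 by move=> /chi0 ->; rewrite mul0r.
by have [] := integral_chart metric_g C1_g volume_dv cK Ka cchif chif0.
Qed.

Section Eigen.
Variables (f : M -> R) (lambda : R).
Hypothesis Cf : C1_M A f.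
Hypothesis Cdf : forall (a : chart_index A) j, C1_on (chart_cod a) (partial j (f \o param a)).
Hypothesis eigen_f : forall (a : chart_index A) x, chart_cod a x ->
  - laplacian (g a) (f \o param a) x = lambda * f (param a x).

(** In the chart, the integrand times sqrt(det g) is the divergence of the
    compactly supported field w sqrt(det g) g^ij d_j f. *)
Lemma green_chart w (a : chart_index A) (K : set M) : compact K -> K `<=` chart_dom a ->
  (forall p, ~ K p -> w p = 0) -> C1_M A w ->
  (\int[dv]_p (grad_ip w f p - lambda * (w p * f p))%:E = 0)%E.
Proof.
move=> cK Ka w0 Cw; have oa := @open_chart_cod _ _ _ A a.
pose F p := grad_ip w f p - lambda * (w p * f p).
have cF : continuous F.
  move=> p; apply: cvgB_at; first exact: grad_ip_continuous.
  apply: cvgM_at; first exact: cvg_cst_at.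
  by apply: cvgM_at; apply: C1_M_continuous.
have F0 p : ~ K p -> F p = 0.
  by move=> nKp; rewrite /F (grad_ip_support _ cK)// w0// mul0r mulr0 subrr.
have [_ ->] := integral_chart metric_g C1_g volume_dv cK Ka cF F0.
pose X i y := pull a w y *
  \sum_j vol_density (g a) y * metric_inv (g a) y i j * partial j (f \o param a) y.
have Cpw : C1_on (chart_cod a) (pull a w).
  by apply: (C1_ext oa (f := w \o param a)) => [x ax|]; [rewrite pullE|exact: Cw].
have pos := @metric_posdef _ _ _ _ _ metric_g a.
have sym := @metric_symm a.
have CX i : C1_on (chart_cod a) (X i).
  apply: C1_mul => //; apply: C1_sum => // j; apply: C1_mul => //.
  apply: C1_mul => //; first exact: (C1_vol_density oa (@C1_g a) pos).
  exact: (C1_metric_inv oa (@C1_g a) pos).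
have X0 i x : ~ (chart a @` K) x -> X i x = 0.
  by move=> nKx; rewrite /X (pull_support w0 nKx) mul0r.
have cK' := chart_compact cK Ka; have Ka' := chart_image_cod Ka.
have oK' : open (~` (chart a @` K)).
  by apply: closed_openC; apply: compact_closed cK'; exact: norm_hausdorff.
have CXT i : C1_on setT (X i) by exact: C1_extend oa cK' Ka' (CX i) (X0 i).
have [k Hk] := compact_rV_bounded cK'.
have Xk i x : k < `|x| -> X i x = 0.
  by move=> kx; apply: X0 => /Hk; apply/negP; rewrite -ltNge.
rewrite (_ : (fun x => _) = (fun x => \sum_i (partial i (X i) x)%:E)%E).
  rewrite integral_sum//; first by rewrite big1// => i _; exact: integral_partial_eq0 (CXT i) (Xk i).
  move=> i; apply: (@continuous_support_integrable _ _ _ k).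
    by move=> x; exact: (C1_partial_continuous (U := setT)).
  by move=> x kx; exact: partial_out (Xk i) kx.
apply/funext => x; rewrite sumEFin; congr (_%:E).
have [ax|nax] := pselect (chart_cod a x); last first.
  rewrite pull_out// mul0r big1// => i _; apply: partial_near0.
  by apply: near_open oK' _ (X0 i) => /Ka'.
rewrite (green_divergence oa (@C1_g a) sym pos Cpw (@Cdf a) ax).
rewrite mulrC !pullE//; congr (_ * _); rewrite /F grad_ip_param//.
rewrite -[laplacian _ _ _]opprK eigen_f// -dual_formE addrC mulrN.
congr (_ + _); first by ring.
apply: eq_bigr => i _; apply: eq_bigr => j _; congr (_ * _ * _).
apply: partial_near_eq; apply: near_open oa ax _ => y ay.
by rewrite pullE.
Qed.

(** The formula is linear in w, and the cut-off functions chi k w satisfy it by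
    [green_chart]. *)
Lemma green w : C1_M A w ->
  (\int[dv]_p (grad_ip w f p)%:E = \int[dv]_p (lambda * (w p * f p))%:E)%E.
Proof.
move=> Cw; have [s [chi [K [Hk chi1]]]] := partition_of_unity A hausdorff_M compact_M.
pose wk k p := chi k p * w p.
have Cwk k : C1_M A (wk k) by apply: C1_M_mul => //; have [] := Hk k.
have cwf : continuous (fun p => lambda * (w p * f p)).
  move=> p; apply: cvgM_at; first exact: cvg_cst_at.
  by apply: cvgM_at; apply: C1_M_continuous.
have i1 : dv.-integrable setT (EFin \o grad_ip w f).
  by apply: integrable_continuous; exact: grad_ip_continuous.
have i2 := integrable_continuous cwf.
suff E : (\int[dv]_p (grad_ip w f p)%:E - \int[dv]_p (lambda * (w p * f p))%:E = 0)%E.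
  have fa : (\int[dv]_p (grad_ip w f p)%:E \is a fin_num)%E by exact: integrable_fin_num i1.
  have /eqP := E; rewrite (@sube_eq _ _ 0%E) ?add0e => [/eqP//|//|].
  exact: fin_num_adde_defr.
rewrite -integralB//.
have -> : (fun p => (grad_ip w f p)%:E - (lambda * (w p * f p))%:E)%E =
    (fun p => \sum_(k <- s) (grad_ip (wk k) f p - lambda * (wk k p * f p))%:E)%E.
  apply/funext => p; rewrite sumEFin -EFinB; congr (_%:E).
  rewrite sumrB; congr (_ - _); last first.
    rewrite -mulr_sumr; congr (_ * _).
    by rewrite -mulr_suml -mulr_suml chi1 mul1r.
  rewrite /grad_ip /scalar_at; set a := chart_at A p; set x := chart a p.
  have ax : chart_cod a x by apply: chart_cod_chart; exact: chart_at_dom.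
  rewrite -dual_formE; under [RHS]eq_bigr do rewrite -dual_formE.
  rewrite [RHS]exchange_big; apply: eq_bigr => i _ /=; rewrite [RHS]exchange_big; apply: eq_bigr => j _ /=.
  rewrite -mulr_suml -mulr_sumr; congr (_ * _ * _).
  rewrite /partial; apply: derive_val.
  apply: (@near_eq_is_derive _ _ _ (fun y => \sum_(k <- s) (wk k \o param a) y)).
    by apply: near_open openT I _ => y _; rewrite /= -mulr_suml chi1 mul1r.
  by apply: is_derive_bigsum => k _; exact: C1_is_derive (Cwk k a) ax.
rewrite integral_sum//.
  rewrite big1// => k _; have [Cchi cK Ka chi0] := Hk k.
  by apply: (green_chart cK Ka) => // p /chi0; rewrite /wk => ->; rewrite mul0r.
move=> k; apply: integrable_continuous => p.
apply: cvgB_at; first exact: grad_ip_continuous.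
apply: cvgM_at; first exact: cvg_cst_at.
by apply: cvgM_at; apply: C1_M_continuous.
Qed.

End Eigen.
End Green.

(** * Passing to the limit under the integral sign *)

Section MatrixContinuity.
Context {R : realType} {T : topologicalType} {n : nat}.
Variables (z : T) (G : T -> 'M[R]_n).
Hypothesis cG : forall i j, G y i j @[y --> z] --> G z i j.

Lemma cvg_det_at m (B : T -> 'M[R]_m) :
  (forall i j, B y i j @[y --> z] --> B z i j) ->
  \det (B y) @[y --> z] --> \det (B z).
Proof.
move=> cB; apply: cvg_sum_at => s _; apply: cvgM_at; first exact: cvg_cst_at.
by apply: cvg_prod_at => i _; exact: cB.
Qed.

Lemma cvg_invmx_at : (\forall y \near z, G y \in unitmx) ->
  forall i j, invmx (G y) i j @[y --> z] --> invmx (G z) i j.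
Proof.
move=> uG i j; have uz : G z \in unitmx := nbhs_singleton uG.
have : {for z, continuous (fun y => (\det (G y))^-1 *
    ((-1) ^+ (j + i) * \det (row' j (col' i (G y)))))}.
  apply: cvgM_at.
    apply: cvgV_at; last exact: cvg_det_at.
    by move: uz; rewrite unitmxE unitfE.
  apply: cvgM_at; first exact: cvg_cst_at.
  apply: (@cvg_det_at _ (fun y => row' j (col' i (G y)))) => a b.
  by under eq_fun do rewrite !mxE; rewrite !mxE; exact: cG.
apply: near_eq_continuous; apply: filterS uG => y uy.
by rewrite [in RHS]/invmx uy [RHS]mxE [X in _ = _ * X]mxE /cofactor.
Qed.

Lemma cvg_mulmx_at m p (B : T -> 'M[R]_(m, n)) (C : T -> 'M[R]_(n, p)) :
  (forall i j, B y i j @[y --> z] --> B z i j) ->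
  (forall i j, C y i j @[y --> z] --> C z i j) ->
  forall i j, (B y *m C y) i j @[y --> z] --> (B z *m C z) i j.
Proof.
move=> cB cC i j; under eq_fun do rewrite mxE; rewrite mxE.
by apply: cvg_sum_at => k _; apply: cvgM_at.
Qed.

End MatrixContinuity.

Section Slices.
Context {R : realType} {V : normedModType R}.
Implicit Types (F : R * V -> R).

Lemma is_derive_fst F (t : R) (x : V) : derivable F (t, x) (1, 0) ->
  is_derive t 1 (fun t' => F (t', x)) ('D_((1, 0) : R * V) F (t, x)).
Proof.
move=> dF.
have E : (fun h : R => h^-1 *: ((fun t' => F (t', x)) (h *: 1 + t) - F (t, x))) =
   (fun h : R => h^-1 *: ((F \o shift (t, x)) (h *: ((1, 0) : R * V)) - F (t, x))).
  by apply/funext => h /=; congr (_ *: (F _ - _)); congr pair; rewrite /= scaler0 add0r.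
by split; rewrite /derivable /derive /= E.
Qed.

Lemma is_derive_snd F (t : R) (x v : V) : derivable F (t, x) (0, v) ->
  is_derive x v (fun y => F (t, y)) ('D_((0, v) : R * V) F (t, x)).
Proof.
move=> dF.
have E : (fun h : R => h^-1 *: ((fun y => F (t, y)) (h *: v + x) - F (t, x))) =
   (fun h : R => h^-1 *: ((F \o shift (t, x)) (h *: ((0, v) : R * V)) - F (t, x))).
  by apply/funext => h /=; congr (_ *: (F _ - _)); congr pair; rewrite /= scaler0 add0r.
by split; rewrite /derivable /derive /= E.
Qed.

Lemma continuous_slice (T : topologicalType) (F : R * V -> T) t x :
  {for (t, x), continuous F} -> {for x, continuous (fun y => F (t, y))}.
Proof.
move=> cF B /cF nB; have : nbhs (t, x) (F @^-1` B) by [].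
move=> [[P Q] /= [nP nQ] PQ]; apply: filterS nQ => y Qy; apply: PQ; split=> //=.
exact: nbhs_singleton nP.
Qed.

End Slices.

Section Quotient.
Context {R : realType} {V : normedModType R}.
Variables (F dF : R -> V -> R) (t0 : R) (x0 : V).
Hypothesis DF : \forall z \near (t0, x0), is_derive (z.1 : R) 1 (fun t => F t z.2) (dF z.1 z.2).
Hypothesis cdF : {for (t0, x0), continuous (fun z : R * V => dF z.1 z.2)}.

(** The difference quotient in time, completed by the derivative at t = t0 to make
    it continuous in (t, x). *)
Definition quotient (F dF : R -> V -> R) (t0 t : R) (x : V) : R :=
  if t == t0 then dF t0 x else (t - t0)^-1 * (F t x - F t0 x).

(** By the mean value theorem the quotient at (t, x) is a value of dF (., x) at a
    time between t0 and t. *)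
Lemma quotient_continuous :
  {for (t0, x0), continuous (fun z : R * V => quotient F dF t0 z.1 z.2)}.
Proof.
apply/(@cvgrPdist_le _ _ _ (nbhs (t0, x0))) => e e0 /=.
have Q0 : quotient F dF t0 t0 x0 = dF t0 x0 by rewrite /quotient eqxx.
have : \forall z \near (t0, x0), is_derive (z.1 : R) 1 (fun t => F t z.2) (dF z.1 z.2) /\
    `|dF t0 x0 - dF z.1 z.2| <= e.
  by apply: filterI => //; move/(@cvgrPdist_le _ _ _ (nbhs (t0, x0))) : cdF; apply.
move=> /nbhs_ballP[d /= d0 Hd]; apply/nbhs_ballP; exists d => //= -[t x] [/= tb xb].
rewrite Q0 /quotient; case: ifPn => [/eqP tt0|tt0].
  by have [] := Hd (t0, x) (conj (ballxx _ d0) xb).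
have inb s : `|s| <= `|t - t0| -> ball (t0, x0) d (t0 + s, x).
  move=> st; split=> //=; rewrite -ball_normE /ball_/= opprD addNKr normrN.
  by apply: le_lt_trans st _; rewrite distrC; move: tb; rewrite -ball_normE.
have [s st|s st] := @MVT_line R R (fun t => F t x) t0 1 (t - t0).
  rewrite [s *: 1]mulr1; have [D _] := Hd _ (inb s st); exact: ex_derive.
rewrite [(t - t0) *: 1]mulr1 [s *: 1]mulr1 [t0 + (t - t0)]addrC subrK => ->.
have [D ?] := Hd _ (inb s st).
by rewrite mulKf ?subr_eq0// (@derive_val _ _ _ _ _ _ _ D).
Qed.

End Quotient.

Section IntegralLimit.
Context {R : realType} {n : nat}.

Lemma uniform_on_compact (Phi : R -> 'rV[R]_n -> R) (t0 : R) (K : set 'rV[R]_n) (e : R) :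
  compact K -> 0 < e ->
  (forall x, K x -> {for (t0, x), continuous (fun z : R * 'rV[R]_n => Phi z.1 z.2)}) ->
  \forall t \near t0, forall x, K x -> `|Phi t0 x - Phi t x| <= e.
Proof.
move=> /compact_near_coveringP cK e0 cPhi.
apply: (cK _ (nbhs t0) (fun t x => `|Phi t0 x - Phi t x| <= e)) => x Kx.
have e20 : 0 < e / 2 by rewrite divr_gt0.
have := cPhi x Kx; move/(@cvgrPdist_le _ _ _ (nbhs (t0, x)))/(_ _ e20) => [[P Q] /= [nP nQ] PQ].
exists (Q, P) => //= -[y t] [/= Qy Pt].
have P0 := nbhs_singleton nP.
have /= H1 := PQ (t, y) (conj Pt Qy); have /= H2 := PQ (t0, y) (conj P0 Qy).
rewrite (_ : _ - _ = (Phi t0 x - Phi t y) - (Phi t0 x - Phi t0 y)); last by ring.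
by rewrite (le_trans (ler_normB _ _))// [leRHS](splitr e) lerD.
Qed.

(** One constant C, the volume of the ball of radius k, serves all f. *)
Lemma norm_integral_le (k : R) :
  exists2 C : R, 0 <= C & forall (f : 'rV[R]_n -> R) e, 0 <= e -> continuous f ->
    (forall x, k < `|x| -> f x = 0) -> (forall x, `|f x| <= e) ->
    `|\int[lebesgue_rV R n]_x f x| <= e * C.
Proof.
pose B := [set x : 'rV[R]_n | `|x| <= k].
have mB : measurable (B : set (borelType 'rV[R]_n)).
  have oB : open (~` B).
    apply: closed_openC; apply: compact_closed; first exact: norm_hausdorff.
    exact: closed_ball_rV_compact.
  by have := measurableC (borel_open oB); rewrite setCK.
have Boo : (lebesgue_rV R n B < +oo)%E.
  apply: (@lebesgue_rV_bounded _ _ _ k) => // x Bx i.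
  exact: le_trans (rV_coord_le _ _) Bx.
exists (fine (lebesgue_rV R n B)); first exact: fine_ge0.
move=> f e e0 cf f0 fe.
have fi : (lebesgue_rV R n).-integrable setT (EFin \o f).
  exact: continuous_support_integrable cf f0.
have fB : f = f \_ B.
  apply/funext => x; rewrite patchE; case: ifPn => // /negP; rewrite inE /B /=.
  by move=> /negP; rewrite -ltNge => /f0.
rewrite {1}fB -Rintegral_mkcond.
have fiB : (lebesgue_rV R n).-integrable B (EFin \o f) by exact: integrableS fi.
apply: (le_trans (le_normr_Rintegral mB fiB)).
apply: (@le_trans _ _ (\int[lebesgue_rV R n]_(x in B) e)); last by rewrite Rintegral_cst.
apply: le_Rintegral => //.
- exact: integrable_norm fiB.
- apply: (@measurable_bounded_integrable _ (borelType _) R (lebesgue_rV R n) (fun=> e) B) => //.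
  by exists e; split; rewrite ?num_real// => M eM x _ /=; rewrite ger0_norm// ltW.
Qed.

(** Convergence is uniform on K, and K carries all the supports. *)
Lemma integral_limit (Phi : R -> 'rV[R]_n -> R) (t0 : R) (K : set 'rV[R]_n) :
  compact K ->
  (forall x, K x -> {for (t0, x), continuous (fun z : R * 'rV[R]_n => Phi z.1 z.2)}) ->
  (forall t x, ~ K x -> Phi t x = 0) ->
  (\forall t \near t0, continuous (Phi t)) ->
  \int[lebesgue_rV R n]_x Phi t x @[t --> t0] --> \int[lebesgue_rV R n]_x Phi t0 x.
Proof.
move=> cK cPhi Phi0 cPhit.
have [k Hk] := compact_rV_bounded cK.
have Phik t x : k < `|x| -> Phi t x = 0.
  by move=> kx; apply: Phi0 => /Hk; apply/negP; rewrite -ltNge.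
have [C C0 HC] := norm_integral_le k.
have c0 : continuous (Phi t0) := nbhs_singleton cPhit.
apply/cvgrPdist_le => e e0.
have e'0 : 0 < e / (C + 1) by rewrite divr_gt0// ltr_wpDl.
have U := uniform_on_compact cK e'0 cPhi.
near=> t.
have ct : continuous (Phi t) by near: t.
have Ut : forall x, K x -> `|Phi t0 x - Phi t x| <= e / (C + 1) by near: t.
rewrite -RintegralB//; last 2 first.
- exact: continuous_support_integrable c0 (Phik _).
- exact: continuous_support_integrable ct (Phik _).
apply: (@le_trans _ _ (e / (C + 1) * C)).
  apply: HC.
  - exact: ltW.
  - by move=> x; apply: cvgB_at; [exact: c0|exact: ct].
  - by move=> x kx; rewrite !Phik// subrr.
  - move=> x; have [Kx|nKx] := pselect (K x); first exact: Ut.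
    by rewrite !Phi0// subrr normr0 ltW.
rewrite mulrAC ler_pdivrMr ?ltr_wpDl// ler_pM2l// lerDl//.
Unshelve. all: by end_near. Qed.

End IntegralLimit.

(** * The metric and its derivative in time *)

Section Forms.
Context {R : realType} {n : nat}.
Implicit Types (B h : 'M[R]_n) (v w : 'cV[R]_n).

Lemma bilinear_formE B v w :
  (v^T *m B *m w) 0 0 = \sum_i \sum_j B i j * v i 0 * w j 0.
Proof.
rewrite mxE exchange_big; apply: eq_bigr => j _.
rewrite !mxE mulr_suml; apply: eq_bigr => i _; rewrite !mxE.
by rewrite [v i 0 * _]mulrC.
Qed.

Lemma invmx_sym B : B^T = B -> (invmx B)^T = invmx B.
Proof. by move=> sB; rewrite trmx_inv sB. Qed.

Lemma dual_form_sym B v w : B^T = B -> dual_form B v w = dual_form B w v.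
Proof.
move=> sB; rewrite /dual_form !bilinear_formE exchange_big.
apply: eq_bigr => j _; apply: eq_bigr => i _.
by rewrite -{1}(invmx_sym sB) mxE mulrAC.
Qed.

Lemma raised_formD B h k (a b : R) v w :
  raised_form B (a *: h + b *: k) v w =
  a * raised_form B h v w + b * raised_form B k v w.
Proof.
by rewrite /raised_form mulmxDr !mulmxDl -!scalemxAr -!scalemxAl !mxE.
Qed.

Lemma raised_form_self B v w : B \in unitmx -> raised_form B B v w = dual_form B v w.
Proof. by move=> uB; rewrite /raised_form /dual_form mulmxKV. Qed.

Lemma metric_traceD B h k (a b : R) :
  metric_trace B (a *: h + b *: k) = a * metric_trace B h + b * metric_trace B k.
Proof. by rewrite /metric_trace mulmxDr linearD/= -!scalemxAr !linearZ. Qed.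

Lemma metric_trace_self B : B \in unitmx -> metric_trace B B = n%:R.
Proof. by move=> uB; rewrite /metric_trace mulVmx// mxtrace1. Qed.

End Forms.

Section STensor.
Context {R : realType} {n : nat}.
Variables (alpha : R) (G : 'rV[R]_n -> 'M[R]_n) (f u : 'rV[R]_n -> R) (x : 'rV[R]_n).
Hypothesis symG : (G x)^T = G x.

Definition S_matrix : 'M[R]_n := \matrix_(i, j) S_tensor alpha G f i j x.

Lemma S_scalarE : S_scalar alpha G f x = metric_trace (G x) S_matrix.
Proof.
rewrite /S_scalar /metric_trace /mxtrace exchange_big; apply: eq_bigr => j _.
rewrite mxE; apply: eq_bigr => i _; rewrite mxE /metric_inv.
by rewrite -{1}(invmx_sym symG) mxE.
Qed.

Lemma S_grad_gradE :
  S_grad_grad alpha G f u x = raised_form (G x) S_matrix (grad u x) (grad u x).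
Proof.
rewrite /raised_form -!mulmxA !mulmxA -(mulmxA _ (invmx _) S_matrix).
rewrite -(mulmxA _ (_ *m S_matrix) (invmx _)) bilinear_formE.
apply: eq_bigr => i _; apply: eq_bigr => j _; rewrite ![grad _ _ _ _]mxE.
congr (_ * _ * _); rewrite /S_raised mxE exchange_big; apply: eq_bigr => l _.
rewrite mxE mulr_suml; apply: eq_bigr => k _; rewrite [S_matrix _ _]mxE /metric_inv.
rewrite -{2}(invmx_sym symG) [_^T _ _]mxE; ring.
Qed.

End STensor.

Section Family.
Context {R : realType} {n : nat} {M : ptopologicalType} {A : smooth_atlas R n M}.
Variables (I : set R) (g : R -> tensor2 A).
Implicit Types (a b : chart_index A) (t : R) (x : 'rV[R]_n).
Hypotheses (open_I : open I) (smooth_g : smooth_metric_family I g).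

Let nearI t a x : I t -> chart_cod a x ->
  \forall z \near (t, x), I z.1 /\ chart_cod a z.2.
Proof.
move=> It ax; exists (I, chart_cod a); last by move=> z [].
by split; apply: open_nbhs_nbhs; split=> //; exact: open_chart_cod.
Qed.

Let metric_t t : I t -> riemannian_metric (g t).
Proof. by have [+ _] := smooth_g; apply. Qed.

Lemma family_C1 t a i j : I t -> C1_on (chart_cod a) (fun x => g t a x i j).
Proof.
move=> It; pose F (z : R * 'rV[R]_n) := g z.1 a z.2 i j.
have [_ sF] := smooth_g.
apply: (C1_onI (@open_chart_cod _ _ _ A a)
  (D := fun l x => 'D_((0, delta_mx 0 l) : R * 'rV[R]_n) F (t, x))) => x l ax.
  apply: (@is_derive_snd _ _ F); have [_] := sF a i j [::] (t, x) (conj It ax).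
  exact.
have [c _] := sF a i j [:: ((0, delta_mx 0 l) : R * 'rV[R]_n)] (t, x) (conj It ax).
exact: (continuous_slice c).
Qed.

(** The time derivative of the metric, as a directional derivative on R x R^n: in
    this form the smoothness of the family gives its continuity in (t, x). *)
Definition dmetric (a : chart_index A) (z : R * 'rV[R]_n) : 'M[R]_n :=
  \matrix_(i, j) 'D_((1, 0) : R * 'rV[R]_n) (fun z => g z.1 a z.2 i j) z.

Lemma is_derive_metric t a x i j : I t -> chart_cod a x ->
  is_derive t 1 (fun t' => g t' a x i j) (dmetric a (t, x) i j).
Proof.
move=> It ax; rewrite mxE; have [_ sF] := smooth_g.
apply: (@is_derive_fst _ _ (fun z => g z.1 a z.2 i j)).
by have [_] := sF a i j [::] (t, x) (conj It ax); exact.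
Qed.

Lemma metric_joint t a x i j : I t -> chart_cod a x ->
  g z.1 a z.2 i j @[z --> (t, x)] --> g t a x i j.
Proof.
move=> It ax; have [_ sF] := smooth_g.
by have [] := sF a i j [::] (t, x) (conj It ax).
Qed.

Lemma dmetric_joint t a x i j : I t -> chart_cod a x ->
  dmetric a z i j @[z --> (t, x)] --> dmetric a (t, x) i j.
Proof.
move=> It ax; have [_ sF] := smooth_g.
under eq_fun do rewrite mxE; rewrite mxE.
by have [] := sF a i j [:: ((1, 0) : R * 'rV[R]_n)] (t, x) (conj It ax).
Qed.

(** The transition maps do not depend on time, so the transformation law of the
    metric can be differentiated term by term. *)
Lemma dmetric_change_chart t a b p : I t -> chart_dom a p -> chart_dom b p ->
  dmetric a (t, chart a p) = jac a b p *m dmetric b (t, chart b p) *m (jac a b p)^T.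
Proof.
move=> It ap bp; apply/matrixP => i j.
have D1 := is_derive_metric i j It (chart_cod_chart ap).
have D2 : is_derive t 1 (fun t' => g t' a (chart a p) i j)
    ((jac a b p *m dmetric b (t, chart b p) *m (jac a b p)^T) i j).
  have E : \forall t' \near t, (fun t' => \sum_l (\sum_k jac a b p i k *
      g t' b (chart b p) k l) * (jac a b p)^T l j) t' = g t' a (chart a p) i j.
    apply: near_open open_I It _ => t' It'.
    rewrite (metric_change_chart (metric_t It') ap bp) mxE.
    by apply: eq_bigr => l _; rewrite [in RHS]mxE.
  apply: (near_eq_is_derive E).
  have D3 : is_derive t 1 (fun t' => \sum_l (\sum_k jac a b p i k *
      g t' b (chart b p) k l) * (jac a b p)^T l j) (\sum_l
     ((\sum_k (0 * g t b (chart b p) k l + jac a b p i k * dmetric b (t, chart b p) k l))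
       * (jac a b p)^T l j
     + (\sum_k jac a b p i k * g t b (chart b p) k l) * 0)).
    apply: is_derive_bigsum => l _; apply: is_derive_mul.
    apply: is_derive_bigsum => k _; apply: is_derive_mul.
    exact: is_derive_metric (chart_cod_chart bp).
  apply: is_derive_eq D3 _.
  rewrite [RHS]mxE; apply: eq_bigr => l _; rewrite mulr0 addr0 [in RHS]mxE.
  by congr (_ * _); apply: eq_bigr => k _; rewrite mul0r add0r.
by rewrite -(@derive_val _ _ _ _ _ _ _ D1) (@derive_val _ _ _ _ _ _ _ D2).
Qed.

(** [vol] and [vinv] are the coefficients sqrt(det g) of the L^2 product and
    sqrt(det g) g^ij of the Dirichlet form; [dvol] and [dvinv] are their
    derivatives in time. *)
Definition vol (a : chart_index A) t x := vol_density (g t a) x.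
Definition dvol (a : chart_index A) t x :=
  2^-1 * vol a t x * metric_trace (g t a x) (dmetric a (t, x)).
Definition vinv (a : chart_index A) i j t x := vol a t x * metric_inv (g t a) x i j.
Definition dvinv (a : chart_index A) i j t x :=
  dvol a t x * metric_inv (g t a) x i j +
  vol a t x * - (invmx (g t a x) *m dmetric a (t, x) *m invmx (g t a x)) i j.

Let unit_t t a x : I t -> chart_cod a x -> g t a x \in unitmx.
Proof. by move=> It; exact: metric_unitmx (metric_t It) _ _. Qed.

Lemma is_derive_vol a t x : I t -> chart_cod a x ->
  is_derive t 1 (fun t' => vol a t' x) (dvol a t x).
Proof.
move=> It ax; rewrite /dvol /metric_trace mxtrace_mulC.
apply: (@is_derive_sqrt_det _ _ _ t 1 (fun t' => g t' a x)).
- by move=> i j; exact: is_derive_metric.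
- by apply: near_open open_I It _ => t' It'; exact: unit_t.
- exact/posdef_det_gt0/(metric_posdef (metric_t It) ax).
Qed.

Lemma is_derive_vinv a i j t x : I t -> chart_cod a x ->
  is_derive t 1 (fun t' => vinv a i j t' x) (dvinv a i j t x).
Proof.
move=> It ax; apply: is_derive_mul; first exact: is_derive_vol.
apply: (@is_derive_invmx _ _ _ t 1 (fun t' => g t' a x)).
- by move=> k l; exact: is_derive_metric.
- by apply: near_open open_I It _ => t' It'; exact: unit_t.
Qed.

Lemma vol_joint a t x : I t -> chart_cod a x ->
  {for (t, x), continuous (fun z : R * 'rV[R]_n => vol a z.1 z.2)}.
Proof.
move=> It ax; apply: (cvg_comp_at (h := @Num.sqrt R)
  (f := fun z : R * 'rV[R]_n => \det (g z.1 a z.2))).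
  apply: (@cvg_det_at _ _ _ _ (fun z : R * 'rV[R]_n => g z.1 a z.2)) => i j.
  exact: metric_joint.
exact: sqrt_continuous.
Qed.

Lemma inv_joint a t x i j : I t -> chart_cod a x ->
  {for (t, x), continuous (fun z : R * 'rV[R]_n => invmx (g z.1 a z.2) i j)}.
Proof.
move=> It ax; apply: (@cvg_invmx_at _ _ _ _ (fun z : R * 'rV[R]_n => g z.1 a z.2)).
  by move=> k l; exact: metric_joint.
by apply: filterS (nearI It ax) => z [Iz az]; exact: unit_t.
Qed.

Lemma dvol_joint a t x : I t -> chart_cod a x ->
  {for (t, x), continuous (fun z : R * 'rV[R]_n => dvol a z.1 z.2)}.
Proof.
move=> It ax; apply: cvgM_at.
  by apply: cvgM_at; [exact: cvg_cst_at|exact: vol_joint].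
apply: cvg_sum_at => i _.
apply: (@cvg_mulmx_at _ _ _ (t, x) _ _ (fun z : R * 'rV[R]_n => invmx (g z.1 a z.2))
  (fun z : R * 'rV[R]_n => dmetric a (z.1, z.2))) => k l; first exact: inv_joint.
have := @dmetric_joint t a x k l It ax; apply: eq_continuous_at => z.
by rewrite -surjective_pairing.
Qed.

Lemma dvinv_joint a i j t x : I t -> chart_cod a x ->
  {for (t, x), continuous (fun z : R * 'rV[R]_n => dvinv a i j z.1 z.2)}.
Proof.
move=> It ax; apply: cvgD_at.
  by apply: cvgM_at; [exact: dvol_joint|exact: inv_joint].
apply: cvgM_at; first exact: vol_joint.
apply: cvgN_at.
apply: (@cvg_mulmx_at _ _ _ (t, x) _ _ (fun z : R * 'rV[R]_n =>
  invmx (g z.1 a z.2) *m dmetric a (z.1, z.2))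
  (fun z : R * 'rV[R]_n => invmx (g z.1 a z.2))) => k l; last exact: inv_joint.
apply: (@cvg_mulmx_at _ _ _ (t, x) _ _ (fun z : R * 'rV[R]_n => invmx (g z.1 a z.2))
  (fun z : R * 'rV[R]_n => dmetric a (z.1, z.2))) => k' l'; first exact: inv_joint.
have := @dmetric_joint t a x k' l' It ax; apply: eq_continuous_at => z.
by rewrite -surjective_pairing.
Qed.

Lemma vol_quotient_joint a t x : I t -> chart_cod a x ->
  {for (t, x), continuous (fun z : R * 'rV[R]_n => quotient (vol a) (dvol a) t z.1 z.2)}.
Proof.
move=> It ax; apply: quotient_continuous; last exact: dvol_joint.
by apply: filterS (nearI It ax) => z [Iz az]; exact: is_derive_vol.
Qed.

Lemma vinv_quotient_joint a i j t x : I t -> chart_cod a x ->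
  {for (t, x), continuous
    (fun z : R * 'rV[R]_n => quotient (vinv a i j) (dvinv a i j) t z.1 z.2)}.
Proof.
move=> It ax; apply: quotient_continuous; last exact: dvinv_joint.
by apply: filterS (nearI It ax) => z [Iz az]; exact: is_derive_vinv.
Qed.

Lemma vol_slice a t x : I t -> chart_cod a x -> {for x, continuous (vol a t)}.
Proof. by move=> It ax; exact: (continuous_slice (vol_joint It ax)). Qed.

Lemma vinv_slice a i j t x : I t -> chart_cod a x -> {for x, continuous (vinv a i j t)}.
Proof.
move=> It ax; apply: cvgM_at; first exact: vol_slice.
exact: (continuous_slice (@inv_joint a t x i j It ax)).
Qed.

Lemma quotient_slice (F dF : R -> 'rV[R]_n -> R) t0 t x :
  {for x, continuous (F t)} -> {for x, continuous (F t0)} ->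
  {for x, continuous (dF t0)} -> {for x, continuous (quotient F dF t0 t)}.
Proof.
move=> cF cF0 cdF0; rewrite /quotient; case: (t == t0) => //.
by apply: cvgM_at; [exact: cvg_cst_at|exact: cvgB_at].
Qed.

Lemma vol_quotient_slice a t0 t x : I t0 -> I t -> chart_cod a x ->
  {for x, continuous (quotient (vol a) (dvol a) t0 t)}.
Proof.
move=> It0 It ax; apply: quotient_slice; try exact: vol_slice.
exact: (continuous_slice (dvol_joint It0 ax)).
Qed.

Lemma vinv_quotient_slice a i j t0 t x : I t0 -> I t -> chart_cod a x ->
  {for x, continuous (quotient (vinv a i j) (dvinv a i j) t0 t)}.
Proof.
move=> It0 It ax; apply: quotient_slice; try exact: vinv_slice.
exact: (continuous_slice (@dvinv_joint a i j t0 x It0 ax)).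
Qed.

End Family.

(** * The derivative of the eigenvalue *)

(** The difference quotient of lam at t0 is N / B: the identity yields the
    differentiability of lam together with the value of its derivative. *)
Lemma is_derive_of_quotient (R : realType) (lam B N : R -> R) (t0 : R) :
  (\forall t \near t0, (lam t - lam t0) * B t = (t - t0) * N t) ->
  B t @[t --> t0] --> (1 : R) -> N t @[t --> t0] --> N t0 ->
  is_derive t0 1 lam (N t0).
Proof.
move=> E cB cN.
have B0 : \forall t \near t0, B t != 0.
  move/cvgrPdist_lt : cB => /(_ _ ltr01); apply: filterS => t.
  by apply: contraTneq => ->; rewrite subr0 normr1 ltxx.
have H : (fun h : R => h^-1 *: (lam (h *: 1 + t0) - lam t0)) @ 0^' --> N t0.
  have shift0 : (h + t0) @[h --> 0^'] --> t0.
    rewrite -[X in _ --> X]add0r; apply: cvgD; last exact: cvg_cst.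
    exact: cvg_within.
  have EB : \forall h \near 0^', (lam (h + t0) - lam t0) * B (h + t0) =
      (h + t0 - t0) * N (h + t0) /\ B (h + t0) != 0 := shift0 _ (filterI E B0).
  have cNB : N t * (B t)^-1 @[t --> t0] --> N t0.
    rewrite -[X in _ --> X]mulr1 -[X in _ * X]invr1.
    by apply: cvgM_at => //; apply: cvgV_at => //; exact: oner_neq0.
  have := cvg_comp _ _ shift0 cNB; apply: cvg_trans; apply: near_eq_cvg.
  near=> h.
  have h0 : h != 0 by near: h; exact: nbhs_dnbhs_neq.
  have [Eh Bh] : (lam (h + t0) - lam t0) * B (h + t0) = (h + t0 - t0) * N (h + t0) /\
      B (h + t0) != 0 by near: h; exact: EB.
  rewrite [h *: 1]mulr1 [_ *: _]mulrC /=; apply/eqP.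
  rewrite eqr_div// Eh addrK mulrC; exact/eqP.
by split; [apply/cvg_ex; exists (N t0)|apply: cvg_lim].
Unshelve. all: by end_near. Qed.

Section Representation.
Context {R : realType} {n : nat} {M : ptopologicalType} (A : smooth_atlas R n M).
Variables (g : tensor2 A) (dv : {measure set (borelType M) -> \bar R}).
Hypotheses (hausdorff_M : hausdorff_space M) (compact_M : compact [set: M]).
Hypothesis metric_g : riemannian_metric g.
Hypothesis C1_g : forall (a : chart_index A) i j, C1_on (chart_cod a) (fun x => g a x i j).
Hypothesis volume_dv : riemannian_volume g dv.
Variables (s : seq M) (chi : M -> M -> R) (K : M -> set M).
Hypothesis chiP : forall k, [/\ C1_M A (chi k), compact (K k),
  K k `<=` chart_dom (chart_at A k) & forall q, ~ K k q -> chi k q = 0].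
Hypothesis chi1 : forall q, \sum_(k <- s) chi k q = 1.

Let integrable_cont := integrable_continuous hausdorff_M compact_M metric_g C1_g volume_dv.

Let chiF_cont (F : M -> R) k : continuous F -> continuous (fun p => chi k p * F p).
Proof.
have [Cchi _ _ _] := chiP k.
by move=> cF p; apply: cvgM_at; [exact: C1_M_continuous Cchi _|exact: cF].
Qed.

Lemma piece_integrable (F : M -> R) k : continuous F ->
  (lebesgue_rV R n).-integrable setT (EFin \o (fun x =>
     pull (chart_at A k) (chi k) x * (F (param (chart_at A k) x) *
       vol_density (g (chart_at A k)) x))).
Proof.
move=> cF; have [Cchi cK Ka chi0] := chiP k.
have chiF0 p : ~ K k p -> chi k p * F p = 0 by move=> /chi0 ->; rewrite mul0r.
have := integrable_pull_vol metric_g C1_g cK Ka (@chiF_cont F k cF) chiF0.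
apply: eq_integrable => // x _; rewrite /= /pull; congr (_%:E).
by rewrite !mulrA.
Qed.

Lemma integral_partition (F : M -> R) : continuous F ->
  \int[dv]_p F p = \sum_(k <- s) \int[lebesgue_rV R n]_x
    (pull (chart_at A k) (chi k) x * (F (param (chart_at A k) x) *
       vol_density (g (chart_at A k)) x)).
Proof.
move=> cF.
have piece k : (\int[dv]_p (chi k p * F p)%:E = (\int[lebesgue_rV R n]_x
    (pull (chart_at A k) (chi k) x * (F (param (chart_at A k) x) *
       vol_density (g (chart_at A k)) x))%R)%:E)%E.
  have [Cchi cK Ka chi0] := chiP k.
  have chiF0 p : ~ K k p -> chi k p * F p = 0 by move=> /chi0 ->; rewrite mul0r.
  have [_ ->] := integral_chart metric_g C1_g volume_dv cK Ka (@chiF_cont F k cF) chiF0.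
  rewrite /Rintegral fineK; last exact: integrable_fin_num (@piece_integrable F k cF).
  by apply: eq_integral => x _; rewrite /pull !mulrA.
rewrite {1}/Rintegral.
have -> : (fun p => (F p)%:E) = (fun p => \sum_(k <- s) (chi k p * F p)%:E)%E.
  by apply/funext => p; rewrite sumEFin -mulr_suml chi1 mul1r.
rewrite integral_sum//; last by move=> k; exact: integrable_cont (@chiF_cont F k cF).
by under eq_bigr do rewrite piece; rewrite sumEFin.
Qed.

End Representation.

Lemma Rintegral_combination {d} {T : measurableType d} {R : realType}
    (mu : {measure set T -> \bar R}) (c e : R) (f1 f2 f3 f4 : T -> R) :
  mu.-integrable setT (EFin \o f1) -> mu.-integrable setT (EFin \o f2) ->
  mu.-integrable setT (EFin \o f3) -> mu.-integrable setT (EFin \o f4) ->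
  \int[mu]_x (c * (f1 x - f2 x - e * (f3 x - f4 x))) =
  c * (\int[mu]_x f1 x - \int[mu]_x f2 x - e * (\int[mu]_x f3 x - \int[mu]_x f4 x)).
Proof.
move=> i1 i2 i3 i4.
have i12 : mu.-integrable setT (EFin \o (f1 \- f2)) by exact: (integrableB measurableT i1 i2).
have i34 : mu.-integrable setT (EFin \o (f3 \- f4)) by exact: (integrableB measurableT i3 i4).
have ie34 : mu.-integrable setT (EFin \o (fun x => e * (f3 x - f4 x))).
  exact: (integrableZl measurableT e i34).
have i : mu.-integrable setT (EFin \o (fun x => f1 x - f2 x - e * (f3 x - f4 x))).
  exact: (integrableB measurableT i12 ie34).
by rewrite RintegralZl// !RintegralB// RintegralZl// RintegralB.
Qed.

Section Main.
Context {R : realType} {n : nat} {M : ptopologicalType} {A : smooth_atlas R n M}.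
Hypotheses (n_gt0 : (0 < n)%N).
Hypotheses (hausdorff_M : hausdorff_space M) (compact_M : compact [set: M]).
Variables (alpha : R) (I : set R) (r : R -> R) (g : R -> tensor2 A) (phi : R -> M -> R).
Hypotheses (open_I : open I) (smooth_g : smooth_metric_family I g).
Hypothesis flow : rescaled_List_flow alpha I r g phi.
Variable dv : R -> {measure set (borelType M) -> \bar R}.
Hypothesis volume_dv : forall t, I t -> riemannian_volume (g t) (dv t).
Variables (lambda : R -> R) (u : R -> M -> R).
Hypothesis diff_u : differentiable_C2_family A I u.
Hypothesis eigen_u : forall t, I t ->
  normalized_eigenfunction (g t) (dv t) (lambda t) (u t).
Implicit Types (a b : chart_index A) (t : R) (x : 'rV[R]_n).

Let metric_t t (It : I t) : riemannian_metric (g t) := smooth_g.1 t It.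
Let C1_t t (It : I t) : forall a i j, C1_on (chart_cod a) (fun x => g t a x i j).
Proof. by move=> a i j; apply: (family_C1 smooth_g). Qed.

Lemma C1_M_u t : I t -> C1_M A (u t).
Proof.
move=> It a; apply: (C1_onI (@open_chart_cod _ _ _ A a)
  (D := fun i => partial i (u t \o param a))) => x i ax.
  have [d _ _] := diff_u (s := [::]) isT It ax.
  exact: derivableP (d isT _).
have [_ c _] := diff_u (s := [:: delta_mx 0 i]) isT It ax.
exact: (continuous_slice c).
Qed.

Lemma C1_partial_u t a j : I t -> C1_on (chart_cod a) (partial j (u t \o param a)).
Proof.
move=> It; apply: (C1_onI (@open_chart_cod _ _ _ A a)
  (D := fun i => partial i (partial j (u t \o param a)))) => x i ax.
  have [d _ _] := diff_u (s := [:: delta_mx 0 j]) isT It ax.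
  exact: derivableP (d isT _).
have [_ c _] := diff_u (s := [:: delta_mx 0 i; delta_mx 0 j]) isT It ax.
exact: (continuous_slice c).
Qed.

Lemma u_joint t a x : I t -> chart_cod a x ->
  {for (t, x), continuous (fun z : R * 'rV[R]_n => u z.1 (param a z.2))}.
Proof. by move=> It ax; have [_ c _] := diff_u (s := [::]) isT It ax. Qed.

Lemma partial_u_joint t a x i : I t -> chart_cod a x ->
  {for (t, x), continuous (fun z : R * 'rV[R]_n => partial i (u z.1 \o param a) z.2)}.
Proof.
by move=> It ax; have [_ c _] := diff_u (s := [:: delta_mx 0 i]) isT It ax.
Qed.

Let integrable_t t (It : I t) := integrable_continuous hausdorff_M compact_M
  (metric_t It) (C1_t It) (volume_dv It).

Let green_t t (It : I t) (w : M -> R) : C1_M A w ->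
  \int[dv t]_p grad_ip (g t) w (u t) p = lambda t * \int[dv t]_p (w p * u t p).
Proof.
move=> Cw; have [eig _] := eigen_u It.
have cwu : continuous (fun p => w p * u t p).
  by move=> p; apply: cvgM_at; apply: C1_M_continuous => //; exact: C1_M_u.
rewrite /Rintegral (green hausdorff_M compact_M (metric_t It) (C1_t It) (volume_dv It)
  (C1_M_u It) (fun a j => C1_partial_u j It) eig Cw).
rewrite -[RHS](RintegralZl _ _ (integrable_t It cwu))//.
Qed.

Variable t0 : R.
Hypothesis It0 : I t0.
Let u0 := u t0.
Let l0 := lambda t0.
Let Cu0 := C1_M_u It0.

Let near_I : \forall t \near t0, I t.
Proof. by apply: open_nbhs_nbhs. Qed.

Let du a x := grad (u0 \o param a) x.

(** The first variation in time of |grad u0|^2 dv - l0 u0^2 dv with u0 held fixed,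
    relative to dv.  Its continuity is plain from this expression; that it does
    not depend on the chart is seen on the tensorial form [variation_densityE]. *)
Let variation_density a x : R := (vol g a t0 x)^-1 *
  (\sum_i \sum_j dvinv g a i j t0 x * partial i (u0 \o param a) x * partial j (u0 \o param a) x
   - l0 * (dvol g a t0 x * u0 (param a x) ^+ 2)).

Let vol_neq0 a x : chart_cod a x -> vol g a t0 x != 0.
Proof.
by move=> ax; rewrite gt_eqF// sqrtr_gt0; exact/posdef_det_gt0/(metric_posdef (metric_t It0) ax).
Qed.

Let variation_densityE a x : chart_cod a x -> variation_density a x =
  2^-1 * metric_trace (g t0 a x) (dmetric g a (t0, x)) *
    (dual_form (g t0 a x) (du a x) (du a x) - l0 * u0 (param a x) ^+ 2)
  - raised_form (g t0 a x) (dmetric g a (t0, x)) (du a x) (du a x).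
Proof.
move=> ax; have v0 := vol_neq0 ax.
set P := invmx (g t0 a x) *m dmetric g a (t0, x) *m invmx (g t0 a x).
have E : \sum_i \sum_j dvinv g a i j t0 x * partial i (u0 \o param a) x *
     partial j (u0 \o param a) x = dvol g a t0 x * dual_form (g t0 a x) (du a x) (du a x)
   - vol g a t0 x * raised_form (g t0 a x) (dmetric g a (t0, x)) (du a x) (du a x).
  have -> : raised_form (g t0 a x) (dmetric g a (t0, x)) (du a x) (du a x) =
      ((du a x)^T *m P *m du a x) 0 0 by rewrite /raised_form /P !mulmxA.
  rewrite bilinear_formE -dual_formE !mulr_sumr -sumrB; apply: eq_bigr => i _.
  rewrite !mulr_sumr -sumrB; apply: eq_bigr => j _.
  rewrite /dvinv -/P /du ![grad _ _ _ _]mxE; ring.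
rewrite /variation_density E /dvol; field.
by rewrite v0.
Qed.

Let variation := scalar_at variation_density.

Let variation_compat a b p : chart_dom a p -> chart_dom b p ->
  variation_density a (chart a p) = variation_density b (chart b p).
Proof.
move=> ap bp; have E := metric_change_chart (metric_t It0) ap bp.
have uB := metric_unitmx (metric_t It0) (chart_cod_chart ap).
rewrite (variation_densityE (chart_cod_chart ap)) (variation_densityE (chart_cod_chart bp)).
rewrite (dmetric_change_chart open_I smooth_g It0 ap bp) /du.
rewrite (grad_change_chart ap bp Cu0) (metric_trace_congruence uB E).
by rewrite (dual_form_congruence uB E) (raised_form_congruence uB E) !chartK.
Qed.

Let variation_continuous : continuous variation.
Proof.
apply: scalar_at_continuous; first exact: variation_compat.
move=> a x ax; apply: cvgM_at.
  by apply: cvgV_at; [exact: vol_neq0|exact: (vol_slice smooth_g It0 ax)].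
have cp i : {for x, continuous (partial i (u0 \o param a))}.
  exact: (C1_partial_continuous (Cu0 (a := a)) ax).
have c0 : continuous u0 := C1_M_continuous Cu0.
have cu := continuous_param_comp ax (c0 (param a x)).
apply: cvgB_at.
  apply: cvg_sum_at => i _; apply: cvg_sum_at => j _; apply: cvgM_at; last exact: cp.
  apply: cvgM_at; last exact: cp.
  have c := dvinv_joint open_I smooth_g (i := i) (j := j) It0 ax.
  exact: (continuous_slice c).
apply: cvgM_at; first exact: cvg_cst_at.
apply: cvgM_at; first exact: (continuous_slice (dvol_joint open_I smooth_g It0 ax)).
under eq_fun do rewrite expr2; rewrite expr2.
by apply: cvgM_at.
Qed.

Section Partitioned.
Variables (s : seq M) (chi : M -> M -> R) (K : M -> set M).
Hypothesis chiP : forall k, [/\ C1_M A (chi k), compact (K k),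
  K k `<=` chart_dom (chart_at A k) & forall q, ~ K k q -> chi k q = 0].
Hypothesis chi1 : forall q, \sum_(k <- s) chi k q = 1.

Let ch k := chart_at A k.

(** The integrands, in the chart of k, of N(t) and below of B(t), where
    (lambda t - l0) * B(t) = (t - t0) * N(t). *)
Let Phi k t x : R := pull (ch k) (chi k) x *
  (\sum_i \sum_j quotient (vinv g (ch k) i j) (dvinv g (ch k) i j) t0 t x *
     partial i (u0 \o param (ch k)) x * partial j (u t \o param (ch k)) x
   - l0 * (quotient (vol g (ch k)) (dvol g (ch k)) t0 t x *
       (u0 (param (ch k) x) * u t (param (ch k) x)))).

Let Psi k t x : R := pull (ch k) (chi k) x *
  (u0 (param (ch k) x) * u t (param (ch k) x) * vol g (ch k) t x).

Let pull_chi0 k x : ~ (chart (ch k) @` K k) x -> pull (ch k) (chi k) x = 0.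
Proof. by have [_ _ _ chi0] := chiP k; exact: pull_support. Qed.

Let pull_chi_cont k x : chart_cod (ch k) x -> {for x, continuous (pull (ch k) (chi k))}.
Proof.
move=> ax; apply: continuous_pull => //.
by have [Cchi _ _ _] := chiP k; exact: C1_M_continuous Cchi _.
Qed.

Let Kc k : compact (chart (ch k) @` K k).
Proof. by have [_ cK Ka _] := chiP k; exact: chart_compact. Qed.

Let Kcod k : chart (ch k) @` K k `<=` chart_cod (ch k).
Proof. by have [_ _ Ka _] := chiP k; exact: chart_image_cod. Qed.

Let joint_snd (F : 'rV[R]_n -> R) x : {for x, continuous F} ->
  {for (t0, x), continuous (fun z : R * 'rV[R]_n => F z.2)}.
Proof.
move=> cF B /cF nB; exists (setT, F @^-1` B); last by move=> z [].
by split=> //; exact: filterT.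
Qed.

Let u0_param_cont k x : chart_cod (ch k) x ->
  {for x, continuous (fun x => u0 (param (ch k) x))}.
Proof.
move=> ax; have c0 : continuous u0 := C1_M_continuous Cu0.
exact: (continuous_param_comp ax (c0 (param (ch k) x))).
Qed.

Let partial_u0_cont k i x : chart_cod (ch k) x ->
  {for x, continuous (partial i (u0 \o param (ch k)))}.
Proof. by move=> ax; exact: (C1_partial_continuous (Cu0 (a := ch k)) ax). Qed.

Let Phi_limit k :
  \int[lebesgue_rV R n]_x Phi k t x @[t --> t0] --> \int[lebesgue_rV R n]_x Phi k t0 x.
Proof.
apply: (integral_limit (Kc (k := k))).
- move=> x /Kcod ax; apply: cvgM_at.
    exact: (joint_snd (F := pull (ch k) (chi k)) (pull_chi_cont ax)).
  apply: cvgB_at.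
    apply: cvg_sum_at => i _; apply: cvg_sum_at => j _; apply: cvgM_at; last exact: partial_u_joint.
    apply: cvgM_at; first exact: (vinv_quotient_joint open_I smooth_g It0 ax).
    exact: (joint_snd (F := partial i (u0 \o param (ch k))) (partial_u0_cont ax)).
  apply: cvgM_at; first exact: cvg_cst_at.
  apply: cvgM_at; first exact: (vol_quotient_joint open_I smooth_g It0 ax).
  by apply: cvgM_at; [exact: (joint_snd (F := fun x => u0 (param (ch k) x)) (u0_param_cont ax))|exact: u_joint].
- by move=> t x nKx; rewrite /Phi pull_chi0// mul0r.
apply: filterS near_I => t It.
apply: (@compact_support_continuous _ _ _ (chart_cod (ch k)) (chart (ch k) @` K k)).
- exact: norm_hausdorff.
- exact: Kc.
- exact: Kcod.
- move=> x ax; apply: cvgM_at; first exact: pull_chi_cont.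
  apply: cvgB_at.
    apply: cvg_sum_at => i _; apply: cvg_sum_at => j _; apply: cvgM_at.
      apply: cvgM_at; first exact: (vinv_quotient_slice open_I smooth_g It0 It ax).
      exact: partial_u0_cont.
    exact: (C1_partial_continuous (C1_M_u It (a := ch k)) ax).
  apply: cvgM_at; first exact: cvg_cst_at.
  apply: cvgM_at; first exact: (vol_quotient_slice open_I smooth_g It0 It ax).
  apply: cvgM_at; first exact: u0_param_cont.
  exact: (C1_continuous (@open_chart_cod _ _ _ A (ch k)) (C1_M_u It (a := ch k)) ax).
- by move=> x nKx; rewrite /Phi pull_chi0// mul0r.
Qed.

Let Psi_limit k :
  \int[lebesgue_rV R n]_x Psi k t x @[t --> t0] --> \int[lebesgue_rV R n]_x Psi k t0 x.
Proof.
apply: (integral_limit (Kc (k := k))).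
- move=> x /Kcod ax; apply: cvgM_at.
    exact: (joint_snd (F := pull (ch k) (chi k)) (pull_chi_cont ax)).
  apply: cvgM_at; last exact: (vol_joint smooth_g It0 ax).
  by apply: cvgM_at; [exact: (joint_snd (F := fun x => u0 (param (ch k) x)) (u0_param_cont ax))|exact: u_joint].
- by move=> t x nKx; rewrite /Psi pull_chi0// mul0r.
apply: filterS near_I => t It.
apply: (@compact_support_continuous _ _ _ (chart_cod (ch k)) (chart (ch k) @` K k)).
- exact: norm_hausdorff.
- exact: Kc.
- exact: Kcod.
- move=> x ax; apply: cvgM_at; first exact: pull_chi_cont.
  apply: cvgM_at; last exact: (vol_slice smooth_g It ax).
  apply: cvgM_at; first exact: u0_param_cont.
  exact: (C1_continuous (@open_chart_cod _ _ _ A (ch k)) (C1_M_u It (a := ch k)) ax).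
- by move=> x nKx; rewrite /Psi pull_chi0// mul0r.
Qed.

Let B t := \sum_(k <- s) \int[lebesgue_rV R n]_x Psi k t x.
Let N t := \sum_(k <- s) \int[lebesgue_rV R n]_x Phi k t x.

Let partition_t t (It : I t) (F : M -> R) (cF : continuous F) :=
  integral_partition hausdorff_M compact_M (metric_t It) (C1_t It) (volume_dv It)
    chiP chi1 cF.
Let integrable_piece t (It : I t) (F : M -> R) (cF : continuous F) k :=
  piece_integrable (metric_t It) (C1_t It) chiP k cF.

Let C_u t (It : I t) : continuous (u t) := C1_M_continuous (C1_M_u It).

Let C_mul (F G : M -> R) : continuous F -> continuous G -> continuous (fun p => F p * G p).
Proof. by move=> cF cG p; apply: cvgM_at; [exact: cF|exact: cG]. Qed.

Let BE t (It : I t) : B t = \int[dv t]_p (u0 p * u t p).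
Proof. exact: esym (partition_t It (C_mul (C_u It0) (C_u It))). Qed.

Let B_limit : B t @[t --> t0] --> (1 : R).
Proof.
have <- : B t0 = 1.
  by rewrite BE//; have [_ <-] := eigen_u It0; apply: eq_Rintegral => p _; rewrite expr2.
by apply: cvg_sum_at => k _; exact: Psi_limit.
Qed.

Let N_limit : N t @[t --> t0] --> N t0.
Proof. by apply: cvg_sum_at => k _; exact: Phi_limit. Qed.

Let integral_Phi k t : I t -> t != t0 ->
  let int t' F := \int[lebesgue_rV R n]_x
    (pull (ch k) (chi k) x * (F (param (ch k) x) * vol_density (g t' (ch k)) x)) in
  \int[lebesgue_rV R n]_x Phi k t x = (t - t0)^-1 *
   (int t (grad_ip (g t) u0 (u t)) - int t0 (grad_ip (g t0) (u t) u0)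
    - l0 * (int t (fun p => u0 p * u t p) - int t0 (fun p => u t p * u0 p))).
Proof.
move=> It tt0 /=.
have i1 := integrable_piece It (grad_ip_continuous (metric_t It) (C1_t It) Cu0 (C1_M_u It)) k.
have i2 := integrable_piece It0 (grad_ip_continuous (metric_t It0) (C1_t It0) (C1_M_u It) Cu0) k.
have i3 := integrable_piece It (C_mul (C_u It0) (C_u It)) k.
have i4 := integrable_piece It0 (C_mul (C_u It) (C_u It0)) k.
rewrite -(Rintegral_combination _ _ i1 i2 i3 i4).
apply: eq_Rintegral => x _; rewrite /Phi.
have [ax|nax] := pselect (chart_cod (ch k) x); last first.
  by rewrite (pull_out _ nax) !mul0r !subrr !mulr0 subrr mulr0.
rewrite (grad_ip_param (metric_t It) Cu0 (C1_M_u It) ax).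
rewrite (grad_ip_param (metric_t It0) (C1_M_u It) Cu0 ax).
rewrite [dual_form (g t0 _ _) _ _]dual_form_sym; last exact: metric_symm (metric_t It0) _ _ ax.
rewrite -!dual_formE /quotient (negbTE tt0).
have -> : \sum_i \sum_j (t - t0)^-1 * (vinv g (ch k) i j t x - vinv g (ch k) i j t0 x) *
     partial i (u0 \o param (ch k)) x * partial j (u t \o param (ch k)) x =
   (t - t0)^-1 * (vol g (ch k) t x * \sum_i \sum_j metric_inv (g t (ch k)) x i j *
     partial i (u0 \o param (ch k)) x * partial j (u t \o param (ch k)) x -
   vol g (ch k) t0 x * \sum_i \sum_j metric_inv (g t0 (ch k)) x i j *
     partial i (u0 \o param (ch k)) x * partial j (u t \o param (ch k)) x).
  rewrite !mulr_sumr -sumrB mulr_sumr; apply: eq_bigr => i _.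
  rewrite !mulr_sumr -sumrB mulr_sumr; apply: eq_bigr => j _.
  rewrite /vinv; ring.
rewrite /vol /ch /u0; ring.
Qed.

(** Green's formula is used twice: at time t for u t against u0, and at time t0 for
    u0 against u t. *)
Let difference_quotient : \forall t \near t0, (lambda t - l0) * B t = (t - t0) * N t.
Proof.
apply: filterS near_I => t It.
have [->|tt0] := eqVneq t t0; first by rewrite !subrr !mul0r.
rewrite /N; under eq_bigr do rewrite (integral_Phi _ It tt0).
rewrite -mulr_sumr mulrA divff ?subr_eq0// mul1r !sumrB -mulr_sumr sumrB.
rewrite -(partition_t It (grad_ip_continuous (metric_t It) (C1_t It) Cu0 (C1_M_u It))).
rewrite -(partition_t It0 (grad_ip_continuous (metric_t It0) (C1_t It0) (C1_M_u It) Cu0)).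
rewrite -(partition_t It (C_mul (C_u It0) (C_u It))).
rewrite -(partition_t It0 (C_mul (C_u It) (C_u It0))).
rewrite (green_t It Cu0) (green_t It0 (C1_M_u It)) BE// -/u0 -/l0; ring.
Qed.

Lemma is_derive_lambda_charts : is_derive t0 1 lambda (\int[dv t0]_p variation p).
Proof.
have -> : \int[dv t0]_p variation p = N t0.
  rewrite (partition_t It0 variation_continuous); apply: eq_bigr => k _.
  apply: eq_Rintegral => x _; rewrite /Phi.
  have [ax|nax] := pselect (chart_cod (ch k) x); last first.
    by rewrite (pull_out _ nax) !mul0r.
  rewrite /variation (scalar_at_param variation_compat ax) /variation_density /quotient eqxx /ch /vol.
  have := vol_neq0 ax; rewrite /vol /ch => v0.
  congr (_ * _); rewrite [LHS]mulrAC mulVf// mul1r; congr (_ - _ * (_ * _)).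
exact: is_derive_of_quotient difference_quotient B_limit N_limit.
Qed.

End Partitioned.

Lemma is_derive_lambda : is_derive t0 1 lambda (\int[dv t0]_p variation p).
Proof.
have [s [chi [K [chiP chi1]]]] := partition_of_unity A hausdorff_M compact_M.
exact: is_derive_lambda_charts chiP chi1.
Qed.

(** The equation of the flow, solved for S_ij; both sides of it are derivatives
    of the same function of time. *)
Let S_matrix_flow a x : chart_cod a x ->
  S_matrix alpha (g t0 a) (phi t0 \o param a) x =
  (- 2^-1) *: dmetric g a (t0, x) + (r t0 / n%:R) *: g t0 a x.
Proof.
move=> ax; apply/matrixP => i j; rewrite mxE [RHS]mxE [X in _ = X + _]mxE [X in _ = _ + X]mxE.
have D1 := is_derive_metric smooth_g i j It0 ax.
have [/(_ i j) D2 _] := flow It0 ax.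
rewrite -(@derive_val _ _ _ _ _ _ _ D1) (@derive_val _ _ _ _ _ _ _ D2); field.
by rewrite pnatr_eq0 -lt0n.
Qed.

Let grad2 : M -> R := grad_ip (g t0) u0 u0.

Let grad_sqE p : grad_sq_field (g t0) u0 p = grad2 p.
Proof. by rewrite /grad_sq_field /grad2 /grad_ip /scalar_at /grad_sq dual_formE. Qed.

(** The terms in r come from the metric part of S_ij: g has trace n, and raising
    both of its indices gives |grad u0|^2. *)
Let integrandE p :
  l0 * S_field alpha (g t0) (phi t0) p * u0 p ^+ 2
    - S_field alpha (g t0) (phi t0) p * grad2 p
    + 2 * S_grad_grad_field alpha (g t0) (phi t0) u0 p =
  variation p + l0 * r t0 * u0 p ^+ 2 + (2 * r t0 / n%:R - r t0) * grad2 p.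
Proof.
set a := chart_at A p; have ax := chart_cod_chart (chart_at_dom A p).
have uB := metric_unitmx (metric_t It0) ax.
have sB := metric_symm (metric_t It0) ax.
rewrite /S_field /S_grad_grad_field /variation /grad2 /grad_ip /scalar_at -/a.
rewrite (S_scalarE _ _ sB) (S_grad_gradE _ _ _ sB) (S_matrix_flow ax) (variation_densityE ax).
rewrite metric_traceD raised_formD metric_trace_self// raised_form_self//.
rewrite (chartK (chart_at_dom A p)) -/(du _ _); field.
by rewrite pnatr_eq0 -lt0n.
Qed.

Lemma eigenvalue_evolution : is_derive t0 1 lambda
  (- (2 * r t0 / n%:R) * lambda t0 + \int[dv t0]_p
     (lambda t0 * S_field alpha (g t0) (phi t0) p * u t0 p ^+ 2
      - S_field alpha (g t0) (phi t0) p * grad_sq_field (g t0) (u t0) p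
      + 2 * S_grad_grad_field alpha (g t0) (phi t0) (u t0) p)).
Proof.
apply: is_derive_eq is_derive_lambda _.
have c0 : continuous u0 := C1_M_continuous Cu0.
have c2 : continuous (fun p => u0 p ^+ 2).
  have -> : (fun p => u0 p ^+ 2) = (fun p => u0 p * u0 p) by apply/funext => p; rewrite expr2.
  by move=> p; apply: cvgM_at; exact: c0.
have cg : continuous grad2 := grad_ip_continuous (metric_t It0) (C1_t It0) Cu0 Cu0.
transitivity (- (2 * r t0 / n%:R) * l0 + \int[dv t0]_p
    (variation p + l0 * r t0 * u0 p ^+ 2 + (2 * r t0 / n%:R - r t0) * grad2 p)); last first.
  by congr (_ + _); apply: eq_Rintegral => p _; rewrite -integrandE -grad_sqE.
have iv := integrable_t It0 variation_continuous.
have iu := integrableZl measurableT (l0 * r t0) (integrable_t It0 c2).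
have ig := integrableZl measurableT (2 * r t0 / n%:R - r t0) (integrable_t It0 cg).
rewrite RintegralD//; last exact: (integrableD measurableT iv iu).
rewrite RintegralD// !RintegralZl//; try exact: integrable_t.
have [_ ->] := eigen_u It0; rewrite (green_t It0 Cu0).
have -> : \int[dv t0]_p (u0 p * u t0 p) = 1.
  by have [_ <-] := eigen_u It0; apply: eq_Rintegral => p _; rewrite expr2.
rewrite -/l0; ring.
Qed.

End Main.

Theorem theorem1p1 (R : realType) (n : nat) (n_gt0 : (0 < n)%N)
    (M : ptopologicalType) (A : smooth_atlas R n M)
    (hausdorff_M : hausdorff_space M) (compact_M : compact [set: M])
    (alpha : R) (alpha_gt0 : 0 < alpha)
    (I : set R) (open_I : open I) (itv_I : is_interval I)
    (r : R -> R) (g : R -> tensor2 A) (phi : R -> M -> R)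
    (smooth_g : smooth_metric_family I g)
    (smooth_phi : smooth_function_family A I phi)
    (flow : rescaled_List_flow alpha I r g phi)
    (dv : R -> {measure set (borelType M) -> \bar R})
    (volume_dv : forall t, I t -> riemannian_volume (g t) (dv t))
    (lambda : R -> R) (u : R -> M -> R)
    (diff_u : differentiable_C2_family A I u)
    (eigen_u : forall t, I t ->
       normalized_eigenfunction (g t) (dv t) (lambda t) (u t)) :
  forall t, I t ->
    is_derive t 1 lambda
      (- (2 * r t / n%:R) * lambda t
       + \int[dv t]_p
           (lambda t * S_field alpha (g t) (phi t) p * u t p ^+ 2
            - S_field alpha (g t) (phi t) p * grad_sq_field (g t) (u t) p
            + 2 * S_grad_grad_field alpha (g t) (phi t) (u t) p)).
Proof.
move=> t It.
exact: (eigenvalue_evolution n_gt0 hausdorff_M compact_M open_I smooth_g flow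
  volume_dv diff_u eigen_u It).
Qed.
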